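(* Let $m\geqslant n$. Then the image of the $n$-th graded component of the ring $\mathcal{D}^*$ in the ring $\mathrm{Qsym}[t_1,\dots,t_m]$ under the map $R_m^*$ consists of all homogeneous polynomials $g\in\mathrm{Qsym}[t_1,\dots,t_m]$ of degree $n$ satisfying the relations $$g(t_1,\dots,t_{q-1},t_q,-t_q,t_{q+2},\dots,t_m)=g(t_1,\dots,t_{q-1},0,0,t_{q+2},\dots,t_m),\qquad q=1,\dots,m-1.$$
   Context: A combinatorial polytope is a combinatorial equivalence class of convex polytopes. The ring of polytopes $\mathcal{P}$ is, as an abelian group, free on all (non-empty) combinatorial polytopes, with multiplication the direct product and unit the point. The operator $d_k$ sends an $n$-dimensional polytope to the sum of all its $(n-k)$-dimensional (non-empty) faces ($d_0=\mathrm{id}$). $\mathcal{D}\subset\mathrm{Hom}_{\mathbb Z}(\mathcal{P},\mathcal{P})$ is the subring (under composition) generated by $d_k$, $k\ge1$; it is a graded Hopf algebra with $\deg d_k=k$, $\Delta d_k=\sum_{i+j=k}d_i\otimes d_j$, and $\mathcal{D}^*$ is its graded dual Hopf algebra over $\mathbb{Z}$. For a composition $\omega=(j_1,\dots,j_k)$, $j_i\ge1$, $M_\omega=\sum_{l_1<\dots<l_k}t_{l_1}^{j_1}\cdots t_{l_k}^{j_k}$; $\mathrm{Qsym}[t_1,\dots,t_m]$ is the ring of integer combinations of the $M_\omega(t_1,\dots,t_m)$ (and constants), with $\deg t_i=1$. With $\Phi(t)=\sum_{k\ge0}d_kt^k$, the ring homomorphism $R_m^*:\mathcal{D}^*\to\mathrm{Qsym}[t_1,\dots,t_m]$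 is $R_m^*\psi=\psi(\Phi(t_m)\cdots\Phi(t_1))$, where $\psi$ is applied coefficientwise; i.e. $R_m^*\psi=\sum_{\omega=(j_1,\dots,j_k)}\psi(d_{j_k}\cdots d_{j_1})\,M_\omega(t_1,\dots,t_m)$. *)

(* Defs.v *)
Set Warnings "-notation-overridden,-ambiguous-paths,-notation-incompatible-prefix,-redundant-canonical-projection,-projection-no-head-constant".
From HB Require Import structures.
From mathcomp Require Import all_boot all_order all_algebra.
From mathcomp Require Import boolp classical_sets functions cardinality fsbigop.
From mathcomp Require Import reals freeg mpoly.

Set Implicit Arguments.
Unset Strict Implicit.
Unset Printing Implicit Defensive.

Import Order.TTheory GRing.Theory Num.Theory.
Local Open Scope classical_set_scope.
Local Open Scope ring_scope.

(* Repetitions in [s] are harmless: they only rescale the coefficients. *)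
Definition conv (R : realType) (N : nat) (s : seq 'rV[R]_N) : set 'rV[R]_N :=
  [set x | exists a : 'rV[R]_N -> R,
    [/\ forall v, v \in s -> 0 <= a v,
        \sum_(v <- s) a v = 1 & \sum_(v <- s) a v *: v = x]].

Definition is_polytope (R : realType) (N : nat) (A : set 'rV[R]_N) : Prop :=
  exists2 s : seq 'rV[R]_N, s != [::] & A = conv s.

(* The intersections of [P] with {c . x = b}, where c . x <= b is valid on [P];
   (c, b) = (0, 1) and (0, 0) give the empty face and [P] itself. *)
Definition is_face (R : realType) (N : nat) (P F : set 'rV[R]_N) : Prop :=
  exists (c : 'cV[R]_N) (b : R),
    (forall x, P x -> (x *m c) 0 0 <= b) /\
    F = P `&` [set x | (x *m c) 0 0 = b].

Definition has_aff_indep (R : realType) (N : nat) (A : set 'rV[R]_N) (k : nat) :=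
  exists (x : 'rV[R]_N) (M : 'M[R]_(k, N)),
    [/\ A x, forall i, A (x + row i M) & row_free M].

(* The largest k such that [A] contains k + 1 affinely independent points. *)
Definition adim (R : realType) (N : nat) (A : set 'rV[R]_N) : nat :=
  \max_(k < N.+1 | `[< has_aff_indep A k >]) k.

Record polytope_in (R : realType) (N : nat) := PolytopeIn {
  pset :> set 'rV[R]_N;
  psetP : is_polytope pset }.

HB.instance Definition _ (R : realType) (N : nat) :=
  gen_eqMixin (polytope_in R N).
HB.instance Definition _ (R : realType) (N : nat) :=
  gen_choiceMixin (polytope_in R N).

Record polytope (R : realType) := Polytope {
  ambient : nat;
  body :> polytope_in R ambient }.

HB.instance Definition _ (R : realType) := gen_eqMixin (polytope R).
HB.instance Definition _ (R : realType) := gen_choiceMixin (polytope R).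

Definition comb_equiv (R : realType) (P Q : polytope R) : Prop :=
  exists f : set 'rV[R]_(ambient P) -> set 'rV[R]_(ambient Q),
    set_bij [set F | is_face P F] [set G | is_face Q G] f /\
    forall F G, is_face P F -> is_face P G -> (F `<=` G <-> f F `<=` f G).

Lemma comb_equiv_refl (R : realType) (P : polytope R) : comb_equiv P P.
Proof.
exists id; split=> //; split; [by []|by []|by move=> F hF; exists F].
Qed.

Lemma comb_equiv_sym (R : realType) (P Q : polytope R) :
  comb_equiv P Q -> comb_equiv Q P.
Proof.
move=> [f [[ff fi fs] fm]].
have /choice[g gP] G : exists F, is_face Q G -> is_face P F /\ f F = G.
  have [/fs[F hF <-]|hG] := pselect (is_face Q G); first by exists F.
  by exists set0.
exists g; split; last first.
  move=> F G hF hG; have [h1 e1] := gP _ hF; have [h2 e2] := gP _ hG.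
  by rewrite fm // e1 e2.
split.
- by move=> G /gP[].
- move=> F G; rewrite !inE => /= /gP[_ e1] /gP[_ e2] e.
  by rewrite -e1 -e2 e.
- move=> F hF; exists (f F); first exact: ff.
  have hfF : is_face Q (f F) by apply: ff.
  have [h1 e1] := gP _ hfF.
  by apply: fi; rewrite ?inE.
Qed.

Lemma comb_equiv_trans (R : realType) (P Q S : polytope R) :
  comb_equiv P Q -> comb_equiv Q S -> comb_equiv P S.
Proof.
move=> [f [[ff fi fs] fm]] [g [[gf gi gs] gm]].
exists (g \o f); split; last first.
  move=> F G hF hG; rewrite fm //; apply: gm; exact: ff.
split.
- by move=> F /ff /gf.
- move=> F G hF hG /= e; apply: fi => //.
  by apply: gi => //; apply/mem_set/ff/set_mem.
- by move=> H /gs[G /fs[F hF <-] <-]; exists F.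
Qed.

Definition comb_equivb (R : realType) : rel (polytope R) :=
  fun P Q => `[< comb_equiv P Q >].

Lemma comb_equivb_refl (R : realType) : reflexive (@comb_equivb R).
Proof. by move=> P; apply/asboolP/comb_equiv_refl. Qed.
Lemma comb_equivb_sym (R : realType) : ssrbool.symmetric (@comb_equivb R).
Proof.
by move=> P Q; apply/asboolP/asboolP; apply: comb_equiv_sym.
Qed.
Lemma comb_equivb_trans (R : realType) : transitive (@comb_equivb R).
Proof.
move=> Q P S /asboolP h1 /asboolP h2; apply/asboolP.
exact: comb_equiv_trans h1 h2.
Qed.

Canonical comb_equiv_rel (R : realType) :=
  EquivRel (@comb_equivb R) (@comb_equivb_refl R) (@comb_equivb_sym R)
    (@comb_equivb_trans R).

Definition comb_polytope (R : realType) := {eq_quot comb_equiv_rel R}%qT.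
HB.instance Definition _ (R : realType) := Choice.on (comb_polytope R).
HB.instance Definition _ (R : realType) := Quotient.on (comb_polytope R).
HB.instance Definition _ (R : realType) := EqQuotient.on (comb_polytope R).

Definition comb_class (R : realType) (P : polytope R) : comb_polytope R :=
  (\pi_(comb_polytope R) P)%qT.

(* The additive group of the ring of polytopes; its product plays no role in the
   operators below, which are merely additive endomorphisms. *)
Definition polyZ (R : realType) : zmodType := {freeg (comb_polytope R) / int}.

Lemma conv_face (R : realType) (N : nat) (s : seq 'rV[R]_N) F (c : 'cV[R]_N) b :
    (forall x, conv s x -> (x *m c) 0 0 <= b) ->
    F = conv s `&` [set x | (x *m c) 0 0 = b] ->
  F = conv [seq v <- s | (v *m c) 0 0 == b].
Proof.
move=> cb ->; set s' := filter _ s.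
have lin r (a : 'rV[R]_N -> R) : ((\sum_(v <- r) a v *: v) *m c) 0 0 =
    \sum_(v <- r) a v * (v *m c) 0 0.
  rewrite mulmx_suml summxE; apply: eq_bigr => v _.
  by rewrite -scalemxAl mxE.
have sb v : v \in s -> (v *m c) 0 0 <= b.
  move=> vs; apply: cb; pose n := (count_mem v s)%:R : R.
  have n0 : n != 0 by rewrite pnatr_eq0 -lt0n -has_count has_pred1.
  have E (V : lmodType R) (f : 'rV[R]_N -> V) :
      \sum_(w <- s) ((w == v)%:R / n) *: f w = f v.
    transitivity (\sum_(w <- s) if w == v then n^-1 *: f v else 0).
      apply: eq_bigr => w _; case: eqP => [->|_]; first by rewrite mul1r.
      by rewrite mul0r scale0r.
    rewrite -big_mkcond big_const_seq iter_addr_0.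
    by rewrite -scaler_nat scalerA divff ?scale1r.
  exists (fun w => (w == v)%:R / n); split.
  - by move=> w _; rewrite divr_ge0 ?ler0n.
  - rewrite -[RHS](E R^o (fun=> 1)).
    by apply: eq_bigr => w _; rewrite [RHS]mulr1.
  - exact: (E _ id).
apply/seteqP; split=> x.
- move=> [[a [a0 a1 ax]] /= xb].
  have z v : v \in s -> (v *m c) 0 0 != b -> a v = 0.
    have : \sum_(v <- s) a v * (b - (v *m c) 0 0) = 0.
      under eq_bigr do rewrite mulrBr.
      by rewrite big_split /= sumrN -lin ax xb -mulr_suml a1 mul1r subrr.
    rewrite big_seq; move/eqP; rewrite psumr_eq0; last first.
      by move=> w ws; rewrite mulr_ge0 ?a0 // subr_ge0 sb.
    move=> /allP h vs vb; have := h v vs; rewrite vs /= mulf_eq0 => /orP[/eqP//|].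
    by rewrite subr_eq0 eq_sym (negPf vb).
  exists a; split.
  - by move=> v; rewrite mem_filter => /andP[_ /a0].
  - rewrite big_filter -a1 [RHS](bigID (fun v => (v *m c) 0 0 == b)) /=.
    rewrite [X in _ = _ + X]big_seq_cond [X in _ = _ + X]big1 ?addr0 //.
    by move=> v /andP[vs vb]; apply: z.
  - rewrite big_filter -ax [RHS](bigID (fun v => (v *m c) 0 0 == b)) /=.
    rewrite [X in _ = _ + X]big_seq_cond [X in _ = _ + X]big1 ?addr0 //.
    by move=> v /andP[vs vb]; rewrite z // scale0r.
- move=> [a [a0 a1 ax]]; split.
  + exists (fun v => if (v *m c) 0 0 == b then a v else 0); split.
    * by move=> v vs; case: ifP => // vb; apply: a0; rewrite mem_filter vb.
    * by rewrite -big_mkcond -big_filter.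
    * rewrite -ax big_filter [RHS]big_mkcond /=; apply: eq_bigr => v _.
      by case: ifP; rewrite ?scale0r.
  + rewrite /= -ax lin big_seq.
    rewrite (eq_bigr (fun v => a v * b)).
      by rewrite -big_seq -mulr_suml a1 mul1r.
    by move=> v; rewrite mem_filter => /andP[/eqP-> _].
Qed.

Lemma is_polytope_face (R : realType) (N : nat) (P F : set 'rV[R]_N) :
  is_polytope P -> is_face P F -> F !=set0 -> is_polytope F.
Proof.
move=> [s _ ->] [c [b [cb FE]]] F0; rewrite (conv_face cb FE).
exists [seq v <- s | (v *m c) 0 0 == b] => //.
move: F0; rewrite (conv_face cb FE) => -[x [a [_ + _]]].
case: (filter _ _) => //; rewrite big_nil => /esym/eqP.
by rewrite oner_eq0.
Qed.

Lemma finite_faces (R : realType) (N : nat) (P : polytope_in R N) :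
  finite_set [set F : polytope_in R N | is_face P F].
Proof.
have [s _ sE] := psetP P.
have fin : finite_set [set conv (mask t s) | t in [set: (size s).-tuple bool]].
  exact/finite_image/finite_finset.
apply: (@sub_finite_set _ _ (@pset R N @^-1`
    [set conv (mask t s) | t in [set: (size s).-tuple bool]])).
  move=> F /= [c [b [cb FE]]]; rewrite sE in cb FE.
  exists (map_tuple (fun v => (v *m c) 0 0 == b) (in_tuple s)) => //.
  by rewrite (conv_face cb FE) /= filter_mask.
apply: finite_preimage fin => -[A hA] [B hB] _ _ /= AB.
by subst B; congr PolytopeIn; apply: Prop_irrelevance.
Qed.

Lemma face_refl (R : realType) (N : nat) (P : set 'rV[R]_N) : is_face P P.
Proof.
exists 0, 0; split=> [x _|]; first by rewrite mulmx0 mxE.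
by apply/seteqP; split=> [x Px|x []//]; split=> //=; rewrite mulmx0 mxE.
Qed.

Lemma has_aff_indep_le_adim (R : realType) (N : nat) (A : set 'rV[R]_N) k :
  has_aff_indep A k -> (k <= adim A)%N.
Proof.
move=> h; have kN : (k < N.+1)%N.
  by have [x [M [_ _ /eqP <-]]] := h; rewrite ltnS rank_leq_col.
apply: (@leq_bigmax_cond _ _ (fun i : 'I_N.+1 => nat_of_ord i) (Ordinal kN)).
exact/asboolP.
Qed.

Lemma has_aff_indep_adim (R : realType) (N : nat) (A : set 'rV[R]_N) :
  A !=set0 -> has_aff_indep A (adim A).
Proof.
move=> [x Ax]; rewrite /adim.
have h0 : has_aff_indep A 0.
  exists x, (0 : 'M_(0, N)); split; [exact: Ax|by case|].
  by rewrite /row_free mxrank0.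
have : (0 < #|[pred k : 'I_N.+1 | `[< has_aff_indep A k >]]|)%N.
  by apply/card_gt0P; exists ord0; apply/asboolP; exact: h0.
move=> /(eq_bigmax_cond (fun k : 'I_N.+1 => nat_of_ord k))[k].
move=> /asboolP hk E.
rewrite (eq_bigl (mem [pred k0 : 'I_N.+1 | `[< has_aff_indep A k0 >]])) ?E //.
Qed.

Lemma adim_face_lt (R : realType) (N : nat) (P F : set 'rV[R]_N) :
  is_face P F -> F !=set0 -> F <> P -> (adim F < adim P)%N.
Proof.
move=> [c [b [cb FE]]] F0 FP.
have [x [M [Fx FM fM]]] := has_aff_indep_adim F0.
have FsubP : F `<=` P by rewrite FE => z [].
have Fb z : F z -> (z *m c) 0 0 = b by rewrite FE => -[].
have [y Py yb] : exists2 y, P y & (y *m c) 0 0 != b.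
  apply: contrapT => h; apply: FP; rewrite FE; apply/seteqP; split=> [z []//|z Pz].
  split=> //=; apply: contrapT => zb; apply: h; exists z => //; exact/eqP.
rewrite -addn1; apply: has_aff_indep_le_adim.
exists x, (col_mx M (y - x)); split; first exact: FsubP.
- move=> i; case: (split_ordP i) => j ->.
    by rewrite rowKu; apply/FsubP/FM.
  by rewrite rowKd row_id addrC subrK.
- have Mc : M *m c = 0.
    apply/matrixP => i j; rewrite [j]ord1 [RHS]mxE.
    have := Fb _ (FM i); rewrite mulmxDl mxE (Fb x) // => /eqP.
    rewrite -subr_eq0 [_ - b]addrC addKr => /eqP <-.
    by rewrite !mxE; apply: eq_bigr => l _; rewrite mxE.
  have /row_freeP[B MB] := fM.
  have yx : ((y - x) *m c) 0 0 != 0.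
    by rewrite mulmxBl mxE [X in _ + X]mxE (Fb x) // subr_eq0.
  rewrite -kermx_eq0; apply/eqP/row_matrixP => i.
  set u := row i _; rewrite row0.
  have /sub_kermxP : (u <= kermx (col_mx M (y - x)))%MS by apply: row_sub.
  rewrite -[u]hsubmxK mul_row_col => uE.
  have /matrixP/(_ 0 0) : (lsubmx u *m M + rsubmx u *m (y - x)) *m c = 0.
    by rewrite uE mul0mx.
  rewrite mulmxDl -!mulmxA Mc mulmx0 add0r mxE big_ord1 [RHS]mxE => /eqP.
  rewrite mulf_eq0 (negPf yx) orbF => /eqP r0.
  have ru0 : rsubmx u = 0 by apply/rowP => k; rewrite ord1 r0 mxE.
  move: uE; rewrite ru0 mul0mx addr0 => /(congr1 (mulmx^~ B)).
  by rewrite -mulmxA MB mulmx1 mul0mx => ->; rewrite row_mx0.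
Qed.

Definition poly_gen (R : realType) (P : polytope R) : polyZ R :=
  << (1 : int) *g comb_class P >>.

(* [F] ranges over polytopes, so the empty face is excluded; nonempty faces are
   polytopes by [is_polytope_face], and the sum is finite by [finite_faces]. *)
Definition face_sum (R : realType) (k : nat) (P : polytope R) : polyZ R :=
  \sum_(F \in [set F : polytope_in R (ambient P) |
                is_face P F /\ (adim F + k)%N = adim P])
    poly_gen (Polytope F).

(* The Z-linear extension; computing on a representative is harmless, since face
   dimensions and face classes are combinatorial invariants. *)
Definition dfun (R : realType) (k : nat) : polyZ R -> polyZ R :=
  @fglift int (zmodule (polyZ R)) (comb_polytope R)
    (fun c => face_sum k (repr c)).

Lemma dfun_zmod_morphism (R : realType) (k : nat) : zmod_morphism (@dfun R k).
Proof. exact: (@lift_is_additive int (comb_polytope R) (zmodule (polyZ R))). Qed.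
HB.instance Definition _ (R : realType) (k : nat) :=
  GRing.isZmodMorphism.Build (polyZ R) (polyZ R) (@dfun R k) (@dfun_zmod_morphism R k).

Definition endo (V : zmodType) := {additive V -> V}.
HB.instance Definition _ (V : zmodType) := gen_eqMixin (endo V).
HB.instance Definition _ (V : zmodType) := gen_choiceMixin (endo V).


Lemma endoP (V : zmodType) (f g : endo V) :
  f =1 g :> (V -> V) -> f = g.
Proof.
case: f g => [f [[fD]]] [g [[gD]]] /= /funext fg; subst g.
by rewrite (Prop_irrelevance fD gD).
Qed.

Section EndoRing.
Context (V : zmodType).
Let z : endo V := (null_fun V : {additive V -> V}).
Let opp (f : endo V) : endo V := ((\- f)%R : {additive V -> V}).
Let add (f g : endo V) : endo V := ((f \+ g)%R : {additive V -> V}).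
Let one : endo V := (idfun : {additive V -> V}).
Let mul (f g : endo V) : endo V := (f \o g : {additive V -> V}).

Fact endo_addA : associative add.
Proof. by move=> f g h; apply: endoP => x /=; rewrite addrA. Qed.
Fact endo_addC : commutative add.
Proof. by move=> f g; apply: endoP => x /=; rewrite addrC. Qed.
Fact endo_add0 : left_id z add.
Proof. by move=> f; apply: endoP => x /=; rewrite add0r. Qed.
Fact endo_addN : left_inverse z opp add.
Proof. by move=> f; apply: endoP => x /=; rewrite addNr. Qed.
Fact endo_mulA : associative mul.
Proof. by move=> f g h; apply: endoP. Qed.
Fact endo_mul1 : left_id one mul.
Proof. by move=> f; apply: endoP. Qed.
Fact endo_mulr1 : right_id one mul.
Proof. by move=> f; apply: endoP. Qed.
Fact endo_mulDl : left_distributive mul add.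
Proof. by move=> f g h; apply: endoP. Qed.
Fact endo_mulDr : right_distributive mul add.
Proof. by move=> f g h; apply: endoP => x /=; rewrite raddfD. Qed.

HB.instance Definition _ := GRing.isPzRing.Build (endo V)
  endo_addA endo_addC endo_add0 endo_addN
  endo_mulA endo_mul1 endo_mulr1 endo_mulDl endo_mulDr.

Lemma endo_mulE (f g : endo V) x : (f * g) x = f (g x).
Proof. by []. Qed.
Lemma endo_oneE x : (1 : endo V) x = x.
Proof. by []. Qed.
End EndoRing.

Definition dend (R : realType) (k : nat) : endo (polyZ R) :=
  (@dfun R k : {additive polyZ R -> polyZ R}).

Lemma dend_gen (R : realType) (k : nat) (c : comb_polytope R) :
  dend R k << (1 : int) *g c >> = face_sum k (repr c).
Proof. by rewrite /dend /= /dfun liftU scale1r. Qed.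

Lemma polytope_in_inj (R : realType) (N : nat) : injective (@pset R N).
Proof.
move=> [A hA] [B hB] /= AB; subst B.
by rewrite (Prop_irrelevance hA hB).
Qed.

Lemma polytope_neq0 (R : realType) (N : nat) (P : polytope_in R N) :
  (P : set 'rV[R]_N) !=set0.
Proof.
have [[//|v s] _ ->] := psetP P; pose n := (count_mem v (v :: s))%:R : R.
have n0 : n != 0 by rewrite pnatr_eq0 /= eqxx.
exists (\sum_(w <- v :: s) ((w == v)%:R / n) *: w).
exists (fun w => (w == v)%:R / n); split=> //.
  by move=> w _; rewrite divr_ge0 ?ler0n.
transitivity (\sum_(w <- v :: s) if w == v then n^-1 else 0).
  by apply: eq_bigr => w _; case: eqP => _; rewrite ?mul1r ?mul0r.
rewrite -big_mkcond big_const_seq iter_addr_0.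
by rewrite -mulr_natl divff.
Qed.

Lemma face_sum0 (R : realType) (P : polytope R) : face_sum 0 P = poly_gen P.
Proof.
rewrite /face_sum (_ : [set F | _] = [set body P]) ?fsbig_set1; last first.
  apply/seteqP; split=> F /=; last first.
    by move=> ->; rewrite addn0; split=> //; apply: face_refl.
  rewrite addn0 => -[fF aF]; apply: polytope_in_inj; apply: contrapT => FP.
  by have := adim_face_lt fF (polytope_neq0 F) FP; rewrite aF ltnn.
by case: P.
Qed.

Lemma dend0 (R : realType) : dend R 0 = 1.
Proof.
apply: endoP => D; rewrite endo_oneE -[D]freeg_sumE raddf_sum.
apply: eq_bigr => c _.
rewrite /dend /= /dfun liftU face_sum0 /poly_gen /comb_class reprK.
by rewrite -[LHS]/(_ *~ _) freeg_mulz intz.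
Qed.

Definition Dpred (R : realType) : {pred endo (polyZ R)} :=
  fun x => `[< forall S : {pred endo (polyZ R)}, GRing.subring_closed S ->
    (forall k, (0 < k)%N -> dend R k \in S) -> x \in S >].

Lemma Dpred_subring (R : realType) : GRing.subring_closed (@Dpred R).
Proof.
split.
- by apply/asboolP => S [].
- move=> x y /asboolP hx /asboolP hy; apply/asboolP => S hS hd.
  by case: (hS) => _ + _; apply; [apply: hx|apply: hy].
- move=> x y /asboolP hx /asboolP hy; apply/asboolP => S hS hd.
  by case: (hS) => _ _; apply; [apply: hx|apply: hy].
Qed.

Record Dring (R : realType) := MkDring {
  Dval :> endo (polyZ R);
  DvalP : Dval \in @Dpred R }.
HB.instance Definition _ (R : realType) := [isSub for @Dval R].
HB.instance Definition _ (R : realType) := [Choice of Dring R by <:].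
HB.instance Definition _ (R : realType) :=
  GRing.SubChoice_isSubPzRing.Build (endo (polyZ R)) (@Dpred R) (Dring R)
    (@Dpred_subring R).

Lemma dend_Dpred (R : realType) (k : nat) : dend R k \in @Dpred R.
Proof.
apply/asboolP => S [S1 _ _] Sd; case: k => [|k]; last exact: Sd.
by rewrite dend0.
Qed.

Definition dop (R : realType) (k : nat) : Dring R :=
  MkDring (dend_Dpred R k).

Definition is_comp (w : seq nat) : bool := all (leq 1) w.

Definition Dcomp (R : realType) (n : nat) : set (Dring R) :=
  [set x | exists2 s : seq (int * seq nat),
    all (fun z => is_comp z.2 && (sumn z.2 == n)) s &
    x = \sum_(z <- s) (\prod_(j <- z.2) dop R j) *~ z.1].

(* The graded dual: additive functionals that vanish on almost all components. *)
Record Ddual (R : realType) := MkDdual {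
  Ddual_fun :> {additive Dring R -> int};
  Ddual_bounded :
    exists N : nat, forall k x, (N <= k)%N -> Dcomp k x -> Ddual_fun x = 0 }.

Definition Ddual_comp (R : realType) (n : nat) : set (Ddual R) :=
  [set psi | forall k x, k != n -> Dcomp k x -> psi x = 0].

(* The coefficient of t^a in Phi(t_m) ... Phi(t_1), where i < m stands for
   t_(i+1); the factor on the left is the one of t_m. *)
Definition Phi_coef (R : realType) (m : nat) (a : 'X_{1..m}) : Dring R :=
  \prod_(i < m) dop R (a (rev_ord i)).

Definition Ddual_bound (R : realType) (psi : Ddual R) : nat :=
  sval (cid (Ddual_bounded psi)).

(* Only finitely many coefficients are nonzero, see [mcoeff_Rstar]. *)
Definition Rstar (R : realType) (m : nat) (psi : Ddual R) : {mpoly int[m]} :=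
  \sum_(a : 'X_{1..m < Ddual_bound psi}) psi (Phi_coef R a) *: 'X_[a].

Lemma dop0 (R : realType) : dop R 0 = 1.
Proof. by apply: val_inj; rewrite /= dend0. Qed.

Lemma Phi_coef_comp (R : realType) (m : nat) (a : 'X_{1..m}) :
  Dcomp (mdeg a) (Phi_coef R a).
Proof.
pose w := [seq j <- [seq a (rev_ord i) | i <- index_enum 'I_m] | (0 < j)%N].
exists [:: (1, w)].
  rewrite /= andbT /is_comp filter_all /= /w sumnE big_filter big_map.
  rewrite big_mkcond /= mdegE (reindex_inj rev_ord_inj) /=.
  by apply/eqP/eq_bigr => i _; rewrite rev_ordK; case: (a i).
rewrite big_seq1 /= /w big_filter big_map big_mkcond /=.
by apply: eq_bigr => i _; case: (a _) => [|//]; rewrite dop0.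
Qed.

Lemma mcoeff_Rstar (R : realType) (m : nat) (psi : Ddual R) (a : 'X_{1..m}) :
  (Rstar m psi)@_a = psi (Phi_coef R a).
Proof.
rewrite /Rstar /Ddual_bound; case: cid => N hN /=.
have [aN|Na] := ltnP (mdeg a) N.
  exact: (mcoeff_mpoly (fun b => psi (Phi_coef R b))).
rewrite (hN _ _ Na (Phi_coef_comp R a)) raddf_sum big1 //= => b _.
rewrite mcoeffZ mcoeffX; case: eqP => [ba|_]; last by rewrite mulr0.
by move: Na; rewrite -ba leqNgt bmdeg.
Qed.

(* M_w(t_1, ..., t_m), a sum over strictly increasing sequences of indices;
   the empty composition gives 1. *)
Definition qmon (m : nat) (w : seq nat) : {mpoly int[m]} :=
  \sum_(l : (size w).-tuple 'I_m | sorted ltn [seq val i | i <- l])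
    \prod_(i < size w) 'X_(tnth l i) ^+ nth 0%N w i.

Definition Qsym (m : nat) : set {mpoly int[m]} :=
  [set g | exists2 s : seq (int * seq nat),
    all (fun z => is_comp z.2) s & g = \sum_(z <- s) z.1 *: qmon m z.2].

Definition subst_opp (m : nat) (q q' : 'I_m) : m.-tuple {mpoly int[m]} :=
  [tuple if i == q' then - 'X_q else 'X_i | i < m].

Definition subst_zero (m : nat) (q q' : 'I_m) : m.-tuple {mpoly int[m]} :=
  [tuple if (i == q) || (i == q') then 0 else 'X_i | i < m].

(* Main.v *)
(* Euler's relation for the intervals [G, P] of face lattices says that
   Phi(-t) Phi(t) = 1 in D; read off in two consecutive variables, this is the
   relation g(.., t, -t, ..) = g(.., 0, 0, ..).

   Conversely, as m >= n, the polynomial g determines a function c on the words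
   in the d_k of degree n which respects Phi(-t) Phi(t) = 1, and one has to show
   that c respects every relation of D. Over Q, the relations Phi(-t) Phi(t) = 1
   express the words through those in the free algebra U on d_1, d_3, ..., so it
   suffices that flag numbers of polytopes separate the elements of U. Let u in U
   be annihilated by all flag numbers (of chains of faces ending with the empty
   face). Flag numbers of a cone C P are those of P after lowering one letter,
   so the image of u under the derivation d_k |-> d_(k-1) is annihilated too;
   comparison with the prism P x I gives a second such element. By induction on
   the degree both are zero, and this forces u = 0.

   Euler's relation is proved on the dual side. Replacing (-1)^dim of a relatively
   open polyhedral cone by the sum over the pieces of a partition into such cones
   changes nothing, because a hyperplane cuts a cone of dimension d into two of
   dimension d and one of dimension d - 1. If p is a functional exposing G, the
   cells of the faces above G, translated along p, partition the space of
   functionals that vanish on G. *)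

From HB Require Import structures.
From mathcomp Require Import all_boot all_order all_algebra.
From mathcomp Require Import -(notations) finmap.
From mathcomp Require Import -(notations) monalg.
From mathcomp Require Import boolp.
From mathcomp Require Import lra zify ring.
Set Implicit Arguments.
Unset Strict Implicit.
Unset Printing Implicit Defensive.
Import Order.TTheory GRing.Theory Num.Theory.
Local Open Scope ring_scope.

(** * Cutting relatively open polyhedral cones *)

(** Everything is proved for finite configurations of vectors, a polytope being the configuration of
    its points lifted to height 1. The rank of a nonempty face is then its dimension plus one, and
    the empty face is an ordinary face of rank 0; chains ending with it let the cone lower the last
    letter like any other. Operators see nonempty faces only. Counting points after an operator word
    appends a letter 1 to the chains, so a relation in D shows that u d_1, rather than u, is
    annihilated by flag numbers; right multiplication by d_1 is injective in U. That two zero images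
    force u = 0 is seen by comparing last letters. The obstacle is that even generators are not
    free; a power series W writes them as left combinations of the odd ones. The prism gives an
    equation independent of that of the cone because its last letter is lowered in one way only, the
    others in two. The bound m >= n gives room for the relation: d_i d_(k-i) needs two variables,
    which k >= 2 pays for, while k = 1 is trivial. *)

Section Cells.
Context (R : realFieldType) (d : nat).
Implicit Types (x y : 'rV[R]_d) (a : 'cV[R]_d) (q s : seq ('cV[R]_d * bool)).

Definition ev x a : R := (x *m a) 0 0.

Lemma evDl x y a : ev (x + y) a = ev x a + ev y a.
Proof. by rewrite /ev mulmxDl mxE. Qed.
Lemma evZl t x a : ev (t *: x) a = t * ev x a.
Proof. by rewrite /ev -scalemxAl mxE. Qed.
Lemma evNl x a : ev (- x) a = - ev x a.
Proof. by rewrite -scaleN1r evZl mulN1r. Qed.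
Lemma evBl x y a : ev (x - y) a = ev x a - ev y a.
Proof. by rewrite evDl evNl. Qed.
Lemma evNr x a : ev x (- a) = - ev x a.
Proof. by rewrite /ev mulmxN mxE. Qed.
Lemma evBr x a b : ev x (a - b) = ev x a - ev x b.
Proof. by rewrite /ev mulmxBr !mxE. Qed.
Lemma evZr t x a : ev x (t *: a) = t * ev x a.
Proof. by rewrite /ev -scalemxAr mxE. Qed.
Lemma ev0l a : ev 0 a = 0.
Proof. by rewrite /ev mul0mx mxE. Qed.

Lemma ev_eq0 x a : (x *m a == 0) = (ev x a == 0).
Proof.
apply/eqP/eqP => [e|e]; first by rewrite /ev e mxE.
by apply/matrixP => i j; rewrite !ord1 [RHS]mxE -e.
Qed.

(* [(a, true)] stands for the open half-space a > 0, [(a, false)] for the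
   hyperplane a = 0. *)
Definition cond x (c : 'cV[R]_d * bool) : bool :=
  if c.2 then 0 < ev x c.1 else ev x c.1 == 0.

Definition cell q : pred 'rV[R]_d := fun x => all (cond x) q.

(** Only the equalities enter: strict inequalities are open conditions, so this subspace is the
    linear span of the cell as soon as the cell is nonempty. *)
Definition eqker q : 'M[R]_d :=
  foldr (fun c K => if c.2 then K else (K :&: kermx c.1)%MS) 1%:M q.

Lemma eqkerP q y : (y <= eqker q)%MS = all (fun c => c.2 || (ev y c.1 == 0)) q.
Proof.
elim: q => [|[a []] q IH] /=; first by rewrite submx1.
  by rewrite IH.
by rewrite sub_capmx IH andbC; congr (_ && _); rewrite -ev_eq0; apply/sub_kermxP/eqP.
Qed.

Lemma cell_eqker q x : cell q x -> (x <= eqker q)%MS.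
Proof.
rewrite eqkerP => /allP h; apply/allP => c /h; rewrite /cond.
by case: c.2.
Qed.

Lemma cell_perturb q x y : cell q x -> (y <= eqker q)%MS ->
  exists2 e, 0 < e & forall t, `|t| <= e -> cell q (x + t *: y).
Proof.
elim: q => [|[a b] q IH]; first by exists 1.
move=> /andP[xa xq]; rewrite eqkerP /= => /andP[ya]; rewrite -eqkerP => yq.
have [e e0 he] := IH xq yq; move: xa ya; rewrite /cond /=.
case: b => /= xa ya; last first.
  exists e => // t te; rewrite he // andbT evDl evZl.
  by rewrite (eqP xa) (eqP ya) mulr0 addr0.
have n0 : 0 < `|ev y a| + 1 by rewrite ltr_wpDl.
(* The summand 1 keeps the denominator positive, and the factor 2 makes the change of [ev x a] at
   most half of it. *)
exists (Order.min e (ev x a / (2 * (`|ev y a| + 1)))).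
  by rewrite lt_min e0 divr_gt0 // mulr_gt0.
move=> t; rewrite le_min => /andP[t1 t2]; rewrite he // andbT evDl evZl.
have : `|t * ev y a| < ev x a.
  rewrite normrM; apply: (@le_lt_trans _ _ (ev x a / 2)); last first.
    by rewrite ltr_pdivrMr // mulr_natr mulr2n ltrDl.
  move: t2; rewrite invfM mulrA ler_pdivlMr // => t2.
  by apply: le_trans t2; rewrite ler_wpM2l ?normr_ge0 // lerDl.
by rewrite ltr_norml => /andP[]; lra.
Qed.

(** The Euler characteristic with compact supports of the cell; [chi_partition] is its
    additivity. *)
Definition chi q : int :=
  if `[< exists x, cell q x >] then (-1) ^+ \rank (eqker q) else 0.

Lemma chi0 q : (forall x, ~~ cell q x) -> chi q = 0.
Proof.
by move=> h; rewrite /chi; case: asboolP => // -[x]; rewrite (negPf (h x)).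
Qed.

Lemma chi_cell q x : cell q x -> chi q = (-1) ^+ \rank (eqker q).
Proof. by move=> h; rewrite /chi asboolT //; exists x. Qed.

(** A nonempty cell determines its span: a small multiple of any vector of [eqker q] is a difference
    of two points of the cell. *)
Lemma eqker_ext q s x : cell q x -> cell s =1 cell q ->
  (eqker q <= eqker s)%MS.
Proof.
move=> qx E; apply/row_subP => i; set y := row i _.
have yq : (y <= eqker q)%MS by apply: row_sub.
have [e e0 he] := cell_perturb qx yq.
have /cell_eqker h1 : cell s (x + e *: y) by rewrite E he // ger0_norm // ltW.
have /cell_eqker h2 : cell s x by rewrite E.
have : (e *: y <= eqker s)%MS.
  by rewrite -[e *: y](addKr x) addmx_sub // eqmx_opp.
by rewrite eqmx_scale // gt_eqF.
Qed.

Lemma chi_ext q s : cell q =1 cell s -> chi q = chi s.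
Proof.
move=> E; have [[x qx]|h] := pselect (exists x, cell q x); last first.
  have qn x : ~~ cell q x by apply/negP => hx; apply: h; exists x.
  by rewrite !chi0 // => x; rewrite -E.
rewrite (chi_cell qx) (@chi_cell s x) -?E //; congr (_ ^+ _).
apply/eqP; rewrite eqn_leq !mxrankS //.
  by apply: (@eqker_ext s q x) => //; rewrite -E.
exact: eqker_ext qx (fsym E).
Qed.

Lemma rank_cap_kermx (K : 'M[R]_d) y a : (y <= K)%MS -> ev y a != 0 ->
  \rank K = (\rank (K :&: kermx a)%MS).+1.
Proof.
move=> yK ya; rewrite -(mxrank_mul_ker K a) -[RHS]add1n.
apply/eqP; rewrite eqn_add2r eqn_leq (leq_trans (rank_leq_col _)) //=.
rewrite lt0n mxrank_eq0.
apply: contraNN ya => /eqP Ka; rewrite -ev_eq0.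
by move/submxP: yK => [B ->]; rewrite -mulmxA Ka mulmx0.
Qed.

(** If the cell meets the hyperplane and its span is not contained in it, the signs are (-1)^d +
    (-1)^d + (-1)^(d-1) = (-1)^d. In all other cases at most one of the three pieces is nonempty,
    and it is the whole cell. *)
Lemma chi_cut q a :
  chi q = chi ((a, true) :: q) + chi ((- a, true) :: q) + chi ((a, false) :: q).
Proof.
have cP x : cell ((a, true) :: q) x = (0 < ev x a) && cell q x by [].
have cN x : cell ((- a, true) :: q) x = (ev x a < 0) && cell q x.
  by rewrite /cell /= {1}/cond /= evNr oppr_gt0.
have cZ x : cell ((a, false) :: q) x = (ev x a == 0) && cell q x by [].
have [[x qx]|h] := pselect (exists x, cell q x); last first.
  by rewrite !chi0 ?addr0 // => x; rewrite ?cP ?cN ?cZ; apply/negP;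
    [move=> /andP[_]|move=> /andP[_]|move=> /andP[_]|]; move=> hx; apply: h; exists x.
have [[x0 qx0 x0a]|h0] := pselect (exists2 x, cell q x & ev x a = 0); last first.
  (* By convexity a cell with points on both sides meets the hyperplane: [t] is the parameter at
     which [a] vanishes on the segment from [y] to [z]. *)
  have sg y z : cell q y -> cell q z -> 0 < ev y a -> ev z a < 0 -> False.
    move=> qy qz ya za; apply: h0.
    pose t := ev y a / (ev y a - ev z a).
    have D0 : 0 < ev y a - ev z a by lra.
    have t0 : 0 < t by rewrite divr_gt0.
    have t1 : 0 < 1 - t.
      by rewrite subr_gt0 ltr_pdivrMr // mul1r; lra.
    exists ((1 - t) *: y + t *: z).
      apply/allP => -[b sb] /= bq; move/allP/(_ _ bq): qy; move/allP/(_ _ bq): qz.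
      rewrite /cond /=; case: sb {bq}; rewrite evDl !evZl.
        by move=> zb yb; rewrite addr_gt0 // mulr_gt0.
      by move=> /eqP-> /eqP->; rewrite !mulr0 addr0.
    rewrite evDl !evZl /t; field; exact: lt0r_neq0.
  have Z0 : chi ((a, false) :: q) = 0.
    apply: chi0 => y; rewrite cZ; apply/negP => /andP[/eqP ya qy].
    by apply: h0; exists y.
  rewrite Z0 addr0; case: (ltrgtP (ev x a) 0) => xa.
  - rewrite [X in _ = X + _]chi0 ?add0r.
      apply: chi_ext => y; rewrite cN; case qy: (cell q y); rewrite ?andbF // andbT.
      apply/esym; case: (ltrgtP (ev y a) 0) => // ya; first by case: (sg y x).
      by case: h0; exists y.
    by move=> y; rewrite cP; apply/negP => /andP[ya qy]; apply: (sg y x).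
  - rewrite [X in _ = _ + X]chi0 ?addr0.
      apply: chi_ext => y; rewrite cP; case qy: (cell q y); rewrite ?andbF // andbT.
      apply/esym; case: (ltrgtP 0 (ev y a)) => // ya; first by case: (sg x y).
      by case: h0; exists y.
    by move=> y; rewrite cN; apply/negP => /andP[ya qy]; apply: (sg x y).
  - by case: h0; exists x.
have [[y yK ya]|hK] := pselect (exists2 y, (y <= eqker q)%MS & ev y a != 0).
  have [e e0 he] := cell_perturb qx0 yK.
  pose t := e * Num.sg (ev y a).
  have te : `|t| <= e by rewrite normrM normr_sg ya mulr1 ger0_norm // ltW.
  have ta : 0 < ev (x0 + t *: y) a.
    by rewrite evDl evZl x0a add0r -mulrA -normrEsg mulr_gt0 // normr_gt0.
  have tna : ev (x0 + (- t) *: y) a < 0.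
    by move: ta; rewrite !evDl !evZl x0a !add0r mulNr oppr_lt0.
  rewrite (@chi_cell ((a, true) :: q) (x0 + t *: y)); last by rewrite cP ta he.
  rewrite (@chi_cell ((- a, true) :: q) (x0 + (- t) *: y)); last first.
    by rewrite cN tna he ?normrN.
  rewrite (@chi_cell ((a, false) :: q) x0); last by rewrite cZ x0a eqxx.
  rewrite (chi_cell qx) [eqker (_ :: _)]/= [eqker ((- _, _) :: _)]/=.
  rewrite [eqker ((_, false) :: _)]/= (rank_cap_kermx yK ya) exprS.
  by move: ((-1) ^+ _) => z; rewrite mulN1r subrK.
have z y : cell q y -> ev y a = 0.
  move=> qy; apply: contrapT => /eqP ya; apply: hK; exists y => //.
  exact: cell_eqker.
rewrite (@chi0 ((a, true) :: q)) ?(@chi0 ((- a, true) :: q)) ?add0r.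
- by apply: chi_ext => y; rewrite cZ; case qy: (cell q y); rewrite ?andbF // z ?eqxx.
- by move=> y; rewrite cN; apply/negP => /andP[ya /z e]; rewrite e ltxx in ya.
- by move=> y; rewrite cP; apply/negP => /andP[ya /z e]; rewrite e ltxx in ya.
Qed.

(** The sign vectors of the hyperplane arrangement [L]; the cells of some of them may be empty. *)
Fixpoint sign_lists (L : seq 'cV[R]_d) : seq (seq ('cV[R]_d * bool)) :=
  if L is a :: L' then
    [seq (a, true) :: s | s <- sign_lists L'] ++
    [seq (- a, true) :: s | s <- sign_lists L'] ++
    [seq (a, false) :: s | s <- sign_lists L']
  else [:: [::]].

Lemma chi_sign_lists q L : chi q = \sum_(s <- sign_lists L) chi (s ++ q).
Proof.
elim: L q => [|a L IH] q /=; first by rewrite big_seq1.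
rewrite !big_cat !big_map /= (chi_cut q a) !(IH (_ :: q)) addrA.
have mid c : \sum_(s <- sign_lists L) chi (s ++ c :: q) =
    \sum_(s <- sign_lists L) chi ((c :: s) ++ q).
  apply: eq_bigr => s _; apply: chi_ext => x.
  by rewrite /cell cat_cons all_cat /= all_cat andbCA.
by rewrite !mid.
Qed.

Lemma sign_lists_sg L s a x y : s \in sign_lists L -> a \in L ->
  cell s x -> cell s y -> Num.sg (ev x a) = Num.sg (ev y a).
Proof.
elim: L s => //= b L IH s; rewrite !mem_cat in_cons.
have main c s' : s = c :: s' -> s' \in sign_lists L ->
   (cond x c -> cond y c -> Num.sg (ev x b) = Num.sg (ev y b)) ->
   (a == b) || (a \in L) ->
   cell s x -> cell s y -> Num.sg (ev x a) = Num.sg (ev y a).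
  move=> -> s'L h aL /andP[xc xs] /andP[yc ys].
  by case/orP: aL => [/eqP->|aL]; [exact: h|exact: (IH s')].
case/or3P => /mapP[s' s'L E]; apply: main E s'L _; rewrite /cond /=.
- by move=> xb yb; rewrite !gtr0_sg.
- by rewrite !evNr !oppr_gt0 => xb yb; rewrite !ltr0_sg.
- by move=> /eqP-> /eqP->.
Qed.

(** Refine by the arrangement of all hyperplanes occurring in the parts. Membership in a part
    depends only on signs, so a region that meets [cell q] meets it inside exactly one part, and
    both sides become the same sum over regions. *)
Lemma chi_partition (J : finType) (r : J -> seq ('cV[R]_d * bool)) q :
    (forall j x, cell (r j) x -> cell q x) ->
    (forall x, cell q x -> exists j, cell (r j) x) ->
    (forall i j x, cell (r i) x -> cell (r j) x -> i = j) ->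
  chi q = \sum_j chi (r j).
Proof.
move=> sub cov dis.
pose L := flatten [seq unzip1 (r j) | j <- enum J].
have rL j c : c \in r j -> c.1 \in L.
  move=> cr; apply/flatten_mapP; exists j; first by rewrite mem_enum.
  by apply/mapP; exists c.
under eq_bigr do rewrite (chi_sign_lists _ L).
rewrite exchange_big /= (chi_sign_lists q L) !big_seq.
apply: eq_bigr => s sL.
have cc p x : cell (s ++ p) x = cell s x && cell p x by rewrite /cell all_cat.
have [[x]|h] := pselect (exists x, cell (s ++ q) x); last first.
  rewrite chi0 => [|x]; last by apply/negP => hx; apply: h; exists x.
  rewrite big1 // => j _; apply: chi0 => x; rewrite cc.
  by apply/negP => /andP[xs /sub xq]; apply: h; exists x; rewrite cc xs.
rewrite cc => /andP[xs xq]; have [j xj] := cov _ xq.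
have tr y i z : cell s y -> cell s z -> cell (r i) y -> cell (r i) z.
  move=> ys zs /allP yi; apply/allP => c ci; move: (yi _ ci).
  have := sign_lists_sg sL (rL _ _ ci) ys zs; rewrite /cond.
  by case: c.2 => e; [rewrite -sgr_gt0 e sgr_gt0|rewrite -sgr_eq0 e sgr_eq0].
rewrite (bigD1 j) //= big1 ?addr0 => [|i ij].
  apply: chi_ext => y; rewrite !cc; case ys: (cell s y) => //=.
  by apply/idP/idP => [_|/sub//]; apply: tr xj.
apply: chi0 => y; rewrite cc; apply/negP => /andP[ys yi].
by move/eqP: ij; apply; apply: (dis _ _ y) => //; apply: tr xj.
Qed.

End Cells.

(** * Euler's relation for face lattices *)

Section Configurations.
Context (R : realFieldType) (I : finType) (d : nat) (X : I -> 'cV[R]_d).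
Implicit Types (l p : 'rV[R]_d) (S F G T : {set I}).

(** The faces of the cone spanned by the [X i], as sets of indices. The full set is always a face
    (take [l] zero); the empty set is one only if some functional is positive on all [X i]. *)
Definition face S : bool :=
  `[< exists l, forall i, 0 <= ev l (X i) /\ (i \in S) = (ev l (X i) == 0) >].

Definition annih S : 'M[R]_d := eqker [seq (X i, false) | i <- enum S].

(** The dimension of the span of the [X i] with [i] in [S], as the codimension of its
    annihilator. *)
Definition rk S : nat := d - \rank (annih S).

Lemma annihP S l : reflect (forall i, i \in S -> ev l (X i) = 0) (l <= annih S)%MS.
Proof.
rewrite eqkerP all_map; apply: (iffP allP) => h i iS.
  by apply/eqP/h; rewrite mem_enum.
by apply/eqP/h; rewrite mem_enum in iS.
Qed.

Lemma rk_annih S : (rk S + \rank (annih S))%N = d.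
Proof. by rewrite subnK // rank_leq_row. Qed.

Lemma annihS S T : S \subset T -> (annih T <= annih S)%MS.
Proof.
move=> /subsetP ST; apply/row_subP => i; apply/annihP => j /ST.
by apply/annihP; apply: row_sub.
Qed.

Lemma rk0 : rk set0 = 0%N.
Proof. by rewrite /rk /annih enum_set0 /= mxrank1 subnn. Qed.

Lemma rkS S T : S \subset T -> (rk S <= rk T)%N.
Proof. by move=> /annihS/mxrankS h; rewrite leq_sub2l. Qed.

Lemma rk_lt G F p : G \proper F ->
  (forall i, i \in F -> 0 <= ev p (X i) /\ (i \in G) = (ev p (X i) == 0)) ->
  (rk G < rk F)%N.
Proof.
move=> /properP[GF [i iF iG]] hp.
have lt : (annih F < annih G)%MS.
  rewrite ltmxE annihS //; apply/negP => GF'.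
  have /annihP/(_ i iF)/eqP : (p <= annih F)%MS.
    apply: submx_trans GF'; apply/annihP => j jG.
    by apply/eqP; rewrite -(hp j _).2 // (subsetP GF).
  by rewrite -(hp i iF).2 (negPf iG).
have := rank_ltmx lt; have := rk_annih F; have := rk_annih G; lia.
Qed.

Lemma faceT : face [set: I].
Proof.
by apply/asboolP; exists 0 => i; rewrite ev0l inE eqxx.
Qed.

(** A face of a face is a face: outside [F], a large multiple of the functional exposing [F]
    outweighs [l]. *)
Lemma face_lift F S l : face F -> S \subset F ->
  (forall i, i \in F -> 0 <= ev l (X i) /\ (i \in S) = (ev l (X i) == 0)) ->
  face S.
Proof.
move=> /asboolP[p hp] SF hl; apply/asboolP.
(* The sum bounds every single ratio, and the extra 1 makes the resulting inequality strict. *)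
pose M := 1 + \sum_(i | i \notin F) `|ev l (X i)| / ev p (X i).
have M0 i : i \notin F -> `|ev l (X i)| / ev p (X i) <= M - 1.
  move=> iF; rewrite /M (bigD1 i) //= addrAC subrr add0r lerDl.
  by apply: sumr_ge0 => j _; rewrite divr_ge0 //; case: (hp j).
exists (l + M *: p) => i; rewrite evDl evZl; case: (boolP (i \in F)) => iF.
  have := (hp i).2; rewrite iF => /esym/eqP->; rewrite mulr0 addr0; exact: hl.
have p0 : 0 < ev p (X i).
  by have [ge0 e] := hp i; rewrite lt_def ge0 -e iF.
have : 0 < ev l (X i) + M * ev p (X i).
  have := M0 i iF; rewrite ler_pdivrMr // mulrBl mul1r.
  have : - ev l (X i) <= `|ev l (X i)| by rewrite -normrN ler_norm.
  lra.
move=> gt0; split; first exact: ltW.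
by rewrite gt_eqF //; apply: contraNF iF => /(subsetP SF).
Qed.

Lemma face_witness G F : face G -> exists p,
  forall i, i \in F -> 0 <= ev p (X i) /\ (i \in G) = (ev p (X i) == 0).
Proof. by move=> /asboolP[p hp]; exists p => i _. Qed.

Lemma face_rk_lt G F : face G -> G \proper F -> (rk G < rk F)%N.
Proof.
move=> fG GF; have [p hp] := face_witness F fG; apply: rk_lt GF hp.
Qed.

(* Moving a functional vanishing on [G] along [p] until it touches [F :\: G]. *)
Lemma argmin_ratio G F l p : G \proper F ->
    (forall i, i \in F -> 0 <= ev p (X i) /\ (i \in G) = (ev p (X i) == 0)) ->
  exists2 i0, i0 \in F :\: G & forall i, i \in F :\: G ->
    ev l (X i0) * ev p (X i) <= ev l (X i) * ev p (X i0).
Proof.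
move=> /properP[GF [i1 i1F i1G]] hp.
have i1D : i1 \in F :\: G by rewrite inE i1F i1G.
have p0 i : i \in F :\: G -> 0 < ev p (X i).
  by rewrite inE => /andP[iG iF]; have [a b] := hp i iF; rewrite lt_def a -b iG.
case: (arg_minP (fun i => ev l (X i) / ev p (X i)) i1D) => i0 i0D h.
exists i0 => // i iD; have := h i iD.
by rewrite ler_pdivrMr ?p0 // mulrAC ler_pdivlMr ?p0.
Qed.

(** The functionals that expose [S] inside [F], with no condition outside [F]. If [F] is a face and
    [S] a subset of it, [face_lift] shows that this cell is empty unless [S] is a face. *)
Definition face_cell F S := [seq (X i, i \notin S) | i <- enum F].

Lemma face_cellP F S l : S \subset F -> reflect
  (forall i, i \in F -> 0 <= ev l (X i) /\ (i \in S) = (ev l (X i) == 0))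
  (cell (face_cell F S) l).
Proof.
move=> SF; rewrite /cell all_map; apply: (iffP allP) => h i.
  move=> iF; have := h i; rewrite mem_enum /= /cond /= => /(_ iF).
  by case: (boolP (i \in S)) => _ /=; [move/eqP->; rewrite eqxx|
    move=> h0; rewrite ltW // gt_eqF].
rewrite mem_enum => iF; have [h0 e] := h i iF; rewrite /= /cond /= e.
by case: eqP => //= ?; rewrite lt_def h0 andbT; apply/eqP.
Qed.

Lemma eqker_face_cell F S : S \subset F -> (eqker (face_cell F S) == annih S)%MS.
Proof.
move=> /subsetP SF; apply/andP; split; apply/row_subP => r.
  apply/annihP => i iS; have := row_sub r (eqker (face_cell F S)).
  rewrite eqkerP all_map => /allP/(_ i); rewrite mem_enum /= iS.
  by move=> /(_ (SF _ iS))/eqP.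
rewrite eqkerP all_map; apply/allP => i _ /=.
case: (boolP (i \in S)) => //= iS; apply/eqP.
by have /annihP -> := row_sub r (annih S).
Qed.

Lemma chi_face_cell F S : face F -> S \subset F ->
  chi (face_cell F S) = if face S then (-1) ^+ \rank (annih S) else 0.
Proof.
move=> fF SF; have rE : \rank (eqker (face_cell F S)) = \rank (annih S).
  exact/eqmx_rank/eqker_face_cell.
case: ifP => [fS|nfS].
  have [p hp] := face_witness F fS.
  by rewrite (@chi_cell _ _ _ p) ?rE //; apply/face_cellP.
apply: chi0 => l; apply: contraFN nfS => /(face_cellP _ SF).
exact: face_lift.
Qed.

Section Euler.
Context (G F : {set I}) (p : 'rV[R]_d).
Hypotheses (fF : face F) (GF : G \proper F).
Hypothesis hp : forall i, i \in F -> 0 <= ev p (X i) /\ (i \in G) = (ev p (X i) == 0).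

Let p_gt0 i : i \in F :\: G -> 0 < ev p (X i).
Proof.
by rewrite inE => /andP[iG iF]; have [a b] := hp iF; rewrite lt_def a -b iG.
Qed.

Let p_eq0 i : i \in G -> ev p (X i) = 0.
Proof.
by move=> iG; apply/eqP; rewrite -(hp _).2 //; case/properP: GF => /subsetP->.
Qed.

(* The functionals vanishing on [G] that take their least value relative to [p]
   on [S :\: G]; this is the sum of the cell of [S] and the line through [p]. *)
Definition argmin_cell S i0 : seq ('cV[R]_d * bool) :=
  [seq (X i, false) | i <- enum G] ++
  [seq (ev p (X i0) *: X i - ev p (X i) *: X i0, i \notin S) | i <- enum (F :\: G)].

Lemma argmin_cellP S i0 l : reflect
  ((forall i, i \in G -> ev l (X i) = 0) /\
   forall i, i \in F :\: G ->
    ev l (X i0) * ev p (X i) <= ev l (X i) * ev p (X i0) /\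
    (i \in S) = (ev l (X i0) * ev p (X i) == ev l (X i) * ev p (X i0)))
  (cell (argmin_cell S i0) l).
Proof.
rewrite /cell all_cat !all_map.
have ME i : ev l (ev p (X i0) *: X i - ev p (X i) *: X i0) =
    ev l (X i) * ev p (X i0) - ev l (X i0) * ev p (X i).
  by rewrite evBr !evZr mulrC [ev p (X i) * _]mulrC.
apply: (iffP andP) => -[h1 h2]; split.
- by move=> i iG; move/allP/(_ i): h1; rewrite mem_enum => /(_ iG)/eqP.
- move=> i iD; move/allP/(_ i): h2; rewrite mem_enum => /(_ iD) /=.
  rewrite /cond /= ME subr_gt0 subr_eq0; case: (i \in S) => /=.
    by move/eqP->; rewrite eqxx.
  by move=> lt; rewrite ltW // lt_eqF.
- by apply/allP => i; rewrite mem_enum => /h1 /eqP.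
- apply/allP => i; rewrite mem_enum => /h2[le e] /=.
  rewrite /cond /= ME subr_gt0 subr_eq0 e; case: eqP => [->|/eqP ne] /=.
    by rewrite eqxx.
  by rewrite lt_def le eq_sym ne.
Qed.

(** Adding the line through [p] raises the dimension by one, hence the sign: inside the larger span,
    [annih S] is cut out by vanishing at [X i0], where [p] is positive. *)
Lemma chi_argmin_cell S i0 : G \subset S -> S \subset F -> i0 \in S :\: G ->
  chi (argmin_cell S i0) = - chi (face_cell F S).
Proof.
move=> GS SF /setDP[i0S i0G]; have i0F := subsetP SF _ i0S.
have pi0 : 0 < ev p (X i0) by apply: p_gt0; rewrite inE i0G.
have GF' : G \subset F by case/properP: GF.
have sub l : cell (face_cell F S) l -> cell (argmin_cell S i0) l.
  move=> /(face_cellP _ SF) h; apply/argmin_cellP.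
  have -> : ev l (X i0) = 0 by apply/eqP; rewrite -(h i0 i0F).2.
  split=> i.
    by move=> iG; apply/eqP; rewrite -(h i (subsetP GF' _ iG)).2 (subsetP GS).
  move=> iD; have /setDP[iF _] := iD; have [h0 e] := h i iF.
  rewrite !mul0r; split; first by rewrite mulr_ge0 // ltW.
  by rewrite eq_sym mulf_eq0 (gt_eqF pi0) orbF.
have kE : (annih S == eqker (argmin_cell S i0) :&: kermx (X i0))%MS.
  apply/andP; split; apply/row_subP => r.
    have /annihP h := row_sub r (annih S).
    rewrite sub_capmx; apply/andP; split; last first.
      by apply/sub_kermxP/eqP; rewrite ev_eq0 h.
    rewrite eqkerP all_cat !all_map; apply/andP; split; apply/allP => i.
      by rewrite mem_enum => iG; rewrite /= h // (subsetP GS).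
    rewrite mem_enum /= => iD; case: (boolP (i \in S)) => //= iS.
    by rewrite evBr !evZr !h // !mulr0 subrr.
  set l := row r _.
  have : (l <= eqker (argmin_cell S i0) :&: kermx (X i0))%MS by apply: row_sub.
  rewrite sub_capmx eqkerP all_cat !all_map => /andP[/andP[/allP h1 /allP h2] h3].
  have l0 : ev l (X i0) = 0 by apply/eqP; rewrite -ev_eq0; apply/eqP/sub_kermxP.
  apply/annihP => i iS; case: (boolP (i \in G)) => [iG|iG].
    by apply/eqP/h1; rewrite mem_enum.
  have /h2 : i \in enum (F :\: G) by rewrite mem_enum inE iG (subsetP SF).
  rewrite /= iS /= evBr !evZr l0 mulr0 subr0 mulf_eq0 gt_eqF //= => /eqP //.
have rE : \rank (eqker (argmin_cell S i0)) = (\rank (annih S)).+1.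
  rewrite (eqmx_rank kE); apply: (@rank_cap_kermx _ _ _ p).
    rewrite eqkerP all_cat !all_map; apply/andP; split; apply/allP => i.
      by rewrite mem_enum => iG; rewrite /= p_eq0.
    by move=> _ /=; rewrite evBr !evZr mulrC subrr eqxx orbT.
  by rewrite gt_eqF.
rewrite chi_face_cell //; case: ifP => [fS|nfS]; last first.
  rewrite oppr0; apply: chi0 => l; apply: contraFN nfS => /argmin_cellP[h1 h2].
  (* Moving [l] along [p] until it vanishes at [X i0] gives a functional exposing [S] in [F]; the
     scaling by [ev p (X i0)] avoids a division. *)
  apply: (face_lift (l := ev p (X i0) *: l - ev l (X i0) *: p) fF SF) => i iF.
  rewrite evBl !evZl; case: (boolP (i \in G)) => iG.
    by rewrite (h1 _ iG) (p_eq0 iG) !mulr0 subrr lexx eqxx (subsetP GS).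
  have [|le ->] := h2 i; first by rewrite inE iG.
  by rewrite subr_ge0 subr_eq0 [ev p (X i0) * _]mulrC le [RHS]eq_sym.
have [l hl] := face_witness F fS.
rewrite (@chi_cell _ _ _ l); last by apply/sub/face_cellP.
by rewrite rE exprS mulN1r.
Qed.

(* Projecting along [p] maps the cells of the faces above [G] onto a partition
   of the space of functionals vanishing on [G]. *)
Lemma sum_chi_face_cell :
  \sum_(S : {set I} | (G \subset S) && (S \subset F)) chi (face_cell F S) = 0.
Proof.
have GF' : G \subset F by case/properP: GF.
have [j0 j0D _] := argmin_ratio 0 GF hp.
pose i0 S := odflt j0 [pick i in S :\: G].
pose q : seq ('cV[R]_d * bool) := [seq (X i, false) | i <- enum G].
(* The sets that do not lie strictly between get an empty cell. *)
pose r S := if (G \proper S) && (S \subset F) then argmin_cell S (i0 S)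
            else [:: (0 : 'cV[R]_d, true)].
have i0P S : G \proper S -> i0 S \in S :\: G.
  move=> /properP[_ [i iS iG]]; rewrite /i0; case: pickP => //= /(_ i).
  by rewrite inE iS iG.
have cell0 l : cell [:: (0 : 'cV[R]_d, true)] l = false.
  by rewrite /cell /= /cond /= /ev mulmx0 mxE ltxx.
have rP S l : cell (r S) l -> [/\ G \proper S, S \subset F & cell (argmin_cell S (i0 S)) l].
  by rewrite /r; case: ifP => [/andP[]//|]; rewrite cell0.
have qP l : reflect (forall i, i \in G -> ev l (X i) = 0) (cell q l).
  rewrite /cell all_map; apply: (iffP allP) => h i.
    by move=> iG; apply/eqP/h; rewrite mem_enum.
  by rewrite mem_enum => /h /eqP.
have part : chi q = \sum_S chi (r S).
  apply: chi_partition.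
  - by move=> S l /rP[_ _ /argmin_cellP[h _]]; apply/qP.
  - move=> l /qP hl; have [i1 i1D hm] := argmin_ratio l GF hp.
    (* The part containing [l] is given by the indices at which the ratio of [l] to [p] attains its
       minimum. *)
    pose S := G :|: [set i in F :\: G |
      ev l (X i1) * ev p (X i) == ev l (X i) * ev p (X i1)].
    have i1S : i1 \in S by rewrite 2!inE i1D eqxx orbT.
    have /setDP[i1F i1G] := i1D.
    have GS : G \proper S.
      by apply/properP; split; [exact: subsetUl|exists i1].
    have SF : S \subset F.
      by apply/subsetP => i; rewrite !inE => /orP[/(subsetP GF')//|/andP[/andP[]]].
    exists S; rewrite /r GS SF /=; apply/argmin_cellP; split=> // i iD.
    have /setDP[iS iG] := i0P _ GS.
    have iSF := subsetP SF _ iS.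
    have e0 : ev l (X i1) * ev p (X (i0 S)) = ev l (X (i0 S)) * ev p (X i1).
      by move: iS; rewrite !inE (negPf iG) /= => /andP[_ /eqP].
    have p1 := p_gt0 i1D.
    have p0 : 0 < ev p (X (i0 S)) by apply: p_gt0; rewrite inE iG.
    have -> : ev l (X (i0 S)) = ev l (X i1) * ev p (X (i0 S)) / ev p (X i1).
      by rewrite e0 mulfK // gt_eqF.
    have sc a b : ((a * ev p (X (i0 S)) / ev p (X i1) * b <= ev l (X i) * ev p (X (i0 S)))
        = (a * b <= ev l (X i) * ev p (X i1))) *
        ((a * ev p (X (i0 S)) / ev p (X i1) * b == ev l (X i) * ev p (X (i0 S)))
        = (a * b == ev l (X i) * ev p (X i1))).
      have E : a * ev p (X (i0 S)) / ev p (X i1) * b =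
          a * b / ev p (X i1) * ev p (X (i0 S)) by ring.
      rewrite E ler_pM2r // ler_pdivrMr //; split=> //.
      rewrite (inj_eq (mulIf (lt0r_neq0 p0))) -[LHS](inj_eq (mulIf (lt0r_neq0 p1))).
      by rewrite divfK // gt_eqF.
    rewrite !sc hm //; split=> //; rewrite 2!inE iD /=.
    by case/setDP: iD => _ /negPf->.
  - move=> S T l /rP[GS SF /argmin_cellP[_ hS]] /rP[GT TF /argmin_cellP[_ hT]].
    have /setDP[sS sG] := i0P _ GS; have /setDP[tT tG] := i0P _ GT.
    have sD : i0 S \in F :\: G by rewrite inE sG (subsetP SF).
    have tD : i0 T \in F :\: G by rewrite inE tG (subsetP TF).
    have e : ev l (X (i0 S)) * ev p (X (i0 T)) = ev l (X (i0 T)) * ev p (X (i0 S)).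
      by apply/eqP; rewrite eq_le (hS _ tD).1 (hT _ sD).1.
    have s0 := p_gt0 sD; have t0 := p_gt0 tD.
    apply/setP => i; case: (boolP (i \in G)) => [iG|iG].
      by rewrite (subsetP (proper_sub GS)) // (subsetP (proper_sub GT)).
    case: (boolP (i \in F)) => [iF|iF]; last first.
      by rewrite (contraNF (subsetP SF _)) // (contraNF (subsetP TF _)).
    have iD : i \in F :\: G by rewrite inE iG.
    rewrite (hS _ iD).2 (hT _ iD).2.
    rewrite -(inj_eq (mulIf (lt0r_neq0 t0))) -[RHS](inj_eq (mulIf (lt0r_neq0 s0))).
    by rewrite mulrAC e mulrAC; congr (_ == _); rewrite mulrAC.
have qE : chi q = chi (face_cell F G).
  have fG : face G by apply: (face_lift fF GF' hp).
  rewrite chi_face_cell // fG (@chi_cell _ _ _ 0) //; apply/qP => i _.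
  by rewrite ev0l.
(* The term of [G] is [chi q], and the other terms are minus the parts of the partition, so that
   everything cancels. *)
rewrite (bigD1 G) /=; last by rewrite subxx.
rewrite -qE part [X in _ + X = _](eq_bigr (fun S => - chi (r S))); last first.
  move=> S /andP[/andP[GS SF] nG]; have GS' : G \proper S.
    by rewrite properEneq eq_sym nG.
  by rewrite /r GS' SF /= chi_argmin_cell ?opprK ?i0P.
rewrite sumrN [X in _ - X = _]big_mkcond -sumrB /= big1 // => S _.
case: ifP => [|h]; first by rewrite subrr.
rewrite subr0 /r; case: ifP => [/andP[GS SF]|_]; last by apply: chi0 => l; rewrite cell0.
by move: h; rewrite proper_sub // SF /= => /negbFE/eqP E; rewrite E properxx in GS.
Qed.

End Euler.

Lemma euler G F : face G -> face F -> G \proper F ->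
  \sum_(S : {set I} | [&& face S, G \subset S & S \subset F]) (-1) ^+ rk S = 0 :> int.
Proof.
move=> fG fF GF; have [p hp] := face_witness F fG.
have := sum_chi_face_cell fF GF hp; rewrite (bigID face) /= [X in _ + X]big1 ?addr0; last first.
  by move=> S /andP[/andP[_ SF] nf]; rewrite chi_face_cell // (negPf nf).
(* The rank of [S] and the dimension of its annihilator add up to [d], so the signs differ by a
   constant factor. *)
rewrite (eq_bigr (fun S => (-1) ^+ d * (-1) ^+ rk S)) => [|S]; last first.
  move=> /andP[/andP[_ SF] fS]; rewrite chi_face_cell // fS.
  rewrite -[in RHS](congr1 (GRing.exp (-1)) (rk_annih S)) exprD mulrAC -exprD.
  by rewrite addnn -mul2n exprM sqrrN !expr1n mul1r.
rewrite -mulr_sumr => /eqP; rewrite mulf_eq0 signr_eq0 /= => /eqP E.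
by rewrite -[RHS]E; apply: eq_bigl => S; rewrite andbC.
Qed.

(** A functional [l] that vanishes on [G] and at one further [X i] of [F] vanishes on all of [F]:
    moved along [p] until it touches [F :\: G], it exposes a face strictly above [G], hence [F]; so
    it is zero on [F], and its value at [X i] shows that it was never moved. The rank is thereby
    determined by the order of the faces. *)
Lemma rk_maximal_face G F : face G -> face F -> G \proper F ->
    (forall S, face S -> G \proper S -> S \subset F -> S = F) ->
  rk F = (rk G).+1.
Proof.
move=> fG fF GF max; have [p hp] := face_witness F fG.
have GF' := proper_sub GF.
have [i iD _] := argmin_ratio 0 GF hp; have /setDP[iF iG] := iD.
have p_gt0 j : j \in F :\: G -> 0 < ev p (X j).
  by rewrite inE => /andP[jG jF]; have [a b] := hp j jF; rewrite lt_def a -b jG.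
have pG : (p <= annih G)%MS.
  by apply/annihP => j jG; apply/eqP; rewrite -(hp _ _).2 // (subsetP GF').
have kE : (annih F == annih G :&: kermx (X i))%MS.
  apply/andP; split; apply/row_subP => r.
    have h := row_sub r (annih F); have /annihP h' := h.
    rewrite sub_capmx (submx_trans h) ?annihS //=.
    by apply/sub_kermxP/eqP; rewrite ev_eq0 h'.
  set l := row r _; have : (l <= annih G :&: kermx (X i))%MS by apply: row_sub.
  rewrite sub_capmx => /andP[/annihP lG /sub_kermxP/eqP]; rewrite ev_eq0 => /eqP li.
  have [i0 i0D hm] := argmin_ratio l GF hp; have /setDP[i0F i0G] := i0D.
  pose l' := ev p (X i0) *: l - ev l (X i0) *: p.
  have l'0 j : j \in F -> 0 <= ev l' (X j).
    move=> jF; rewrite evBl !evZl; case: (boolP (j \in G)) => jG.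
      have := (hp _ jF).2; rewrite jG => /esym/eqP pj.
      by rewrite (lG _ jG) pj !mulr0 subrr.
    by rewrite subr_ge0 [ev p _ * _]mulrC hm // inE jG.
  pose S := [set j in F | ev l' (X j) == 0].
  have SF : S \subset F by apply/subsetP => j; rewrite inE => /andP[].
  have fS : face S.
    by apply: (face_lift (l := l') fF SF) => j jF; rewrite l'0 // inE jF.
  have GS : G \proper S.
    apply/properP; split.
      apply/subsetP => j jG; have jF := subsetP GF' _ jG; rewrite inE jF /=.
      by rewrite evBl !evZl (lG _ jG) (annihP _ _ pG _ jG) !mulr0 subrr.
    exists i0 => //; rewrite inE i0F /= evBl !evZl mulrC subrr //.
  have SE := max _ fS GS SF.
  have l'F j : j \in F -> ev l' (X j) = 0.
    by rewrite -{1}SE inE => /andP[_ /eqP].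
  have l0 : ev l (X i0) = 0.
    have /eqP := l'F i iF; rewrite evBl !evZl li mulr0 sub0r oppr_eq0 mulf_eq0.
    by rewrite [ev p _ == 0]gt_eqF ?p_gt0 // orbF => /eqP.
  apply/annihP => j jF; have /eqP := l'F j jF.
  rewrite evBl !evZl l0 mul0r subr0 mulf_eq0 gt_eqF ?p_gt0 //= => /eqP //.
have := rank_cap_kermx pG (_ : ev p (X i) != 0).
rewrite gt_eqF ?p_gt0 // => /(_ isT); rewrite -(eqmx_rank kE).
have := rk_annih F; have := rk_annih G; lia.
Qed.

Lemma maximal_face_exists F : face set0 -> face F -> F != set0 ->
  exists M, [/\ face M, M \proper F, rk F = (rk M).+1 &
    forall S, face S -> M \proper S -> S \subset F -> S = F].
Proof.
move=> f0 fF F0; have pr0 : face set0 && (set0 \proper F) by rewrite f0 proper0.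
have [M] := @maxset_exists _ (fun M => face M && (M \proper F)) _ pr0.
move=> /maxsetP[/andP[fM MF] max _].
have maxM S : face S -> M \proper S -> S \subset F -> S = F.
  move=> fS MS SF; apply: contrapT => /eqP SnF.
  have pr : S \proper F by rewrite properEneq SnF.
  have := max S; rewrite fS pr (proper_sub MS) => /(_ isT isT) E.
  by rewrite E properxx in MS.
by exists M; split=> //; apply: rk_maximal_face.
Qed.

End Configurations.

(** * Flag numbers of cones and prisms *)

Section FlagCounts.
Context (R : realFieldType) (I : finType) (d : nat) (X : I -> 'cV[R]_d).
Implicit Types (S F G T : {set I}) (w : seq nat).

(* The number of chains of faces F > F_1 > ... > F_k, the last one being empty,
   whose successive codimensions are the letters of [w]. *)
Fixpoint flags w F : int :=
  if w is j :: w' then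
    \sum_(S | [&& face X S, S \subset F & (rk X S + j)%N == rk X F]) flags w' S
  else (F == set0)%:R.

Lemma face_rk_inj S F : face X S -> S \subset F ->
  rk X S = rk X F -> S = F.
Proof.
move=> fS SF e; apply/eqP; move: SF; rewrite subEproper => /orP[//|pr].
by have := face_rk_lt fS pr; rewrite e ltnn.
Qed.

Lemma flags0 w F : face X F -> flags (0 :: w) F = flags w F.
Proof.
move=> fF /=; rewrite (big_pred1 F) // => S.
apply/and3P/eqP => [[fS SF /eqP e]|->]; last by rewrite addn0.
by apply: face_rk_inj => //; rewrite -e addn0.
Qed.

Lemma flags_set0 w : has (leq 1) w -> flags w set0 = 0.
Proof.
elim: w => //= j w IH; case: j => [|j] /= h; last first.
  rewrite big_pred0 // => S; rewrite subset0; case: eqP => [->|]; rewrite ?andbF //.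
  by rewrite -[X in _ == X]addn0 eqn_add2l andbF.
by rewrite big1 // => S; rewrite subset0 => /and3P[_ /eqP-> _]; apply: IH.
Qed.

(** After exchanging the sums, the coefficient of [g T] is Euler's sum over the faces between [T]
    and [F], with signs counting codimension in [F] instead of rank. The weight [g] is general so as
    to serve both flag numbers and the operators. *)
Lemma codim_euler (V : zmodType) (g : {set I} -> V) k F : face X F -> (0 < k)%N ->
  \sum_(i < k.+1) \sum_(S | [&& face X S, S \subset F & (rk X S + i)%N == rk X F])
    \sum_(T | [&& face X T, T \subset S & (rk X T + (k - i))%N == rk X S])
      g T *~ (-1) ^+ i = 0.
Proof.
move=> fF k0.
transitivity (\sum_(T | [&& face X T, T \subset F & (rk X T + k)%N == rk X F])
  \sum_(i < k.+1) \sum_(S | [&& face X S, T \subset S, S \subset F & (rk X S + i)%N == rk X F])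
   g T *~ (-1) ^+ i).
  rewrite exchange_big /=; apply: eq_bigr => i _.
  rewrite (exchange_big_dep (fun T => [&& face X T, T \subset F & (rk X T + k)%N == rk X F])) /=.
    apply: eq_bigr => T /and3P[fT TF /eqP rT]; apply: eq_bigl => S.
    rewrite fT /=; case: (face X S) => //=; case: (S \subset F); rewrite ?andbF //=.
    case: (T \subset S); rewrite ?andbF //=.
    by have := ltn_ord i; lia.
  move=> S T /and3P[fS SF rS] /and3P[fT TS rT]; rewrite fT (subset_trans TS) //=.
  by have := ltn_ord i; lia.
rewrite big1 // => T /and3P[fT TF /eqP rT].
have pr : T \proper F.
  by rewrite properEneq TF andbT; apply/eqP => e; rewrite e in rT; lia.
under eq_bigr do rewrite -mulrz_sumr.
rewrite -mulrz_sumr [X in _ *~ X](_ : _ = 0) ?mulr0z //.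
rewrite (exchange_big_dep (fun S => [&& face X S, T \subset S & S \subset F])) /=; last first.
  by move=> i S _ /and4P[-> -> ->].
have := euler fT fF pr; move/(congr1 (fun x => (-1) ^+ rk X F * x)).
rewrite mulr0 => E; rewrite -[RHS]E mulr_sumr; apply: eq_bigr => S /and3P[fS TS SF].
have rS := rkS X SF; have rTS := rkS X TS.
have lt : (rk X F - rk X S < k.+1)%N by lia.
rewrite (big_pred1 (Ordinal lt)) => [|i].
  by rewrite -signr_odd /= oddB // signr_addb !signr_odd.
rewrite /= fS TS SF /= -val_eqE /=; apply/eqP/eqP; lia.
Qed.

Lemma flags_euler u v k F : face X F -> (0 < k)%N ->
  \sum_(i < k.+1) (-1) ^+ i * flags (u ++ nat_of_ord i :: (k - i)%N :: v) F = 0.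
Proof.
move=> fF k0; elim: u F fF => [|a u IH] F fF /=; last first.
  under eq_bigr do rewrite big_distrr.
  by rewrite exchange_big /= big1 // => S /and3P[fS _ _]; apply: IH.
rewrite -[RHS](codim_euler (flags v) fF k0); apply: eq_bigr => i _.
rewrite mulr_sumr; apply: eq_bigr => S _; rewrite mulr_sumr.
by apply: eq_bigr => T _; rewrite -mulrzr intz mulrC.
Qed.

End FlagCounts.

(** * Ranks and flag numbers as invariants of the face lattice *)

Section LatticeIsomorphisms.
Context (R : realFieldType).

(** Only the values of [phi] on the faces of [F] are constrained; injectivity there follows since
    inclusion is both preserved and reflected. *)
Definition lattice_iso (I J : finType) (d e : nat) (X : I -> 'cV[R]_d) (F : {set I})
    (Y : J -> 'cV[R]_e) (G : {set J}) (phi : {set I} -> {set J}) : Prop :=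
  [/\ forall S, face X S -> S \subset F -> face Y (phi S) /\ phi S \subset G,
      forall S T, face X S -> S \subset F -> face X T -> T \subset F ->
        (phi S \subset phi T) = (S \subset T) &
      forall T, face Y T -> T \subset G ->
        exists S, [/\ face X S, S \subset F & phi S = T]].

Context (I J : finType) (d e : nat) (X : I -> 'cV[R]_d) (Y : J -> 'cV[R]_e).
Context (F : {set I}) (G : {set J}) (phi : {set I} -> {set J}).
Hypotheses (iso : lattice_iso X F Y G phi).
Hypotheses (fF : face X F) (fG : face Y G) (X0 : face X set0) (Y0 : face Y set0).

Lemma lattice_iso_inj S T : face X S -> S \subset F -> face X T -> T \subset F ->
  phi S = phi T -> S = T.
Proof.
move=> fS SF fT TF E; case: iso => _ mon _; apply/eqP; rewrite eqEsubset.
by rewrite -(mon S T) // -(mon T S) // E subxx.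
Qed.

Lemma lattice_iso_set0 : phi set0 = set0.
Proof.
case: iso => ph mon sur; have [S [fS SF E]] := sur _ Y0 (sub0set _).
by apply/eqP; rewrite -subset0 -E mon // sub0set.
Qed.

Lemma lattice_iso_top : phi F = G.
Proof.
case: iso => ph mon sur; have [S [fS SF E]] := sur _ fG (subxx _).
apply/eqP; rewrite eqEsubset (ph _ fF (subxx _)).2 /=.
by rewrite -{1}E mon.
Qed.

Lemma lattice_iso_restr S : face X S -> S \subset F ->
  lattice_iso X S Y (phi S) phi.
Proof.
move=> fS SF; case: iso => ph mon sur; split.
- move=> T fT TS; have TF := subset_trans TS SF.
  by rewrite mon //; case: (ph T).
- by move=> T T' fT TS fT' TS'; rewrite mon //; apply: subset_trans SF.
- move=> T fT TS; have [|S' [fS' S'F E]] := sur T fT.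
    exact: subset_trans TS (ph _ fS SF).2.
  by exists S'; split=> //; rewrite -mon // E.
Qed.

Lemma lattice_iso_sum (V : nmodType) (P : pred {set I}) (Q : pred {set J})
    (f : {set I} -> V) (g : {set J} -> V) :
    (forall S, face X S -> S \subset F -> P S = Q (phi S)) ->
    (forall S, face X S -> S \subset F -> P S -> f S = g (phi S)) ->
  \sum_(S | [&& face X S, S \subset F & P S]) f S =
  \sum_(T | [&& face Y T, T \subset G & Q T]) g T.
Proof.
case: iso => ph mon sur PQ fg.
rewrite (partition_big phi [pred T | [&& face Y T, T \subset G & Q T]]) /=; last first.
  by move=> S /and3P[fS SF PS]; have [-> ->] := ph S fS SF; rewrite -PQ.
apply: eq_bigr => T /and3P[fT TG QT]; have [S [fS SF E]] := sur T fT TG.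
rewrite (big_pred1 S) => [|S']; first by rewrite -E fg // PQ // E.
apply/andP/eqP => [[/and3P[fS' S'F PS'] /eqP E']|->].
  by apply: lattice_iso_inj => //; rewrite E'.
by rewrite fS SF PQ // E QT eqxx.
Qed.

(** Induction on the size of the face: a maximal proper face has rank one less, and isomorphisms
    preserve maximality. *)
Lemma lattice_iso_rk_face S : face X S -> S \subset F -> rk X S = rk Y (phi S).
Proof.
have [n] := ubnP #|S|; elim: n S => // n IH S /ltnSE Sn fS SF.
case: iso => ph mon sur.
have [->|S0] := eqVneq S set0; first by rewrite lattice_iso_set0 !rk0.
have [M [fM MS -> max]] := maximal_face_exists X0 fS S0.
have MF : M \subset F by apply: subset_trans SF; apply: proper_sub.
have [fM' MG] := ph _ fM MF; have [fS' SG] := ph _ fS SF.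
have MS' : phi M \proper phi S by rewrite properE !mon // -properE.
rewrite (rk_maximal_face fM' fS' MS') => [|T fT MT TS].
  by rewrite (IH M) //; apply: leq_trans (proper_card MS) _.
have [T' [fT' T'F E]] := sur T fT (subset_trans TS SG).
have MT' : M \proper T' by move: MT; rewrite -E !properE !mon.
by rewrite -E (max T') // -(mon T' S) // E.
Qed.

Lemma lattice_iso_rk : rk X F = rk Y G.
Proof. by rewrite lattice_iso_rk_face // lattice_iso_top. Qed.

Lemma lattice_iso_flags_face w S : face X S -> S \subset F ->
  flags X w S = flags Y w (phi S).
Proof.
elim: w S => [|j w IH] S fS SF /=.
  congr (nat_of_bool _)%:R; apply/eqP/eqP => [->|E]; first exact: lattice_iso_set0.
  by apply: lattice_iso_inj; rewrite ?sub0set // lattice_iso_set0.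
case: iso => ph mon sur.
rewrite [LHS](eq_bigl (fun T => [&& face X T, T \subset F &
    (T \subset S) && ((rk X T + j)%N == rk X S)])); last first.
  by move=> T; case TS: (T \subset S); rewrite ?andbF // (subset_trans TS SF).
rewrite [RHS](eq_bigl (fun T => [&& face Y T, T \subset G &
    (T \subset phi S) && ((rk Y T + j)%N == rk Y (phi S))])); last first.
  move=> T; case TS: (T \subset phi S); rewrite ?andbF //.
  by rewrite (subset_trans TS) //; case: (ph S).
apply: lattice_iso_sum => T fT TF; last by move=> _; apply: IH.
by rewrite mon // !lattice_iso_rk_face.
Qed.

Lemma lattice_iso_flags w : flags X w F = flags Y w G.
Proof. by rewrite lattice_iso_flags_face // lattice_iso_top. Qed.

End LatticeIsomorphisms.

(** The terms of the derivation d_k |-> d_(k-1) on a word. A letter 1 becomes 0, which stands for a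
    repeated face in a chain. *)
Fixpoint lowerings (w : seq nat) : seq (seq nat) :=
  if w is j :: w' then (j.-1 :: w') :: [seq j :: v | v <- lowerings w'] else [::].

(** * Cones (pyramids) over a configuration *)

Section Cone.
Context (R : realFieldType) (I : finType) (d : nat) (X : I -> 'cV[R]_d).
Hypothesis X0 : face X set0.
Implicit Types (S F T : {set I}).

Definition cone (o : option I) : 'cV[R]_(d + 1) :=
  if o is Some i then col_mx (X i) 0 else col_mx 0 1%:M.

Definition base S : {set option I} := Some @: S.
Definition apex S : {set option I} := None |: base S.

Lemma ev_row_mx (e : nat) (l : 'rV[R]_d) (m : 'rV[R]_e) a b :
  ev (row_mx l m) (col_mx a b) = ev l a + ev m b.
Proof. by rewrite /ev mul_row_col mxE. Qed.

Lemma ev0r n (l : 'rV[R]_n) : ev l 0 = 0.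
Proof. by rewrite /ev mulmx0 mxE. Qed.

Lemma in_base S o : (o \in base S) = if o is Some i then i \in S else false.
Proof.
case: o => [i|]; first by rewrite mem_imset // => x y [].
by apply/imsetP => -[].
Qed.

Lemma in_apex S o : (o \in apex S) = if o is Some i then i \in S else true.
Proof. by rewrite in_setU1 in_base; case: o. Qed.

Lemma cone_setP (Z : {set option I}) : exists S, Z = base S \/ Z = apex S.
Proof.
exists [set i | Some i \in Z]; case: (boolP (None \in Z)) => h; [right|left];
  by apply/setP => -[i|]; rewrite ?in_apex ?in_base ?inE // (negPf h).
Qed.

Lemma base_sub S T : (base S \subset base T) = (S \subset T).
Proof.
apply/subsetP/subsetP => h i; first by have := h (Some i); rewrite !in_base.
by rewrite !in_base; case: i.
Qed.

Lemma apex_sub S T : (apex S \subset apex T) = (S \subset T).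
Proof.
apply/subsetP/subsetP => h i; first by have := h (Some i); rewrite !in_apex.
by rewrite !in_apex; case: i.
Qed.

Lemma base_sub_apex S T : (base S \subset apex T) = (S \subset T).
Proof.
apply/subsetP/subsetP => h i; first by have := h (Some i); rewrite in_base in_apex.
by rewrite in_base in_apex; case: i.
Qed.

Lemma apex_sub_base S T : (apex S \subset base T) = false.
Proof. by apply/subsetP => /(_ None); rewrite in_base in_apex => /(_ isT). Qed.

Lemma face_base S : face cone (base S) = face X S.
Proof.
apply/asboolP/asboolP => -[l hl].
  exists (lsubmx l) => i; have := hl (Some i).
  by rewrite in_base -{1 2}[l]hsubmxK ev_row_mx ev0r addr0.
exists (row_mx l 1%:M) => -[i|]; rewrite in_base ev_row_mx ev0r ?addr0 //.
by rewrite add0r /ev mul1mx mxE /= ler01 oner_eq0.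
Qed.

Lemma face_apex S : face cone (apex S) = face X S.
Proof.
apply/asboolP/asboolP => -[l hl].
  exists (lsubmx l) => i; have := hl (Some i).
  by rewrite in_apex -{1 2}[l]hsubmxK ev_row_mx ev0r addr0.
exists (row_mx l 0) => -[i|]; rewrite in_apex ev_row_mx ev0l ?addr0 //.
by rewrite ev0r lexx eqxx.
Qed.

Lemma face_cone0 : face cone set0.
Proof.
by rewrite (_ : set0 = base set0) ?face_base //; apply/setP => -[i|]; rewrite in_base !inE.
Qed.

Lemma base_iso F : lattice_iso X F cone (base F) base.
Proof.
split=> [S fS SF|S T _ _ _ _|Z fZ ZF]; first by rewrite face_base base_sub.
  exact: base_sub.
have [S [E|E]] := cone_setP Z; rewrite E ?apex_sub_base // in fZ ZF *.
by exists S; rewrite face_base in fZ; rewrite base_sub in ZF.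
Qed.

Lemma rk_base F : face X F -> rk cone (base F) = rk X F.
Proof.
by move=> fF; rewrite (lattice_iso_rk (base_iso F)) ?face_base //; apply: face_cone0.
Qed.

Lemma flags_base w F : face X F -> flags cone w (base F) = flags X w F.
Proof.
by move=> fF; rewrite (lattice_iso_flags (base_iso F)) ?face_base //; apply: face_cone0.
Qed.

Lemma rk_apex F : face X F -> rk cone (apex F) = (rk X F).+1.
Proof.
move=> fF; rewrite -rk_base //; apply: rk_maximal_face.
- by rewrite face_base.
- by rewrite face_apex.
- by rewrite properE base_sub_apex subxx apex_sub_base.
- move=> Z fZ; have [S [->|->]] := cone_setP Z.
    by rewrite properE !base_sub base_sub_apex => /andP[_ /negbTE->].
  move=> /proper_sub; rewrite base_sub_apex apex_sub => FS SF.
  by congr apex; apply/eqP; rewrite eqEsubset SF.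
Qed.

Lemma big_cone (V : nmodType) (P : pred {set option I}) (f : {set option I} -> V) :
  \sum_(Z | P Z) f Z = \sum_(S | P (base S)) f (base S) + \sum_(S | P (apex S)) f (apex S).
Proof.
pose k (Z : {set option I}) := [set i | Some i \in Z].
have pb S : k (base S) = S.
  by apply/setP => i; rewrite inE in_base.
have pa S : k (apex S) = S.
  by apply/setP => i; rewrite inE in_apex.
rewrite (bigID (fun Z : {set option I} => None \in Z)) /= addrC; congr (_ + _).
  rewrite (reindex_onto base k) /= => [|Z /andP[_ nZ]].
    by apply: eq_bigl => S; rewrite in_base andbT pb eqxx andbT.
  by apply/setP => -[i|]; rewrite in_base ?inE // (negPf nZ).
rewrite (reindex_onto apex k) /= => [|Z /andP[_ nZ]].
  by apply: eq_bigl => S; rewrite in_apex andbT pa eqxx andbT.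
by apply/setP => -[i|]; rewrite in_apex ?inE.
Qed.

(** A chain from the cone over [F] to the empty face loses the apex in exactly one step, and the
    codimension of that step exceeds that of its trace in [F] by one. A letter 0 could not be such a
    step, hence the positivity. *)
Lemma flags_apex w F : face X F -> all (leq 1) w ->
  flags cone w (apex F) = \sum_(v <- lowerings w) flags X v F.
Proof.
elim: w F => [|j w IH] F fF /=.
  by rewrite big_nil; case: eqP => // /setP/(_ None); rewrite in_apex inE.
case/andP=> j0 wp; rewrite big_cons big_map big_cone /=; congr (_ + _).
  apply: eq_big => S; rewrite face_base base_sub_apex rk_apex //; last first.
    by case/and3P => fS _ _; rewrite flags_base.
  case fS: (face X S) => //=; case SF: (S \subset F) => //=.
  by rewrite rk_base //; lia.
rewrite exchange_big /=; apply: eq_big => S; last first.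
  by rewrite face_apex apex_sub => /and3P[fS _ _]; rewrite IH.
rewrite face_apex apex_sub; case fS: (face X S) => //=.
by rewrite !rk_apex.
Qed.

End Cone.

(** * Prisms over a configuration at height one *)

Section Prism.
Context (R : realFieldType) (I : finType) (d : nat) (X : I -> 'cV[R]_d).
Context (h : 'rV[R]_d) (h1 : forall i, ev h (X i) = 1).
Implicit Types (S F T A B : {set I}).

Let X0 : face X set0.
Proof. by apply/asboolP; exists h => i; rewrite h1 ler01 oner_eq0 inE. Qed.

Definition prism (ib : I * bool) : 'cV[R]_(d + 1) := col_mx (X ib.1) (ib.2%:R)%:M.

Definition pair_set A B : {set I * bool} :=
  [set ib | ib.1 \in if ib.2 then B else A].

Lemma in_pair_set A B ib : (ib \in pair_set A B) = (ib.1 \in if ib.2 then B else A).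
Proof. by rewrite inE. Qed.

Lemma pair_setP (Z : {set I * bool}) :
  pair_set [set i | (i, false) \in Z] [set i | (i, true) \in Z] = Z.
Proof. by apply/setP => -[i []]; rewrite !inE. Qed.

Lemma pair_set_sub A B A' B' :
  (pair_set A B \subset pair_set A' B') = (A \subset A') && (B \subset B').
Proof.
apply/subsetP/andP => [hs|[/subsetP hA /subsetP hB]].
  by split; apply/subsetP => i; [have := hs (i, false)|have := hs (i, true)];
    rewrite !in_pair_set.
by move=> [i []]; rewrite !in_pair_set /=; [apply: hB|apply: hA].
Qed.

Lemma pair_set00 : pair_set set0 set0 = set0.
Proof. by apply/setP => -[i []]; rewrite !inE. Qed.

(** Let [a] be the coefficient of the functional at the added coordinate. If it is zero, bottom and
    top have the same zeros; if positive, zeros occur only at the bottom; if negative, only at the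
    top. *)
Lemma face_pair_set A B : face prism (pair_set A B) =
  [|| (A == B) && face X A, (B == set0) && face X A | (A == set0) && face X B].
Proof.
have evE l i b : ev l (prism (i, b)) = ev (lsubmx l) (X i) + (rsubmx l 0 0) *+ b.
  rewrite -{1}[l]hsubmxK ev_row_mx; congr (_ + _).
  by rewrite /ev mul_mx_scalar mxE /= mulr_natl.
apply/asboolP/or3P => [[l hl]|].
  set a := rsubmx l 0 0 in evE.
  have hA i : 0 <= ev (lsubmx l) (X i) /\ (i \in A) = (ev (lsubmx l) (X i) == 0).
    by have := hl (i, false); rewrite evE mulr0n addr0 in_pair_set.
  have hB i : 0 <= ev (lsubmx l) (X i) + a /\ (i \in B) = (ev (lsubmx l) (X i) + a == 0).
    by have := hl (i, true); rewrite evE mulr1n in_pair_set.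
  have fA : face X A by apply/asboolP; exists (lsubmx l).
  have fB : face X B.
    by apply/asboolP; exists (lsubmx l + a *: h) => i; rewrite evDl evZl h1 mulr1.
  case: (ltrgtP a 0) => ha.
  - constructor 3; rewrite fB andbT; apply/eqP/setP => i.
    by rewrite inE (hA i).2; have := (hB i).1; case: eqP => // ->; lra.
  - constructor 2; rewrite fA andbT; apply/eqP/setP => i.
    by rewrite inE (hB i).2; have := (hA i).1 => le; apply/gt_eqF; lra.
  - constructor 1; rewrite fA andbT; apply/eqP/setP => i.
    by rewrite (hB i).2 ha addr0 (hA i).2.
have mk (l : 'rV[R]_d) (a : R) i b : ev (row_mx l a%:M) (prism (i, b)) = ev l (X i) + a *+ b.
  by rewrite evE row_mxKl row_mxKr mxE.
move=> [|  |] /andP[/eqP-> /asboolP[l hl]].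
- exists (row_mx l 0%:M) => -[i b]; rewrite mk mul0rn addr0 in_pair_set /=.
  by rewrite if_same; apply: hl.
- exists (row_mx l 1%:M) => -[i b]; rewrite mk in_pair_set /=; have [le e] := hl i.
  case: b; rewrite ?mulr0n ?addr0 // inE mulr1n; split; first lra.
  by apply/esym/gt_eqF; lra.
(* Adding [h] compensates the coefficient -1 on the top copy and makes the functional positive on
   the bottom one. *)
- exists (row_mx (l + h) (- 1)%:M) => -[i b]; rewrite mk in_pair_set /= evDl h1.
  have [le e] := hl i.
  case: b; rewrite ?mulr0n ?addr0 ?inE ?mulr1n ?addrK //; split; first lra.
  by apply/esym/gt_eqF; lra.
Qed.

Lemma face_prism0 : face prism set0.
Proof. by rewrite -pair_set00 face_pair_set eqxx X0. Qed.

Lemma pair_set_iso_l F : lattice_iso X F prism (pair_set F set0) (pair_set^~ set0).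
Proof.
split=> [S fS SF|S T _ _ _ _|Z]; rewrite ?pair_set_sub ?subxx ?andbT //.
  by rewrite face_pair_set eqxx fS orbT.
rewrite -(pair_setP Z) face_pair_set pair_set_sub subset0 => fZ /andP[ZF /eqP Z1].
exists [set i | (i, false) \in Z]; rewrite Z1; split=> //.
by move: fZ; rewrite Z1 eqxx /= => /or3P[] // /andP[/eqP->].
Qed.

Lemma pair_set_iso_r F : lattice_iso X F prism (pair_set set0 F) (pair_set set0).
Proof.
split=> [S fS SF|S T _ _ _ _|Z]; rewrite ?pair_set_sub ?subxx ?andbT //.
  by rewrite face_pair_set eqxx fS !orbT.
rewrite -(pair_setP Z) face_pair_set pair_set_sub subset0 => fZ /andP[/eqP Z1 ZF].
exists [set i | (i, true) \in Z]; rewrite Z1; split=> //.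
by move: fZ; rewrite Z1 eqxx /= => /or3P[] // /andP[/eqP->].
Qed.

Lemma prism_iso_faces F : face X F ->
  [/\ rk prism (pair_set F set0) = rk X F, rk prism (pair_set set0 F) = rk X F,
      forall w, flags prism w (pair_set F set0) = flags X w F &
      forall w, flags prism w (pair_set set0 F) = flags X w F].
Proof.
move=> fF; have p0 := face_prism0.
have fl : face prism (pair_set F set0) by rewrite face_pair_set eqxx fF orbT.
have fr : face prism (pair_set set0 F) by rewrite face_pair_set eqxx fF !orbT.
split=> [||w|w].
- by rewrite (lattice_iso_rk (pair_set_iso_l F)).
- by rewrite (lattice_iso_rk (pair_set_iso_r F)).
- by rewrite (lattice_iso_flags (pair_set_iso_l F)).
- by rewrite (lattice_iso_flags (pair_set_iso_r F)).
Qed.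

Lemma rk_pair_set F : face X F -> F != set0 -> rk prism (pair_set F F) = (rk X F).+1.
Proof.
move=> fF F0; have [<- _ _ _] := prism_iso_faces fF; apply: rk_maximal_face.
- by rewrite face_pair_set eqxx fF orbT.
- by rewrite face_pair_set eqxx fF.
- by rewrite properE !pair_set_sub subxx sub0set subset0.
- move=> Z; rewrite -(pair_setP Z) face_pair_set properE !pair_set_sub sub0set subset0 andbT.
  move=> fZ /andP[FZ nZ] /andP[ZF _].
  have E : [set i | (i, false) \in Z] = F by apply/eqP; rewrite eqEsubset ZF.
  move: fZ nZ; rewrite E subxx (negPf F0) orbF /= => /orP[/andP[/eqP<-]//|/andP[/eqP->]].
  by rewrite eqxx.
Qed.

(** A nonempty face of the base yields three different faces of the prism; for the empty face the
    three coincide. *)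
Lemma big_prism (V : nmodType) (P : pred {set I * bool}) (f : {set I * bool} -> V) :
  \sum_(Z | face prism Z && P Z) f Z =
  \sum_(S | (S != set0) && face X S)
     ((if P (pair_set S S) then f (pair_set S S) else 0) +
      (if P (pair_set S set0) then f (pair_set S set0) else 0) +
      (if P (pair_set set0 S) then f (pair_set set0 S) else 0)) +
  (if P set0 then f set0 else 0).
Proof.
pose g (Z : {set I * bool}) := if P Z then f Z else 0.
rewrite big_mkcondr -/(g) /=.
transitivity (\sum_(p : {set I} * {set I} | face prism (pair_set p.1 p.2))
    g (pair_set p.1 p.2)).
  pose k (Z : {set I * bool}) := ([set i | (i, false) \in Z], [set i | (i, true) \in Z]).
  rewrite (reindex_onto (fun p : {set I} * {set I} => pair_set p.1 p.2) k) /=.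
    apply: eq_bigl => -[A B] /=; rewrite [X in _ && X](_ : _ = true) ?andbT //.
    by apply/eqP; congr (_, _); apply/setP => i; rewrite !inE.
  by move=> Z _; apply: pair_setP.
rewrite -(pair_big_dep xpredT (fun A B => face prism (pair_set A B))
  (fun A B => g (pair_set A B))) /=.
rewrite (bigD1 set0) //= addrC.
have E0 : \sum_(B | face prism (pair_set set0 B)) g (pair_set set0 B) =
    g set0 + \sum_(S | (S != set0) && face X S) g (pair_set set0 S).
  rewrite (bigD1 set0) /= ?pair_set00 ?face_prism0 //; congr (_ + _).
  apply: eq_bigl => B; rewrite face_pair_set eqxx /= X0 andbT andbC.
  by rewrite [set0 == _]eq_sym; case: eqP.
rewrite E0 addrC -addrA addrC; congr (_ + _); rewrite addrC.
have EA A : A != set0 -> \sum_(B | face prism (pair_set A B)) g (pair_set A B) =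
    if face X A then g (pair_set A A) + g (pair_set A set0) else 0.
  move=> A0; case: ifP => fA; last first.
    rewrite big_pred0 // => B; rewrite face_pair_set fA (negPf A0) !andbF //.
  rewrite (bigD1 A) ?face_pair_set ?eqxx ?fA //=; congr (_ + _).
  rewrite (big_pred1 set0) // => B; rewrite face_pair_set fA (negPf A0) !andbT orbF /=.
  rewrite eq_sym; case: eqP => /= [->|]; first by rewrite (negPf A0).
  by rewrite andbT.
by rewrite [RHS]big_split /= (eq_bigr _ EA) -big_mkcondr.
Qed.

(* In the last term the chain jumps from the prism over a face of rank [j - 1] to
   the empty face, which has no top and bottom copies: hence no factor 2. *)
Lemma flags_prism w j F : face X F -> F != set0 -> all (leq 1) (rcons w j) ->
  flags prism (rcons w j) (pair_set F F) =
  2 * (\sum_(v <- lowerings w) flags X (rcons v j) F) +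
  (if j == 1%N then 0 else flags X (rcons w j.-1) F).
Proof.
elim: w F => [|a w IH] F fF F0.
  rewrite [all _ _]/= andbT big_nil mulr0 add0r [rcons _ j]/= [rcons _ _]/= => j0.
  (* A one-letter chain goes directly to the empty face, whose rank is 0. *)
  have E (J : finType) e (Y : J -> 'cV[R]_e) k G : face Y set0 ->
      flags Y [:: k] G = (k == rk Y G)%:R.
    move=> Y0 /=; case kE: (k == _).
      rewrite (bigD1 set0) /= ?Y0 ?sub0set ?rk0 // eqxx big1 ?addr0 //.
      by move=> S /andP[_ /negPf->].
    rewrite big1 // => S /and3P[_ _ e']; case: eqP => // S0.
    by move: e' kE; rewrite S0 rk0 add0n => ->.
  rewrite (E _ _ prism) ?face_prism0 // rk_pair_set // (E _ _ X) //.
  case: (j =P 1%N) => [->|j1]; last by congr (nat_of_bool _)%:R; lia.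
  have := @face_rk_lt _ _ _ _ _ F X0; rewrite proper0 F0 rk0 => /(_ isT).
  by case: (rk X F).
rewrite /= => /andP[a0 wj].
rewrite big_prism [X in _ + X]/= flags_set0; last first.
  by rewrite has_rcons; case: (j) wj => //; rewrite all_rcons.
rewrite if_same addr0 big_cons big_map mulrDr -addrA.
transitivity (\sum_(S | [&& face X S, S \subset F & (rk X S + a)%N == rk X F])
    (2 * (\sum_(v <- lowerings w) flags X (rcons v j) S) +
      (if j == 1%N then 0 else flags X (rcons w j.-1) S)) +
   2 * \sum_(S | [&& face X S, S \subset F & (rk X S + a.-1)%N == rk X F])
     flags X (rcons w j) S);
    last first.
  rewrite addrC; congr (_ + _); rewrite big_split /=; congr (_ + _); last first.
    by case: ifP => // _; rewrite big1.
  by rewrite -mulr_sumr exchange_big.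
have hp : has (leq 1) (rcons w j) by rewrite has_rcons; case: (j) wj => //; rewrite all_rcons.
have z : flags X (rcons w j) set0 = 0 by apply: flags_set0.
(* The empty face contributes nothing on the right, as all words counted there keep a positive last
   letter; the sums then run over nonempty faces, as those from [big_prism] do. *)
rewrite mulr_sumr [X in _ = X + _](bigID (pred1 set0)) [X in _ = _ + X](bigID (pred1 set0)) /=.
rewrite [X in _ = X + _ + _]big1; last first.
  move=> S /andP[_ /eqP->]; rewrite [X in _ * X]big1_seq ?mulr0 ?add0r => [|v _].
    case: eqP => // /eqP j1; apply: flags_set0; rewrite has_rcons.
    by move: wj; rewrite all_rcons => /andP[]; case: (j) j1 => [|[]].
  apply: flags_set0; rewrite has_rcons.
  by move: wj; rewrite all_rcons => /andP[->].
rewrite add0r [X in _ = _ + (X + _)]big1 ?add0r; last first.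
  by move=> S /andP[_ /eqP->]; rewrite z mulr0.
rewrite [X in _ = X + _](eq_bigl (fun S => ((S != set0) && face X S) &&
    ((S \subset F) && ((rk X S + a)%N == rk X F)))); last first.
  by move=> S; case: (face X S); case: (S == set0); rewrite /= ?andbF ?andbT.
rewrite [X in _ = _ + X](eq_bigl (fun S => ((S != set0) && face X S) &&
    ((S \subset F) && ((rk X S + a.-1)%N == rk X F)))); last first.
  by move=> S; case: (face X S); case: (S == set0); rewrite /= ?andbF ?andbT.
rewrite [X in _ = X + _]big_mkcondr [X in _ = _ + X]big_mkcondr -big_split /=.
apply: eq_bigr => S /andP[S0 fS]; have [rl rr fl fr] := prism_iso_faces fS.
rewrite !pair_set_sub andbb !sub0set andbT /= rl rr !rk_pair_set // IH // fl fr.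
case: (S \subset F) => //=; rewrite addSn eqSS.
rewrite (_ : ((rk X S + a)%N == (rk X F).+1) = ((rk X S + a.-1)%N == rk X F)); last by lia.
rewrite -addrA; congr (_ + _); case: ifP => _; rewrite ?addr0 //.
by rewrite mulr2n mulrDl mul1r.
Qed.

End Prism.

(** * The free algebra on the odd generators *)

Section CourseOfValues.
Context (T : Type) (x0 : T) (F : nat -> (nat -> T) -> T).
Hypothesis F_ext : forall k f g, (forall i, (i < k)%N -> f i = g i) -> F k f = F k g.

Fixpoint cv_seq n : seq T :=
  if n is m.+1 then rcons (cv_seq m) (F n (nth x0 (cv_seq m))) else [:: F 0 (fun=> x0)].

Definition cv_rec k : T := nth x0 (cv_seq k) k.

Lemma cv_recE k : cv_rec k = F k cv_rec.
Proof.
have sz n : size (cv_seq n) = n.+1 by elim: n => //= n IH; rewrite size_rcons IH.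
have nthE n i : (i <= n)%N -> nth x0 (cv_seq n) i = cv_rec i.
  elim: n => [|n IH]; first by rewrite leqn0 => /eqP->.
  rewrite leq_eqVlt => /orP[/eqP->//|lt].
  by rewrite /= nth_rcons sz lt IH.
case: k => [|k]; first exact: F_ext.
rewrite {1}/cv_rec /= nth_rcons sz ltnn eqxx; apply: F_ext => i ik.
exact: nthE.
Qed.
End CourseOfValues.


(* The letter [p] stands for the odd generator d_(2p+1). *)
Definition word_monom (w : seq nat) : fmonom nat := FMonom w.
Definition oddalg := malg (fmonom nat) rat.
HB.instance Definition _ := GRing.Lalgebra.on oddalg.
Definition mo (w : seq nat) : oddalg := mkmalgU (word_monom w) 1.

Section LinearExtension.
Context (V : lmodType rat).

Definition ext (f : seq nat -> V) (u : oddalg) : V :=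
  \sum_(k <- msupp u) mcoeff k u *: f (fmonom_val k).

Lemma extEw f (u : oddalg) (D : finset_of (Phant (fmonom nat))) :
  fsubset (msupp u) D ->
  ext f u = \sum_(k <- D) mcoeff k u *: f (fmonom_val k).
Proof.
move=> sub; apply: big_fset_incl => // k _ /mcoeff_outdom ->.
by rewrite scale0r.
Qed.

Lemma ext_is_linear f : linear (ext f).
Proof.
move=> c x y; pose D := fsetU (msupp x) (msupp y).
have sx : fsubset (msupp x) D by apply: fsubsetUl.
have sy : fsubset (msupp y) D by apply: fsubsetUr.
have sxy : fsubset (msupp (c *: x + y)) D.
  apply: (fsubset_trans (msuppD_le _ _)).
  by apply: fsetSU; apply: msuppZ_le.
rewrite (extEw _ sx) (extEw _ sy) (extEw _ sxy) scaler_sumr -big_split.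
by apply: eq_bigr => k _; rewrite mcoeffD mcoeffZ scalerDl scalerA.
Qed.

HB.instance Definition _ f := GRing.isLinear.Build rat oddalg V _ (ext f) (ext_is_linear f).

Lemma ext_mo f w : ext f (mo w) = f w.
Proof.
rewrite /ext msuppU oner_eq0 /= big_seq_fset1.
by rewrite mcoeffUU scale1r.
Qed.
End LinearExtension.

Lemma mo_nil : mo [::] = 1.
Proof.
rewrite /mo; congr (mkmalgU _ _); apply/eqP; rewrite fmP.
by rewrite fm1.
Qed.

Lemma mo_span (u : oddalg) : u = ext mo u.
Proof.
rewrite {1}[u]monalgE; apply: eq_bigr => k _.
apply/malgP => k'; rewrite mcoeffZ !mcoeffU mulr_natr.
by congr (_ *+ (_ == _)); case: k.
Qed.

Lemma scale_mo z w : z *: mo w = mkmalgU (word_monom w) z.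
Proof.
apply/malgP => m; rewrite [LHS]mcoeffZ.
by rewrite [LHS](congr1 (fun t => z * t) (mcoeffU _ _ _)) mcoeffU mulr_natr.
Qed.

Lemma scale_moM a b v w : a *: mo v * (b *: mo w) = (a * b) *: mo (v ++ w).
Proof.
rewrite !scale_mo [LHS]fgmulUU; congr (mkmalgU _ _).
by apply/eqP; rewrite fmP fmM.
Qed.


(* Working with an arbitrary such [A] keeps unification from unfolding [malg]. *)
Definition is_free_alg (A : lalgType rat) (word : seq nat -> A) : Prop :=
  [/\ word [::] = 1,
      forall a b v w, a *: word v * (b *: word w) = (a * b) *: word (v ++ w),
      forall u, exists s : seq (rat * seq nat), u = \sum_(z <- s) z.1 *: word z.2 &
      forall (V : lmodType rat) (f : seq nat -> V),
        exists g : {linear A -> V}, forall w, g (word w) = f w].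

Lemma oddalg_free : is_free_alg mo.
Proof.
split; [exact: mo_nil|exact: scale_moM| |].
  move=> u; exists [seq (mcoeff k u, fmonom_val k) | k <- msupp u].
  by rewrite {1}[u]mo_span /ext big_map.
by move=> V f; exists (ext f); apply: ext_mo.
Qed.

Section FreeAlgebra.
Context (A : lalgType rat) (mo : seq nat -> A) (free : is_free_alg mo).

Lemma word_nil : mo [::] = 1. Proof. by case: free. Qed.

Lemma scale_wordM a b v w : a *: mo v * (b *: mo w) = (a * b) *: mo (v ++ w).
Proof. by case: free. Qed.

Lemma word_cat v w : mo (v ++ w) = mo v * mo w.
Proof. by rewrite -[LHS]scale1r -[1]mul1r -scale_wordM !scale1r. Qed.

Lemma word_span u : exists s : seq (rat * seq nat), u = \sum_(z <- s) z.1 *: mo z.2.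
Proof. by case: free. Qed.

Definition lin_lift (V : lmodType rat) (f : seq nat -> V) : {linear A -> V} :=
  let: And4 _ _ _ h := free in projT1 (cid (h V f)).

Lemma lin_lift_word (V : lmodType rat) (f : seq nat -> V) w : lin_lift f (mo w) = f w.
Proof. by rewrite /lin_lift; case: free => ? ? ? h; case: cid. Qed.

Lemma span_ind (P : A -> Prop) : P 0 ->
  (forall a w u, P u -> P (a *: mo w + u)) -> forall u, P u.
Proof.
move=> P0 PS u; have [s ->] := word_span u; elim: s => [|z s IH].
  by rewrite big_nil.
by rewrite big_cons; apply: PS.
Qed.

Lemma lin_ext (V : lmodType rat) (f g : {linear A -> V}) :
  (forall w, f (mo w) = g (mo w)) -> f =1 g.
Proof.
move=> fg; elim/span_ind => [|a w u IH]; first by rewrite !linear0.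
by rewrite !linearP IH fg.
Qed.

(** An [lalgType] lets scalars pass only through the left factor; for the right one, the product
    rule for scaled words is used. *)
Lemma free_scaleAr (c : rat) (x y : A) : x * (c *: y) = c *: (x * y).
Proof.
elim/span_ind: x => [|a v x IH]; first by rewrite !mul0r scaler0.
rewrite !mulrDl scalerDr IH; congr (_ + _).
elim/span_ind: y {IH} => [|b w y IH]; first by rewrite !(mulr0, scaler0).
by rewrite scalerDr !mulrDr scalerDr IH scalerA !scale_wordM scalerA mulrCA.
Qed.

Lemma free_mul2_inj (x : A) : x *+ 2 = 0 -> x = 0.
Proof.
move=> h; rewrite -[x]scale1r (_ : 1 = 2^-1 * 2%:R :> rat) //.
by rewrite -scalerA scaler_nat h scaler0.
Qed.

Definition wt (w : seq nat) : nat := sumn [seq p.*2.+1 | p <- w].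

(** A filtration is enough: it bounds the sums over last letters and carries the induction in
    [vanishing]. *)
Definition deg_le n (u : A) : Prop := exists s : seq (rat * seq nat),
  u = \sum_(z <- s) z.1 *: mo z.2 /\ all (fun z => wt z.2 <= n)%N s.

Lemma deg_leD n u v : deg_le n u -> deg_le n v -> deg_le n (u + v).
Proof.
move=> [s [-> hs]] [t [-> ht]]; exists (s ++ t).
by rewrite big_cat all_cat hs.
Qed.

Lemma deg_leZ n c u : deg_le n u -> deg_le n (c *: u).
Proof.
move=> [s [-> hs]]; exists [seq (c * z.1, z.2) | z <- s].
rewrite big_map all_map scaler_sumr; split=> //.
by apply: eq_bigr => z _; rewrite scalerA.
Qed.

Lemma deg_le_mo n w : (wt w <= n)%N -> deg_le n (mo w).
Proof. by move=> wn; exists [:: (1, w)]; rewrite big_seq1 scale1r /= wn. Qed.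

Lemma deg_le0 n : deg_le n 0.
Proof. by exists [::]; rewrite big_nil. Qed.

Lemma deg_le_sum n (I : Type) (r : seq I) (P : pred I) F :
  (forall i, P i -> deg_le n (F i)) -> deg_le n (\sum_(i <- r | P i) F i).
Proof.
move=> h; elim/big_ind: _ => //; first exact: deg_le0.
by move=> x y; apply: deg_leD.
Qed.

Lemma deg_leM m n u v : deg_le m u -> deg_le n v -> deg_le (m + n) (u * v).
Proof.
move=> [s [-> /allP hs]] [t [-> /allP ht]]; rewrite mulr_suml big_seq.
apply: deg_le_sum => z zs; rewrite mulr_sumr big_seq; apply: deg_le_sum => z' z't.
rewrite free_scaleAr -scalerAl -word_cat; do 2!apply: deg_leZ.
by apply: deg_le_mo; rewrite /wt map_cat sumn_cat leq_add ?hs ?ht.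
Qed.

Lemma deg_le_lin m n (f : {linear A -> A}) u :
  (forall w, (wt w <= n)%N -> deg_le m (f (mo w))) -> deg_le n u -> deg_le m (f u).
Proof.
move=> hf [s [-> /allP hs]]; rewrite linear_sum big_seq; apply: deg_le_sum => z zs.
by rewrite linearZ /=; apply/deg_leZ/hf/hs.
Qed.

Lemma deg_le_exists u : exists n, deg_le n u.
Proof.
have [s E] := word_span u; exists (\max_(z <- s | true) wt z.2)%N; exists s; split=> //.
by apply/allP => z zs; apply: (@leq_bigmax_seq _ s xpredT (fun z => wt z.2)).
Qed.

(* The generators d_k: the odd ones are free, the even ones are given by
   sum_i (-1)^i d_i d_(2p-i) = 0. *)
Definition gen_step k (f : nat -> A) : A :=
  if k == 0%N then 1 else if odd k then mo [:: k./2]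
  else 2^-1 *: \sum_(1 <= i < k) (-1) ^+ i.+1 * (f i * f (k - i)%N).

Definition gen : nat -> A := cv_rec 0 gen_step.

Lemma genE k : gen k = gen_step k gen.
Proof.
apply: cv_recE => {k} k f g fg; rewrite /gen_step; do 2!case: ifP => // _.
by congr (_ *: _); apply: eq_big_nat => i /andP[i0 ik]; rewrite !fg //; lia.
Qed.

Lemma gen0 : gen 0 = 1. Proof. by rewrite genE. Qed.

Lemma gen_odd p : gen p.*2.+1 = mo [:: p].
Proof. by rewrite genE /gen_step /= odd_double /= uphalf_double. Qed.

Lemma gen_even k : (0 < k)%N -> ~~ odd k ->
  gen k *+ 2 = \sum_(1 <= i < k) (-1) ^+ i.+1 * (gen i * gen (k - i)%N).
Proof.
case: k => // k _ ek; rewrite genE /gen_step (negPf ek) -scaler_nat scalerA.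
by rewrite (_ : _ * _ = 1 :> rat) ?scale1r.
Qed.

Definition gens (w : seq nat) : A := \prod_(j <- w) gen j.

Definition odds (w : seq nat) : seq nat := [seq p.*2.+1 | p <- w].

Lemma gens_cat v w : gens (v ++ w) = gens v * gens w.
Proof. by rewrite /gens big_cat. Qed.

Lemma gens_cons j w : gens (j :: w) = gen j * gens w.
Proof. by rewrite /gens big_cons. Qed.

Lemma gens1 j : gens [:: j] = gen j.
Proof. by rewrite /gens big_seq1. Qed.

Lemma gens_odds w : gens (odds w) = mo w.
Proof.
elim: w => [|p w IH] /=; first by rewrite /gens big_nil word_nil.
by rewrite gens_cons IH gen_odd -word_cat.
Qed.

Lemma signM n (x : A) : (-1) ^+ n * x = ((-1) ^+ n : rat) *: x.
Proof.
rewrite -signr_odd -[in RHS]signr_odd.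
by case: (odd n); rewrite ?mulN1r ?scaleN1r ?mul1r ?scale1r.
Qed.

Lemma big_ends (V : zmodType) (f : nat -> V) j : (0 < j)%N ->
  \sum_(i < j.+1) f i = f 0%N + \sum_(1 <= i < j) f i + f j.
Proof.
by move=> j0; rewrite -(big_mkord xpredT) big_nat_recr //= big_ltn.
Qed.

Lemma lowerings_cat v w :
  lowerings (v ++ w) = [seq x ++ w | x <- lowerings v] ++ [seq v ++ x | x <- lowerings w].
Proof.
elim: v => [|j v IH] /=; first by rewrite map_id.
by rewrite IH map_cat -!map_comp.
Qed.

(** Reading [c] as a linear function on words in the d_k, the first condition says d_0 = 1, the
    second that [c] vanishes on the two-sided ideal generated by the coefficients of Phi(-t) Phi(t)
    in positive degree. *)
Definition eulerian (c : seq nat -> rat) : Prop :=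
  (forall a b, c (a ++ 0 :: b) = c (a ++ b)) /\
  (forall a b k, (0 < k)%N ->
    \sum_(i < k.+1) (-1) ^+ i * c (a ++ nat_of_ord i :: (k - i)%N :: b) = 0).

Definition pairing (c : seq nat -> rat) : {linear A -> rat^o} :=
  lin_lift (fun w => c (odds w) : rat^o).

(** Splitting a letter j into two positive letters lowers the cost 2j - 1 by one; deleting a letter
    0 lowers the total by one as well. *)
Let cost j := if j is j'.+1 then j'.*2.+1 else 1%N.

(** Both sides agree on words in odd letters by definition. A letter 0 can be deleted on both sides,
    and a positive even letter j is replaced by means of the relation of degree j: on the left
    through [gen_even], on the right through [eulerian c]. *)
Lemma pairing_gens c w : eulerian c -> pairing c (gens w) = c w.
Proof.
move=> [c0 ce]; have [n] := ubnP (sumn (map cost w)); elim: n w => // n IH w /ltnSE wn.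
have [hw|nw] := boolP (all odd w).
  have E : odds (map half w) = w.
    rewrite /odds -map_comp -[RHS]map_id; apply/eq_in_map => j jw /=.
    by have := allP hw j jw; rewrite -{3}[j]odd_double_half => ->.
  by rewrite -{1}E gens_odds /pairing lin_lift_word E.
have [j /= jw ej] := allPn nw; have [a [b Ew]] : exists a b, w = a ++ j :: b.
  by case/splitPr: jw => a b; exists a, b.
move: wn; rewrite Ew map_cat sumn_cat /= => wn.
have [j0|j0] := posnP j.
  rewrite j0 c0 gens_cat gens_cons gen0 mul1r -gens_cat IH // map_cat sumn_cat.
  by move: wn; rewrite j0 /=; lia.
suff : pairing c (gens (a ++ j :: b)) *+ 2 = c (a ++ j :: b) *+ 2.
  by move=> h; apply: (@mulIf rat 2%:R) => //; rewrite !mulr_natr.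
rewrite -linearMn /=; have -> : gens (a ++ j :: b) *+ 2 =
    \sum_(1 <= i < j) (-1) ^+ i.+1 * gens (a ++ i :: (j - i)%N :: b).
  rewrite gens_cat gens_cons -mulrnAr -mulrnAl gen_even // mulr_suml mulr_sumr.
  apply: eq_bigr => i _; rewrite gens_cat !gens_cons -!mulrA mulrA.
  by rewrite (commr_sign (gens a) i.+1) !mulrA.
rewrite linear_sum /= (eq_big_nat _ _ (F2 := fun i =>
    (-1) ^+ i.+1 * c (a ++ i :: (j - i)%N :: b))) => [|i /andP[i0 ij]]; last first.
  have costE l : (0 < l)%N -> cost l = (l.*2).-1 by case: l.
  rewrite signM linearZ /= IH //; move: wn; rewrite !map_cat !sumn_cat /=.
  by rewrite !costE ?subn_gt0 //; lia.
(* The extreme terms i = 0 and i = j are both [c (a ++ j :: b)], with sign plus because j is even;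
   this is the factor 2. *)
have := ce a b j j0.
rewrite (big_ends (fun i => (-1) ^+ i * c (a ++ i :: (j - i)%N :: b))) //.
rewrite subn0 subnn expr0 mul1r c0.
have -> : a ++ j :: 0%N :: b = (a ++ [:: j]) ++ 0%N :: b by rewrite -catA.
rewrite c0 -catA /= -signr_odd (negPf ej) expr0 mul1r.
rewrite (eq_bigr (fun i => - ((-1) ^+ i.+1 * c (a ++ i :: (j - i)%N :: b)))); last first.
  by move=> i _; rewrite exprS mulN1r mulNr opprK.
by rewrite sumrN addrAC => /eqP; rewrite subr_eq0 mulr2n => /eqP.
Qed.

(** Only the words in odd generators enter; that d_k |-> d_(k-1) holds for even k too is
    [der_gen]. *)
Definition der : {linear A -> A} :=
  lin_lift (fun w => \sum_(v <- lowerings (odds w)) gens v).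

Lemma derM x y : der (x * y) = der x * y + x * der y.
Proof.
elim/span_ind: x => [|a v x IH]; first by rewrite !mul0r linear0 mul0r add0r.
rewrite !(mulrDl, linearD) /= IH -!scalerAl !linearZ /= -!scalerAl addrACA.
congr (_ + _); rewrite -scalerDr; congr (_ *: _).
elim/span_ind: y {IH} => [|b w y IH]; first by rewrite !(mulr0, linear0) addr0.
rewrite !(mulrDr, linearD) /= IH free_scaleAr !linearZ /= !free_scaleAr [RHS]addrACA.
congr (_ + _); rewrite -scalerDr; congr (_ *: _).
rewrite -word_cat !lin_lift_word /odds map_cat lowerings_cat big_cat !big_map -!gens_odds.
by rewrite mulr_suml mulr_sumr; congr (_ + _); apply: eq_bigr => u _; rewrite gens_cat.
Qed.

(** For odd k this is the definition. For even k, differentiating the relation for 2 d_k leaves a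
    telescoping sum of the terms (-1)^i d_i d_(k-1-i), whose two ends add up to 2 d_(k-1) because k
    - 1 is odd. *)
Lemma der_gen k : (0 < k)%N -> der (gen k) = gen k.-1.
Proof.
have [n] := ubnP k; elim: n k => // n IH k /ltnSE kn k0.
have [ok|ek] := boolP (odd k).
  rewrite -[k]odd_double_half ok add1n gen_odd lin_lift_word /= big_seq1 gens1 //.
apply/eqP; rewrite -subr_eq0; apply/eqP/free_mul2_inj.
rewrite mulrnBl -linearMn /= gen_even // linear_sum /=.
pose T i := (-1) ^+ i *: (gen i * gen (k.-1 - i)%N).
rewrite (eq_big_nat _ _ (F2 := fun i => T i.-1 - T i)) => [|i /andP[i0 ik]]; last first.
  rewrite signM linearZ /= derM !IH ?subn_gt0 //; try lia.
  rewrite /T; case: i i0 ik => // i _ ik; rewrite scalerDr /= !exprS !mulN1r opprK scaleNr opprK.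
  by congr (_ *: (_ * gen _) + _ *: (_ * gen _)); lia.
rewrite big_add1 (eq_bigr (fun i => (- T i.+1) - (- T i))) => [|i _]; last first.
  by rewrite opprK addrC.
rewrite (telescope_sumr (fun i => - T i)) // opprK /T expr0 scale1r gen0 mul1r subn0 subnn.
rewrite gen0 mulr1 -signr_odd (_ : odd k.-1); last by case: (k) k0 ek => //= ? _ /negPn.
by rewrite expr1 scaleN1r opprK -mulr2n subrr.
Qed.

(* u = cterm u + sum_p (rcoef p u) d_(2p+1), see [rcoef_decomp]. *)
Definition rcoef p : {linear A -> A} :=
  lin_lift (fun w => if rev w is q :: v then if q == p then mo (rev v) else 0 else 0).

Definition cterm : {linear A -> rat^o} := lin_lift (fun w => (w == [::])%:R : rat^o).

(* The flag functional of a prism at [u] is that of its base at 2 der u - vert u: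
   each letter can be lowered in two ways (bottom and top), but the last one in
   one way only, or in none if it is 1. *)
Definition vert : {linear A -> A} :=
  lin_lift (fun w => if rev w is q :: v then
    (if q == 0%N then 2 else 1) *: (mo (rev v) * gen q.*2) else 0).

Lemma word_gen v q : mo v * gen q.*2.+1 = mo (rcons v q).
Proof. by rewrite gen_odd -word_cat cats1. Qed.

Lemma rcoefM p x q : rcoef p (x * gen q.*2.+1) = if q == p then x else 0.
Proof.
elim/span_ind: x => [|a v x IH]; first by rewrite mul0r linear0 if_same.
rewrite mulrDl linearD /= IH -scalerAl linearZ /= word_gen lin_lift_word rev_rcons revK.
by case: ifP => _; rewrite ?scaler0 ?addr0.
Qed.

Lemma vertM x q :
  vert (x * gen q.*2.+1) = (if q == 0%N then 2 else 1) *: (x * gen q.*2).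
Proof.
elim/span_ind: x => [|a v x IH]; first by rewrite !mul0r linear0 scaler0.
rewrite !mulrDl linearD /= IH scalerDr -!scalerAl linearZ /= word_gen lin_lift_word.
by rewrite rev_rcons revK !scalerA mulrC.
Qed.

Lemma wt_rcons v q : wt (rcons v q) = (wt v + q.*2.+1)%N.
Proof. by rewrite /wt map_rcons -cats1 sumn_cat /= addn0. Qed.

Lemma rcoef_decomp n u : deg_le n u ->
  u = cterm u *: 1 + \sum_(p < n) rcoef p u * gen p.*2.+1.
Proof.
move=> [s [-> /allP hs]]; pose T x := cterm x *: 1 + \sum_(p < n) rcoef p x * gen p.*2.+1.
have TP a x y : T (a *: x + y) = a *: T x + T y.
  rewrite /T linearP /= scalerDl -scalerA scalerDr addrACA; congr (_ + _).
  rewrite scaler_sumr -big_split; apply: eq_bigr => p _ /=.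
  by rewrite linearP /= mulrDl scalerAl.
suff Tw w : (wt w <= n)%N -> T (mo w) = mo w.
  rewrite -/(T _); elim: s hs => [|z s IH] hs.
    rewrite big_nil /T linear0 scale0r add0r big1 // => p _; by rewrite linear0 mul0r.
  rewrite big_cons TP Tw; last by apply: hs; rewrite mem_head.
  by rewrite -IH // => z' zs; apply: hs; rewrite in_cons zs orbT.
rewrite /T lin_lift_word; case/lastP: w => [|v q] wn.
  rewrite eqxx scale1r word_nil big1 ?addr0 // => p _.
  by rewrite -word_nil lin_lift_word mul0r.
rewrite wt_rcons in wn; have qn : (q < n)%N by lia.
rewrite -size_eq0 size_rcons scale0r add0r (bigD1 (Ordinal qn)) //= big1 => [|p pq].
  by rewrite lin_lift_word rev_rcons eqxx revK addr0 word_gen.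
by rewrite lin_lift_word rev_rcons eq_sym -val_eqE /= in pq *; rewrite (negPf pq) mul0r.
Qed.

(** The isolated summand [rcoef 0 u] is the second half of the double weight that [vert] gives to a
    last letter 1, where [gen 0] is 1. *)
Lemma vert_decomp n u : deg_le n.+1 u -> cterm u = 0 ->
  vert u = rcoef 0 u + \sum_(p < n.+1) rcoef p u * gen p.*2.
Proof.
move=> un u0; rewrite {1}(rcoef_decomp un) u0 scale0r add0r linear_sum /=.
under eq_bigr do rewrite vertM.
rewrite big_ord_recl [in RHS]big_ord_recl /= gen0 mulr1 addrA -mulr2n scaler_nat.
by congr (_ + _); apply: eq_bigr => p _; rewrite scale1r.
Qed.

Lemma der_decomp n u : deg_le n u -> cterm u = 0 ->
  der u = \sum_(p < n) der (rcoef p u) * gen p.*2.+1 +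
          \sum_(p < n) rcoef p u * gen p.*2.
Proof.
move=> un u0; rewrite {1}(rcoef_decomp un) u0 scale0r add0r linear_sum /=.
by rewrite -big_split; apply: eq_bigr => p _; rewrite derM der_gen.
Qed.

Lemma deg_leW m n u : (m <= n)%N -> deg_le m u -> deg_le n u.
Proof.
move=> mn [s [-> hs]]; exists s; split=> //; apply: sub_all hs => z.
by move=> /leq_trans; apply.
Qed.

Lemma deg_le_gen k : deg_le k (gen k).
Proof.
have [n] := ubnP k; elim: n k => // n IH k /ltnSE kn.
rewrite genE /gen_step; case: eqP => [->|/eqP k0].
  by rewrite -word_nil; apply: deg_le_mo.
case: ifP => ok.
  by apply: deg_le_mo; rewrite /wt /= addn0 -[X in (_ <= X)%N]odd_double_half ok.
apply: deg_leZ; rewrite big_nat_cond; apply: deg_le_sum => i /andP[/andP[i0 ik] _].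
rewrite signM; apply: deg_leZ; rewrite -{1}(subnKC (ltnW ik)).
by apply: deg_leM; apply: IH; lia.
Qed.

Lemma deg_le_gens w : deg_le (sumn w) (gens w).
Proof.
elim: w => [|j w IH]; first by rewrite /gens big_nil -word_nil; apply: deg_le_mo.
by rewrite gens_cons; apply: deg_leM => //; apply: deg_le_gen.
Qed.

Lemma sumn_lowerings w v : all (leq 1) w -> v \in lowerings w -> sumn w = (sumn v).+1.
Proof.
elim: w v => //= j w IH v /andP[j0 w0]; rewrite in_cons => /orP[/eqP->|].
  by rewrite /= -addSn prednK.
by move=> /mapP[x xw ->] /=; rewrite (IH x) // addnS.
Qed.

Lemma all_odds w : all (leq 1) (odds w).
Proof. by rewrite all_map; apply/allP. Qed.

Lemma deg_le_der n u : deg_le n.+1 u -> deg_le n (der u).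
Proof.
apply: deg_le_lin => w wn; rewrite lin_lift_word big_seq; apply: deg_le_sum => v vw.
have := sumn_lowerings (all_odds w) vw; rewrite -/(wt w) => e.
by apply: deg_leW (deg_le_gens v); lia.
Qed.

Lemma deg_le_vert n u : deg_le n.+1 u -> deg_le n (vert u).
Proof.
apply: deg_le_lin => w; rewrite lin_lift_word; case/lastP: w => [|v q] wn.
  exact: deg_le0.
rewrite rev_rcons revK; apply/deg_leZ; rewrite wt_rcons in wn.
apply: (@deg_leW (wt v + q.*2)); first by lia.
by apply: deg_leM; [exact: deg_le_mo|exact: deg_le_gen].
Qed.

(* With E = sum d_(2p) s^p and O = sum d_(2p+1) s^p, the relations say
   E^2 = 1 + s O^2; the series W with W (E + 1) = O then satisfies s W O = E - 1. *)
Definition wgen : nat -> A := cv_rec 0 (fun k f =>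
  2^-1 *: (gen k.*2.+1 - \sum_(i < k) f (k - i.+1)%N * gen i.+1.*2)).

Lemma gen_odd_wgen k :
  gen k.*2.+1 = wgen k + \sum_(i < k.+1) wgen (k - i) * gen i.*2.
Proof.
rewrite big_ord_recl subn0 gen0 mulr1 addrA -mulr2n -scaler_nat.
rewrite {1}/wgen cv_recE => [|{}k f g fg].
  by rewrite scalerA (_ : _ * _ = 1 :> rat) // scale1r subrK.
congr (_ *: (_ - _)); apply: eq_bigr => i _; rewrite fg //.
by have := ltn_ord i; lia.
Qed.

Lemma big_parity (V : zmodType) (f : nat -> V) k : \sum_(i < k.*2.+1) f i =
  \sum_(i < k.+1) f i.*2 + \sum_(i < k) f i.*2.+1.
Proof.
elim: k => [|k IH]; first by rewrite !big_ord_recr !big_ord0 addr0.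
rewrite doubleS 2!big_ord_recr /= IH.
rewrite [X in _ = X + _]big_ord_recr [X in _ = _ + X]big_ord_recr /= -!addrA.
by congr (_ + _); rewrite addrA addrC.
Qed.

(** The coefficient of s^k in E^2 = 1 + s O^2: the relation of degree 2k with even and odd indices
    separated. *)
Lemma gen_square k : (0 < k)%N -> \sum_(i < k.+1) gen i.*2 * gen (k - i).*2 =
  \sum_(i < k) gen i.*2.+1 * gen (k - i.+1).*2.+1.
Proof.
move=> k0; apply/eqP; rewrite -subr_eq0; apply/eqP.
have k20 : (0 < k.*2)%N by rewrite double_gt0.
have : \sum_(i < k.*2.+1) (-1) ^+ i * (gen i * gen (k.*2 - i)%N) = 0.
  rewrite (big_ends (fun i => (-1) ^+ i * (gen i * gen (k.*2 - i)%N))) //.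
  rewrite subn0 subnn gen0 !mulr1 !mul1r -signr_odd odd_double mul1r addrAC -mulr2n.
  rewrite gen_even ?odd_double // -big_split big1 // => i _ /=.
  by rewrite exprS mulN1r mulNr addNr.
rewrite (big_parity (fun i => (-1) ^+ i * (gen i * gen (k.*2 - i)%N))) => E.
rewrite -[RHS]E -sumrN; congr (_ + _); apply: eq_bigr => i _.
  by rewrite -signr_odd odd_double mul1r doubleB.
rewrite -signr_odd /= odd_double expr1 mulN1r; congr (- (_ * gen _)).
by have := ltn_ord i; lia.
Qed.

(** * Identities of power series over the free algebra, modulo the N-th power of the variable *)

Section TruncatedSeries.
Context (N : nat).
Implicit Types P Q : {poly A}.

Definition eqt P Q : Prop := forall k, (k < N)%N -> P`_k = Q`_k.

Lemma eqtM P P' Q Q' : eqt P P' -> eqt Q Q' -> eqt (P * Q) (P' * Q').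
Proof.
move=> hP hQ k kN; rewrite !coefM; apply: eq_bigr => j _.
by rewrite hP ?hQ //; have := ltn_ord j; lia.
Qed.

Lemma eqtB P P' Q Q' : eqt P P' -> eqt Q Q' -> eqt (P - Q) (P' - Q').
Proof. by move=> hP hQ k kN; rewrite !coefB hP ?hQ. Qed.

Lemma eqt_trans P Q S : eqt P Q -> eqt Q S -> eqt P S.
Proof. by move=> h1 h2 k kN; rewrite h1 ?h2. Qed.

Lemma eqt_refl P : eqt P P. Proof. by []. Qed.

Let Ep := \poly_(i < N) gen i.*2.
Let Op := \poly_(i < N) gen i.*2.+1.
Let Wp := \poly_(i < N) wgen i.

Let EpE k : (k < N)%N -> Ep`_k = gen k.*2. Proof. by move=> kN; rewrite coef_poly kN. Qed.
Let OpE k : (k < N)%N -> Op`_k = gen k.*2.+1. Proof. by move=> kN; rewrite coef_poly kN. Qed.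
Let WpE k : (k < N)%N -> Wp`_k = wgen k. Proof. by move=> kN; rewrite coef_poly kN. Qed.

Lemma eqt_square : eqt (Ep * Ep) (1 + 'X * (Op * Op)).
Proof.
move=> k kN; rewrite coefM coefD coef1 coefXM.
under eq_bigr => j _.
  rewrite !EpE; [|by have := ltn_ord j; lia|by have := ltn_ord j; lia].
  over.
case: k kN => [|k] kN; first by rewrite big_ord1 gen0 mulr1 addr0.
rewrite gen_square // add0r /= coefM; apply: eq_bigr => j _.
by rewrite !OpE //; have := ltn_ord j; lia.
Qed.

(** The commutator X = O E - E O satisfies X E + E X = [O, E^2] = [O, s O^2] = 0. As E has constant
    term 1, a coefficient of X is killed by 2 once the lower ones are zero. *)
Lemma eqt_comm : eqt (Op * Ep) (Ep * Op).
Proof.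
pose X := Op * Ep - Ep * Op.
have : eqt (X * Ep + Ep * X) 0.
  have -> : X * Ep + Ep * X = Op * (Ep * Ep) - (Ep * Ep) * Op.
    by rewrite /X mulrBl mulrBr !mulrA addrA subrK.
  apply: eqt_trans (eqtB (eqtM (eqt_refl Op) eqt_square) (eqtM eqt_square (eqt_refl Op))) _.
  rewrite mulrDr mulr1 mulrDl mul1r opprD addrACA subrr add0r.
  by rewrite mulrA (commr_polyX Op) -!mulrA subrr.
move=> h k kN; apply/eqP; rewrite -subr_eq0 -coefB -/X; apply/eqP; move: k kN.
elim/ltn_ind => k IH kN; have := h k kN; rewrite coefD !coefM coef0.
rewrite big_ord_recr big_ord_recl /= !subnn !subn0 big1 => [|j _].
  rewrite [X in _ + (_ + X)]big1 => [|j _].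
    rewrite add0r addr0 EpE ?gen0; last by lia.
    by rewrite mulr1 mul1r -mulr2n => /free_mul2_inj.
  by rewrite IH ?mulr0 // /bump /=; have := ltn_ord j; lia.
by rewrite IH ?mul0r //; have := ltn_ord j; lia.
Qed.

Lemma eqt_wgen : eqt (Wp * (Ep + 1)) Op.
Proof.
move=> k kN; rewrite mulrDr mulr1 coefD coefM OpE // gen_odd_wgen addrC WpE //.
congr (_ + _); rewrite [RHS](reindex_inj rev_ord_inj) /=; apply: eq_bigr => j _.
by have jk := ltn_ord j; rewrite subSS subKn // WpE ?EpE //; lia.
Qed.

(** Times E + 1, the difference of the two sides is E^2 - 1 - s W (E + 1) O = 0, where [eqt_comm]
    has moved O to the right; E + 1 has constant term 2 and can be cancelled. *)
Lemma eqt_wgen_odd : eqt Ep (1 + 'X * (Wp * Op)).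
Proof.
pose Y := Ep - 1 - 'X * (Wp * Op).
have : eqt (Y * (Ep + 1)) 0.
  have -> : Y * (Ep + 1) = Ep * Ep - 1 - 'X * (Wp * (Op * Ep + Op)).
    rewrite /Y mulrBl; congr (_ - _); last by rewrite -!mulrA mulrDr mulr1.
    by rewrite mulrBl mul1r mulrDr mulr1 opprD addrA addrK.
  have h1 : eqt (Wp * (Op * Ep + Op)) (Op * Op).
    apply: (@eqt_trans _ (Wp * ((Ep + 1) * Op))).
      apply: eqtM => // k kN; rewrite mulrDl mul1r !coefD; congr (_ + _).
      exact: eqt_comm.
    by rewrite mulrA; apply: eqtM => //; apply: eqt_wgen.
  apply: eqt_trans (eqtB (eqtB eqt_square (eqt_refl 1)) (eqtM (eqt_refl 'X) h1)) _.
  by rewrite addrAC addrK subrr.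
move=> h k kN; apply/eqP; rewrite -subr_eq0 -coefB opprD addrA -/Y; apply/eqP.
move: k kN; elim/ltn_ind => k IH kN; have := h k kN; rewrite coefM coef0.
rewrite big_ord_recr /= subnn [(Ep + 1)`_0]coefD coef1 EpE ?gen0; last by lia.
rewrite big1 => [|j _]; last by rewrite IH ?mul0r //; have := ltn_ord j; lia.
by rewrite add0r mulrDr mulr1 -mulr2n => /free_mul2_inj.
Qed.

(** This makes last letters comparable: [rcoefM] now applies to products ending in an even
    generator. *)
Lemma gen_even_wgen p : (p.+1 < N)%N ->
  gen p.+1.*2 = \sum_(i < p.+1) wgen (p - i) * gen i.*2.+1.
Proof.
move=> pN; rewrite -EpE // eqt_wgen_odd // coefD coef1 coefXM add0r /= coefM.
rewrite (reindex_inj rev_ord_inj) /=; apply: eq_bigr => j _.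
by have jk := ltn_ord j; rewrite subSS subKn // WpE ?OpE //; lia.
Qed.
End TruncatedSeries.

(** * The equations of cone and prism force an element to vanish *)

Section Vanishing.
Context (K : A -> Prop).
Hypothesis K_cst : forall u, K u -> cterm u = 0.
Hypothesis K_der : forall u, K u -> K (der u).
Hypothesis K_vert : forall u, K u -> der u = 0 -> K (vert u).

(** [K] abstracts annihilation by all flag numbers. Both [der] and [vert] lower the degree; the
    induction first gives der u = 0, which [K_vert] requires, and then vert u = 0. *)
Lemma vanishing u : K u -> u = 0.
Proof.
have [n] := deg_le_exists u; elim: n u => [|n IH] u un Ku.
  by rewrite (rcoef_decomp un) K_cst // scale0r add0r big_ord0.
have u0 := K_cst Ku.
have Du : der u = 0 by apply: IH; [exact: deg_le_der|exact: K_der].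
have Vu : vert u = 0 by apply: IH; [exact: deg_le_vert|exact: K_vert].
pose U p := rcoef p u; pose V p := U p.+1.
(* The difference of der u = 0 and vert u = 0, which share the sum over even generators. *)
have e1 : U 0%N = \sum_(p < n.+1) der (U p) * gen p.*2.+1.
  have hD := der_decomp un u0; have hV := vert_decomp un u0; rewrite Du in hD; rewrite Vu in hV.
  by apply: (addIr (\sum_(p < n.+1) rcoef p u * gen p.*2)); rewrite -hD -hV.
have e2 : U 0%N *+ 2 + \sum_(q < n) V q * gen q.+1.*2 = 0.
  by rewrite -[RHS]Vu (vert_decomp un u0) big_ord_recl /= gen0 mulr1 addrA mulr2n.
have genW q : gen q.+1.*2 = \sum_(i < q.+1) wgen (q - i) * gen i.*2.+1.
  exact: (@gen_even_wgen q.+2).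
(* Here [U 0] is expanded by [e1] and the even generators by [genW], so that every term ends in an
   odd generator. *)
have e3 i : (i < n.+1)%N -> der (U i) *+ 2 + \sum_(q < n | (i <= q)%N) V q * wgen (q - i) = 0.
  move=> iN; have := congr1 (rcoef i) e2; rewrite {1}e1 linear0 => Z; rewrite -[RHS]Z.
  rewrite linearD linearMn !linear_sum /=; congr (_ *+ 2 + _).
    rewrite (bigD1 (Ordinal iN)) //= rcoefM eqxx big1 ?addr0 // => p pi.
    by rewrite rcoefM -val_eqE /= in pi *; rewrite (negPf pi).
  rewrite big_mkcond; apply: eq_bigr => q _; rewrite genW mulr_sumr linear_sum /=.
  under eq_bigr do rewrite mulrA rcoefM.
  case: leqP => iq; last first.
    by rewrite big1 // => j _; case: eqP => // ji; have := ltn_ord j; lia.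
  rewrite (bigD1 (Ordinal (iq : (i < q.+1)%N))) //= eqxx big1 ?addr0 // => j.
  by rewrite -val_eqE /= => /negPf->.
(* The coefficient of d_(2i+1) in [e2], and [der] of [e2], combine to 2 S = S. *)
pose S := \sum_(q < n) V q * gen q.*2.+1.
have e4 : der (U 0%N) *+ 2 + \sum_(q < n) der (V q) * gen q.+1.*2 + S = 0.
  have := congr1 der e2; rewrite linear0 => Z; rewrite -[RHS]Z.
  rewrite linearD linearMn linear_sum /= -addrA; congr (_ + _).
  rewrite -big_split; apply: eq_bigr => q _ /=.
  by rewrite derM [der (gen _)]der_gen // doubleS.
have S0 : S = 0.
  have E0 := e3 0%N isT; have EV (q : 'I_n) := e3 q.+1 (ltn_ord q).
  have : (der (U 0%N) *+ 2 + \sum_(q < n) der (V q) * gen q.+1.*2 + S) *+ 2 = 0.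
    by rewrite e4 mul0rn.
  have W0 : der (U 0%N) *+ 2 = - \sum_(q < n) V q * wgen q.
    apply/eqP; rewrite -addr_eq0; apply/eqP; rewrite -[RHS]E0; congr (_ + _).
    by apply: eq_bigr => q _; rewrite subn0.
  have WV (q : 'I_n) : der (V q) *+ 2 = - \sum_(r < n | (q < r)%N) V r * wgen (r - q.+1).
    by apply/eqP; rewrite -addr_eq0; apply/eqP; apply: EV.
  have W1 : (\sum_(q < n) der (V q) * gen q.+1.*2) *+ 2 =
      - \sum_(r < n) \sum_(q < r) V r * (wgen (r - q.+1) * gen q.+1.*2).
    rewrite -sumrMnl (eq_bigr (fun q : 'I_n => - \sum_(r < n | (q < r)%N)
        V r * (wgen (r - q.+1) * gen q.+1.*2))); last first.
      move=> q _; rewrite -mulrnAl WV mulNr mulr_suml; congr (- _).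
      by apply: eq_bigr => r _; rewrite mulrA.
    rewrite sumrN; congr (- _); rewrite (exchange_big_dep xpredT) //=.
    apply: eq_bigr => r _.
    by rewrite -(big_ord_widen n (fun q => V r * (wgen (r - q.+1) * gen q.+1.*2))) // ltnW.
  (* In [gen_odd_wgen] the term [wgen r] occurs alone and again with [gen 0]; this doubling matches
     twice [W0]. *)
  have W2 : S = (\sum_(q < n) V q * wgen q) *+ 2 +
      \sum_(r < n) \sum_(q < r) V r * (wgen (r - q.+1) * gen q.+1.*2).
    rewrite /S -sumrMnl -big_split; apply: eq_bigr => r _ /=.
    rewrite gen_odd_wgen big_ord_recl subn0 gen0 mulr1 addrA -mulr2n mulrDr -mulrnAr.
    by rewrite mulr_sumr.
  by rewrite !mulrnDl W1 W0 -!opprD -mulr2n -W2 mulr2n addKr.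
have V0 q : (q < n)%N -> V q = 0.
  move=> qn; have := congr1 (rcoef q) S0; rewrite linear0 => Z.
  rewrite -[RHS]Z linear_sum /=.
  rewrite (bigD1 (Ordinal qn)) //= rcoefM eqxx big1 ?addr0 // => p.
  by rewrite rcoefM -val_eqE /= => /negPf->.
have U0 : U 0%N = 0.
  apply: free_mul2_inj; rewrite -[RHS]e2 big1 ?addr0 // => q _.
  by rewrite V0 ?mul0r.
rewrite (rcoef_decomp un) u0 scale0r add0r big1 // => -[[|p] pn] _ /=.
  by rewrite [rcoef _ _]U0 mul0r.
by rewrite [rcoef _ _](V0 p) ?mul0r.
Qed.
End Vanishing.

End FreeAlgebra.

(** * Flag numbers separate the elements of the free algebra *)

Section Completeness.
Context (R : realFieldType) (A : lalgType rat) (mo : seq nat -> A) (free : is_free_alg mo).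
Local Notation pairing := (pairing free).

Definition flag_fun (I : finType) d (X : I -> 'cV[R]_d) (w : seq nat) : rat :=
  (flags X w [set: I])%:~R.

Lemma flags_skip0 (I : finType) d (X : I -> 'cV[R]_d) a b F : face X F ->
  flags X (a ++ 0 :: b) F = flags X (a ++ b) F.
Proof.
elim: a F => [|j a IH] F fF; first exact: flags0.
by apply: eq_bigr => S /and3P[fS _ _]; apply: IH.
Qed.

Lemma flag_fun_eulerian (I : finType) d (X : I -> 'cV[R]_d) : eulerian (flag_fun X).
Proof.
split=> [a b|a b k k0]; first by rewrite /flag_fun flags_skip0 // faceT.
have := flags_euler a b (faceT X) k0 => /(congr1 (fun z : int => z%:~R : rat)).
rewrite rmorph0 rmorph_sum => E; rewrite -[RHS]E; apply: eq_bigr => i _.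
by rewrite rmorphM rmorphXn rmorphN1.
Qed.

Lemma pairing_cone (I : finType) d (X : I -> 'cV[R]_d) u : face X set0 ->
  pairing (flag_fun (cone X)) u = pairing (flag_fun X) (der free u).
Proof.
move=> X0; move: u; pose f := pairing (flag_fun X); pose g := der free.
apply: (lin_ext free (g := (f \o g : {linear A -> rat^o}))) => w /=.
rewrite /f /g !lin_lift_word linear_sum /=.
rewrite (eq_bigr (fun v => flag_fun X v)); last first.
  by move=> v _; rewrite pairing_gens //; apply: flag_fun_eulerian.
rewrite /flag_fun (_ : [set: option I] = apex [set: I]); last first.
  by apply/setP => -[i|]; rewrite in_apex !inE.
by rewrite flags_apex ?faceT // ?rmorph_sum //; apply: all_odds.
Qed.

(** This is [flags_prism] solved for [vert]. The empty configuration is set apart because its prism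
    is again empty and has no separate bottom and top. *)
Lemma pairing_prism (I : finType) d (X : I -> 'cV[R]_d) (h : 'rV[R]_d) u :
    (forall i, ev h (X i) = 1) ->
  pairing (flag_fun X) (vert free u) = 2 * pairing (flag_fun X) (der free u) -
    (if #|I| == 0%N then 0 else pairing (flag_fun (prism X)) u).
Proof.
move=> h1; have X0 : face X set0.
  by apply/asboolP; exists h => i; rewrite h1 ler01 oner_eq0 inE.
have fT := faceT X.
pose f := pairing (flag_fun X); rewrite -/f.
suff E w : f (vert free (mo w)) = 2 * f (der free (mo w)) -
    (if #|I| == 0%N then 0 else pairing (flag_fun (prism X)) (mo w)).
  elim/(span_ind free): u => [|a w u IH].
    by rewrite !linear0 mulr0 if_same subrr.
  rewrite !linearP /= IH E; case: ifP => _; rewrite ?linearP /= /GRing.scale /=; ring.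
rewrite lin_lift_word [der _ _]lin_lift_word; case/lastP: w => [|w q].
  rewrite /= big_nil !linear0 mulr0 sub0r; case: ifP => // I0.
  rewrite lin_lift_word /flag_fun /= (_ : (_ == _) = false) ?rmorph0 ?oppr0 //.
  by apply/negbTE; rewrite -cards_eq0 cardsT card_prod muln_eq0 I0 card_bool.
have gE v : f (gens mo v) = flag_fun X v.
  by rewrite /f pairing_gens //; apply: flag_fun_eulerian.
rewrite rev_rcons revK linearZ /= -(gens_odds free w) -(gens1 mo) -gens_cat gE.
rewrite {2}/odds map_rcons -cats1 lowerings_cat big_cat /= big_map big_seq1 linearD linear_sum /= gE.
rewrite (eq_bigr (fun v => flag_fun X (rcons v q.*2.+1))); last first.
  by move=> v _; rewrite cats1 gE.
set s := \sum_(v <- _) _; set t := flag_fun X _.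
have [I0|I0] := eqVneq #|I| 0%N.
  have T0 : [set: I] = set0 by apply/eqP; rewrite -cards_eq0 cardsT I0.
  have -> : s = 0.
    rewrite /s big1 // => v _; rewrite /flag_fun T0 flags_set0 ?rmorph0 //.
    by rewrite has_rcons.
  case: eqP => [_|/eqP q0]; first by rewrite add0r subr0.
  have -> : t = 0; last by rewrite /GRing.scale /=; ring.
  by rewrite /t /flag_fun T0 flags_set0 ?rmorph0 // has_cat /= double_gt0 lt0n q0 orbT.
have T0 : [set: I] != set0 by rewrite -cards_eq0 cardsT.
rewrite lin_lift_word /flag_fun (_ : [set: I * bool] = pair_set [set: I] [set: I]); last first.
  by apply/setP => -[i []]; rewrite !inE.
rewrite /odds map_rcons (flags_prism h1) //; last first.
  by rewrite all_rcons; apply: (all_odds w).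
rewrite rmorphD rmorphM rmorph_sum /= -/s eqSS double_eq0 -cats1 -/t.
case: eqP => [_|_]; rewrite /GRing.scale /= ?rmorph0; first by rewrite addr0; ring.
by rewrite -/(flag_fun X _) -/t; ring.
Qed.

Theorem flag_funs_separate (u : A) :
    (forall (I : finType) d (X : I -> 'cV[R]_d) (h : 'rV[R]_d),
      (forall i, ev h (X i) = 1) -> pairing (flag_fun X) u = 0) ->
  u = 0.
Proof.
pose K u := forall (I : finType) d (X : I -> 'cV[R]_d) (h : 'rV[R]_d),
      (forall i, ev h (X i) = 1) -> pairing (flag_fun X) u = 0.
suff: forall u, K u -> u = 0 by apply.
apply: (@vanishing _ _ free K) => {}u Ku.
(* The empty configuration has the empty face only, so its flag functional reads off the constant
   term. *)
- pose X (i : 'I_0) : 'cV[R]_0 := 0.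
  have E : cterm free =1 pairing (flag_fun X).
    apply: (lin_ext free) => w; rewrite !lin_lift_word /flag_fun.
    have -> : [set: 'I_0] = set0 by apply/setP => -[].
    case: w => [|p w]; first by rewrite /= eqxx.
    by rewrite flags_set0 // /odds /=.
  by rewrite E; apply: (Ku _ _ _ 0) => -[].
- move=> I d X h h1; rewrite -pairing_cone.
    apply: (Ku _ _ _ (row_mx h 1%:M)) => -[i|] /=; rewrite ev_row_mx ?ev0r ?addr0 ?h1 //.
    by rewrite add0r /ev mul1mx mxE.
  by apply/asboolP; exists h => i; rewrite h1 ler01 oner_eq0 inE.
- move=> Du I d X h h1; rewrite (pairing_prism _ h1) Du linear0 mulr0 sub0r.
  case: ifP => _; first by rewrite oppr0.
  rewrite (Ku _ _ _ (row_mx h 0)) ?oppr0 // => -[i b].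
  by rewrite /prism ev_row_mx h1 ev0l addr0.
Qed.
End Completeness.

Require Import Defs.
From mathcomp Require Import classical_sets functions cardinality fsbigop reals.
From mathcomp Require Import freeg mpoly.
Local Open Scope classical_set_scope.

(** * Face lattices of polytopes *)

Section PolytopeConfigurations.
Context (R : realType) (N : nat) (I : finType) (v : I -> 'rV[R]_N).
Implicit Types (S F G T : {set I}) (c : 'cV[R]_N) (b : R).

Definition hpoint (i : I) : 'cV[R]_(N + 1) := col_mx (v i)^T 1%:M.

(** The sign is chosen so that a valid inequality c . x <= b becomes a functional that is
    nonnegative on the lifted points and zero on the face. *)
Definition affine_form c b : 'rV[R]_(N + 1) := row_mx (- c^T) b%:M.

Definition cset S : set 'rV[R]_N := conv [seq v i | i <- enum S].

Lemma ev_affine_form c b i : ev (affine_form c b) (hpoint i) = b - (v i *m c) 0 0.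
Proof.
rewrite ev_row_mx /ev mulNmx -trmx_mul ![in LHS]mxE /= addrC; congr (_ - _).
  by rewrite big_ord1 !mxE eqxx mulr1.
by rewrite mxE.
Qed.

Lemma affine_formP (l : 'rV[R]_(N + 1)) : exists c b, l = affine_form c b.
Proof.
exists (- (lsubmx l)^T), (rsubmx l 0 0); rewrite /affine_form linearN /= opprK trmxK.
by rewrite -mx11_scalar hsubmxK.
Qed.

Lemma hpoint_height i : ev (row_mx 0 1%:M) (hpoint i) = 1.
Proof. by rewrite ev_row_mx ev0l add0r /ev mul1mx mxE. Qed.

Lemma face_hpoint0 : face hpoint finset.set0.
Proof.
by apply/asboolP; exists (row_mx 0 1%:M) => i; rewrite hpoint_height ler01 oner_eq0 inE.
Qed.

Lemma face_hpointP S : face hpoint S <-> exists c b,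
  forall i, (v i *m c) 0 0 <= b /\ (i \in S) = ((v i *m c) 0 0 == b).
Proof.
split=> [/asboolP[l hl]|[c [b h]]].
  have [c [b E]] := affine_formP l; exists c, b => i; have := hl i.
  by rewrite E ev_affine_form subr_ge0 subr_eq0 eq_sym.
apply/asboolP; exists (affine_form c b) => i.
by rewrite ev_affine_form subr_ge0 subr_eq0 eq_sym.
Qed.

Lemma conv_mem (s : seq 'rV[R]_N) x : x \in s -> conv s x.
Proof.
move=> xs; pose n := (count_mem x s)%:R : R.
have n0 : n != 0 by rewrite pnatr_eq0 -lt0n -has_count has_pred1.
have E (V : lmodType R) (f : 'rV[R]_N -> V) :
    \sum_(w <- s) ((w == x)%:R / n) *: f w = f x.
  transitivity (\sum_(w <- s) if w == x then n^-1 *: f x else 0).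
    apply: eq_bigr => w _; case: eqP => [->|_]; first by rewrite mul1r.
    by rewrite mul0r scale0r.
  rewrite -big_mkcond big_const_seq iter_addr_0.
  by rewrite -scaler_nat scalerA divff ?scale1r.
exists (fun w => (w == x)%:R / n); split.
- by move=> w _; rewrite divr_ge0 ?ler0n.
- by rewrite -[RHS](E R^o (fun=> 1)); apply: eq_bigr => w _; rewrite [RHS]mulr1.
- exact: (E _ id).
Qed.

Lemma cset_vertex S i : i \in S -> cset S (v i).
Proof. by move=> iS; apply: conv_mem; apply: map_f; rewrite mem_enum. Qed.

Lemma cset_affine S c b (x : 'rV[R]_N) :
  (forall i, i \in S -> (v i *m c) 0 0 <= b) -> cset S x -> (x *m c) 0 0 <= b.
Proof.
move=> h [a [a0 a1 <-]]; rewrite mulmx_suml summxE -[b]mul1r -a1 mulr_suml.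
rewrite big_seq [X in _ <= X]big_seq; apply: ler_sum => w /[dup] wS /mapP[i].
rewrite mem_enum => iS E; rewrite -scalemxAl mxE ler_wpM2l ?a0 // E; exact: h.
Qed.

Lemma cset_cut S c b :
  (forall i, i \in S -> (v i *m c) 0 0 <= b) ->
  cset S `&` [set x | (x *m c) 0 0 = b] =
  cset [set i in S | (v i *m c) 0 0 == b]%SET.
Proof.
move=> h; pose H := [set x : 'rV[R]_N | (x *m c) 0 0 = b].
rewrite (conv_face (F := cset S `&` H) (c := c) (b := b) (s := [seq v i | i <- enum S])) //.
  rewrite /cset filter_map /enum_mem -filter_predI; congr (conv (map _ _)).
  apply: eq_filter => i.
  change (((v i *m c) 0 0 == b) && (i \in S) = (i \in [set i in S | (v i *m c) 0 0 == b]%SET)).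
  by rewrite inE andbC.
by move=> x; apply: cset_affine.
Qed.

(** An inequality valid on [cset F] may fail at points outside [F]; [face_lift] replaces it by one
    that holds for the whole configuration. *)
Lemma is_face_csetP F (G : set 'rV[R]_N) : face hpoint F -> is_face (cset F) G <->
  exists S, [/\ face hpoint S, S \subset F & G = cset S].
Proof.
move=> fF; split=> [[c [b [cb ->]]]|[S [/face_hpointP[c [b h]] SF ->]]].
  have hb i : i \in F -> (v i *m c) 0 0 <= b by move=> iF; apply/cb/cset_vertex.
  exists [set i in F | (v i *m c) 0 0 == b]%SET; rewrite cset_cut //.
  have sF : [set i in F | (v i *m c) 0 0 == b]%SET \subset F.
    by apply/fintype.subsetP => i; rewrite inE => /andP[].
  split=> //; apply: (face_lift (l := affine_form c b) fF sF) => i iF.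
  by rewrite ev_affine_form inE iF subr_ge0 subr_eq0 [RHS]eq_sym hb.
exists c, b; split.
  by move=> x; apply: cset_affine => i iF; case: (h i).
rewrite cset_cut => [|i _]; last by case: (h i).
congr cset; apply/setP => i; rewrite inE -(h i).2.
by case: (boolP (i \in S)) => [/(fintype.subsetP SF)->|]; rewrite ?andbF.
Qed.

Lemma cset_support S i : face hpoint S -> cset S (v i) -> i \in S.
Proof.
move=> /face_hpointP[c [b h]] vi.
have hE : cset S = cset S `&` [set x | (x *m c) 0 0 = b].
  rewrite cset_cut => [|j _]; last by case: (h j).
  by congr cset; apply/setP => j; rewrite inE -(h j).2 andbb.
by move: vi; rewrite hE => -[_ /= e]; rewrite (h i).2 e.
Qed.

Lemma cset_subP S T : face hpoint S -> face hpoint T ->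
  (cset S `<=` cset T) <-> S \subset T.
Proof.
move=> fS fT; split=> [sub|ST].
  by apply/fintype.subsetP => i iS; apply: cset_support => //; apply/sub/cset_vertex.
have [c [b [_ ->]]] : is_face (cset T) (cset S) by apply/is_face_csetP => //; exists S.
by move=> x [].
Qed.

Lemma cset_inj S T : face hpoint S -> face hpoint T -> cset S = cset T -> S = T.
Proof.
by move=> fS fT E; apply/eqP; rewrite finset.eqEsubset; apply/andP; split;
  apply/cset_subP => //; rewrite E.
Qed.

Lemma cset0 : cset finset.set0 = set0.
Proof.
apply/seteqP; split=> // x [a [_ + _]]; rewrite enum_set0 big_nil => /esym/eqP.
by rewrite oner_eq0.
Qed.

Lemma is_polytope_cset S : S != finset.set0 -> is_polytope (cset S).
Proof.
move=> /set0Pn[i iS]; exists [seq v i | i <- enum S] => //.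
by rewrite -mem_enum in iS; case: (enum S) iS.
Qed.

Lemma cset_neq0 S : S != finset.set0 -> cset S !=set0.
Proof. by move=> /set0Pn[i iS]; exists (v i); apply: cset_vertex. Qed.

(** The rows of [Y], a point at height 1 and k difference vectors at height 0, are linearly
    independent, and every functional vanishing on [S] vanishes on them. *)
Lemma has_aff_indep_rk S k : has_aff_indep (cset S) k -> (k.+1 <= rk hpoint S)%N.
Proof.
move=> [x [M [Sx SM fM]]].
pose Y : 'M_(1 + k, N + 1) := block_mx x 1%:M M 0.
have fY : row_free Y.
  apply: inj_row_free => u; rewrite -[u]hsubmxK mul_row_block mulmx1 mulmx0 addr0.
  rewrite -[0]row_mx0 => /eq_row_mx[h1 h2]; move: h1; rewrite h2 mul0mx add0r.
  move=> h; have := row_free_inj fM; move=> /(_ _ (rsubmx u) 0).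
  by rewrite h mul0mx => -> //; rewrite row_mx0.
have zero z (l : 'rV_(N + 1)) : cset S z -> (l <= annih hpoint S)%MS ->
    l *m (row_mx z 1%:M)^T = 0.
  move=> [a [a0 a1 <-]] /annihP hl.
  have [c [b E]] := affine_formP l.
  have E' i : i \in S -> (v i *m c) 0 0 = b.
    by move=> iS; apply/eqP; rewrite eq_sym -subr_eq0 -ev_affine_form -E hl.
  rewrite E tr_row_mx; set w := \sum_(_ <- _) _.
  have -> : (1%:M : 'M[R]_1)^T = 1%:M by rewrite trmx1.
  rewrite mul_row_col mulmx1 mulNmx -trmx_mul.
  apply/matrixP => i j; rewrite !ord1 !mxE eqxx /=; apply/eqP; rewrite addrC subr_eq0; apply/eqP.
  transitivity ((w *m c) 0 0); last by rewrite mxE.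
  rewrite /w mulmx_suml summxE -[LHS]mul1r -a1 mulr_suml.
  rewrite big_seq [RHS]big_seq; apply: eq_bigr => u /mapP[m].
  by rewrite mem_enum => mS ->; rewrite -scalemxAl mxE E'.
have KY : (annih hpoint S <= kermx Y^T)%MS.
  apply/row_subP => i; apply/sub_kermxP; set l := row i _.
  have lS : (l <= annih hpoint S)%MS by apply: row_sub.
  have l1 : l *m (row_mx x 1%:M)^T = 0 by apply: zero.
  have lM j : l *m (row_mx (row j M) 0)^T = 0.
    have := zero _ _ (SM j) lS; rewrite -[X in row_mx _ X]addr0 -add_row_mx.
    by rewrite linearD /= mulmxDr l1 add0r.
  apply: trmx_inj; rewrite trmx_mul trmxK trmx0; apply/row_matrixP => j; rewrite row_mul row0.
  apply: trmx_inj; rewrite trmx_mul trmxK trmx0.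
  rewrite /Y /block_mx; case: (split_ordP j) => j' ->.
    by rewrite rowKu row_id.
  by rewrite rowKd row_row_mx row0.
have := mxrankS KY; rewrite mxrank_ker mxrank_tr (eqP fY).
by have := rk_annih hpoint S; have := rank_leq_col Y; rewrite (eqP fY); lia.
Qed.

(** One inequality is [has_aff_indep_rk]. For the other, along a maximal chain of faces the rank
    grows by exactly one in each step, and [adim] by at least one. *)
Lemma adim_cset F : face hpoint F -> F != finset.set0 ->
  (adim (cset F)).+1 = rk hpoint F.
Proof.
move=> fF F0; apply/eqP; rewrite eqn_leq has_aff_indep_rk /=; last first.
  exact/has_aff_indep_adim/cset_neq0.
have [n] := ubnP #|F|; elim: n F fF F0 => // n IH F fF F0 /ltnSE Fn.
have [M [fM MF -> _]] := maximal_face_exists face_hpoint0 fF F0.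
rewrite ltnS; have [->|M0] := eqVneq M finset.set0; first by rewrite rk0.
apply: leq_trans (IH M fM M0 _) _; first exact: leq_trans (proper_card MF) _.
apply: adim_face_lt (cset_neq0 M0) _.
  by apply/is_face_csetP => //; exists M; rewrite proper_sub.
by move=> /(cset_inj fM fF) E; rewrite E fintype.properxx in MF.
Qed.

End PolytopeConfigurations.

Section Classes.
Context (R : realType).

Definition point_polytope : polytope R :=
  Polytope (PolytopeIn (ex_intro2 _ _ [:: (0 : 'rV[R]_0)] isT erefl)).

(* The class of the point is a junk value outside polytopes. *)
Definition set_class N (A : set 'rV[R]_N) : comb_polytope R :=
  if pselect (is_polytope A) is left h then comb_class (Polytope (PolytopeIn h))
  else comb_class point_polytope.

Lemma set_class_pset N (F : polytope_in R N) : set_class F = comb_class (Polytope F).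
Proof.
rewrite /set_class; case: pselect => [h|/(_ (psetP F))//].
by congr (comb_class (Polytope _)); apply: polytope_in_inj.
Qed.

Lemma comb_classP (P Q : polytope R) : comb_class P = comb_class Q <-> comb_equiv P Q.
Proof.
split=> [E|E]; first by apply/asboolP/(eqmodP (comb_equiv_rel R)).
by apply/(eqmodP (comb_equiv_rel R))/asboolP.
Qed.

(** The inverse of [cset v] on faces, see [supp_cset]. *)
Definition supp N (I : finType) (v : I -> 'rV[R]_N) (A : set 'rV[R]_N) : {set I} :=
  [set i | `[< A (v i) >]]%SET.

Lemma supp_cset N (I : finType) (v : I -> 'rV[R]_N) S :
  face (hpoint v) S -> supp v (cset v S) = S.
Proof.
move=> fS; apply/setP => i; rewrite inE; apply/asboolP/idP; last exact: cset_vertex.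
exact: cset_support.
Qed.

Section TwoConfigurations.
Context (N M : nat) (I J : finType) (v : I -> 'rV[R]_N) (w : J -> 'rV[R]_M).
Context (F : {set I}) (G : {set J}).
Hypotheses (fF : face (hpoint v) F) (fG : face (hpoint w) G).
Hypotheses (F0 : F != finset.set0) (G0 : G != finset.set0).

Lemma lattice_iso_class phi : lattice_iso (hpoint v) F (hpoint w) G phi ->
  set_class (cset v F) = set_class (cset w G).
Proof.
move=> iso; case: (iso) => ph mon sur.
rewrite /set_class; case: pselect => [hF|]; last by case; apply: is_polytope_cset.
case: pselect => [hG|]; last by case; apply: is_polytope_cset.
apply/comb_classP; exists (fun A => cset w (phi (supp v A))) => /=; split; first split.
- move=> A /= /(is_face_csetP _ fF)[S [fS SF ->]].
  apply/(is_face_csetP _ fG); exists (phi S).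
  by rewrite supp_cset //; case: (ph S fS SF).
- move=> A B; rewrite !inE /= => /(is_face_csetP _ fF)[S [fS SF ->]].
  move=> /(is_face_csetP _ fF)[T [fT TF ->]]; rewrite !supp_cset //.
  have [fS' _] := ph S fS SF; have [fT' _] := ph T fT TF.
  by move/(cset_inj fS' fT')/(lattice_iso_inj iso fS SF fT TF)->.
- move=> B /= /(is_face_csetP _ fG)[T [fT TG ->]].
  have [S [fS SF E]] := sur T fT TG; exists (cset v S); last by rewrite supp_cset ?E.
  by apply/(is_face_csetP _ fF); exists S.
- move=> A B /(is_face_csetP _ fF)[S [fS SF ->]] /(is_face_csetP _ fF)[T [fT TF ->]].
  rewrite !supp_cset //; have [fS' _] := ph S fS SF; have [fT' _] := ph T fT TF.
  split=> [/(cset_subP fS fT) ST|/(cset_subP fS' fT')]; last first.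
    by rewrite mon // => ST; apply/cset_subP.
  by apply/cset_subP => //; rewrite mon.
Qed.

Lemma class_lattice_iso : set_class (cset v F) = set_class (cset w G) ->
  exists phi, lattice_iso (hpoint v) F (hpoint w) G phi.
Proof.
rewrite /set_class; case: pselect => [hF|]; last by case; apply: is_polytope_cset.
case: pselect => [hG|]; last by case; apply: is_polytope_cset.
move=> /comb_classP[f [[/= ff fi fs] fm]]; exists (fun S => supp w (f (cset v S))).
have isF S : face (hpoint v) S -> S \subset F -> is_face (cset v F) (cset v S).
  by move=> fS SF; apply/(is_face_csetP _ fF); exists S.
have isG S : face (hpoint v) S -> S \subset F ->
    exists T, [/\ face (hpoint w) T, T \subset G & f (cset v S) = cset w T].
  by move=> fS SF; apply/(is_face_csetP _ fG)/ff/isF.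
split.
- by move=> S fS SF; have [T [fT TG ->]] := isG S fS SF; rewrite supp_cset.
- move=> S T fS SF fT TF; have [S' [fS' S'G ES]] := isG S fS SF.
  have [T' [fT' T'G ET]] := isG T fT TF; rewrite ES ET !supp_cset //.
  apply/idP/idP => [/(cset_subP fS' fT')|/(cset_subP fS fT)] sub; last first.
    by apply/(cset_subP fS' fT'); rewrite -ES -ET -fm //; apply: isF.
  by apply/(cset_subP fS fT); rewrite fm -?ES -?ET //; try exact: isF; rewrite ES ET.
- move=> T fT TG; have [|A hA E] := fs (cset w T).
    by apply/(is_face_csetP _ fG); exists T.
  have [S [fS SF AS]] := (is_face_csetP _ fF).1 hA.
  by exists S; rewrite -AS E supp_cset.
Qed.

End TwoConfigurations.

Lemma polytope_config (P : polytope R) : exists (n : nat) (v : 'I_n -> 'rV[R]_(ambient P)),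
  n != 0%N /\ (P : set _) = cset v [set: 'I_n]%SET.
Proof.
have [s s0 E] := psetP P; exists (size s), (tnth (in_tuple s)).
by rewrite size_eq0 s0 E /cset enum_setT -enumT map_tnth_enum.
Qed.

Lemma face_sum_config (V : zmodType) (theta : comb_polytope R -> V) k N
    (P : polytope_in R N) (I : finType) (v : I -> 'rV[R]_N) (F : {set I}) :
    face (hpoint v) F -> (P : set _) = cset v F ->
  \sum_(G \in [set G : polytope_in R N | is_face P G /\ (adim G + k)%N = adim P])
    theta (comb_class (Polytope G)) =
  \sum_(S : {set I} | [&& face (hpoint v) S, S \subset F &
      (S != finset.set0) && ((rk (hpoint v) S + k)%N == rk (hpoint v) F)])
    theta (set_class (cset v S)).
Proof.
move=> fF PE.
have F0 : F != finset.set0.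
  apply/eqP => E; have := polytope_neq0 P; rewrite PE E cset0 => -[x []].
pose g (S : {set I}) : polytope_in R N :=
  if pselect (is_polytope (cset v S)) is left h then PolytopeIn h else P.
have gE S : S != finset.set0 -> g S = cset v S :> set _.
  by move=> S0; rewrite /g; case: pselect => // -[]; apply: is_polytope_cset.
pose C (S : {set I}) := [&& face (hpoint v) S, S \subset F &
  (S != finset.set0) && ((rk (hpoint v) S + k)%N == rk (hpoint v) F)].
rewrite (@reindex_fsbig _ _ _ _ _ g [set` C]).
  rewrite -(@bigfs _ _ _ _ (index_enum _)) ?index_enum_uniq //; last first.
    by move=> S _; rewrite mem_index_enum.
  apply: eq_bigr => S /and3P[_ _ /andP[S0 _]].
  by rewrite -set_class_pset gE.
split.
- move=> S /= /and3P[fS SF /andP[S0 /eqP rS]]; rewrite gE //.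
  rewrite PE; split; first by apply/(is_face_csetP _ fF); exists S.
  by apply: succn_inj; rewrite -addSn !adim_cset.
- move=> S T; rewrite !inE => /and3P[fS SF /andP[S0 _]] /and3P[fT TF /andP[T0 _]] E.
  by apply: (cset_inj fS fT); rewrite -!gE // E.
- move=> G /= [Gf aG]; rewrite PE in Gf aG.
  have [S [fS SF E]] := (is_face_csetP _ fF).1 Gf.
  have S0 : S != finset.set0.
    apply/eqP => S0; have := polytope_neq0 G; rewrite E S0 cset0 => -[x []].
  exists S; last by apply: polytope_in_inj; rewrite gE.
  by rewrite /= unfold_in /C fS SF S0 /= -!adim_cset // -E addSn aG.
Qed.

Definition gen_class (c : comb_polytope R) : polyZ R := << (1 : int) *g c >>.

(** The operator computes on a chosen representative; an isomorphism of face lattices carries the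
    sum over to any configuration of the same class. Products of operators can then be followed
    inside one configuration. *)
Lemma dend_class k N (I : finType) (v : I -> 'rV[R]_N) (F : {set I}) :
    face (hpoint v) F -> F != finset.set0 ->
  dend R k (gen_class (set_class (cset v F))) =
  \sum_(S : {set I} | [&& face (hpoint v) S, S \subset F &
      (S != finset.set0) && ((rk (hpoint v) S + k)%N == rk (hpoint v) F)])
    gen_class (set_class (cset v S)).
Proof.
move=> fF F0; rewrite dend_gen; set Q := repr _.
have [n [w [n0 QE]]] := polytope_config Q.
have fT : face (hpoint w) [set: 'I_n]%SET by apply: faceT.
have T0 : [set: 'I_n]%SET != finset.set0.
  by rewrite -cards_eq0 cardsT card_ord.
have [|phi iso] := @class_lattice_iso _ _ _ _ v w F [set: 'I_n]%SET fF fT F0 T0.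
  rewrite -QE set_class_pset (_ : Polytope Q = Q); last by case: (Q).
  by rewrite /comb_class reprK.
rewrite /face_sum [LHS](face_sum_config gen_class k fT QE); apply/esym.
have isoS := lattice_iso_set0 iso (face_hpoint0 _) (face_hpoint0 _).
have rkE := lattice_iso_rk_face iso (face_hpoint0 _) (face_hpoint0 _).
have sz S : face (hpoint v) S -> S \subset F -> (phi S == finset.set0) = (S == finset.set0).
  move=> fS SF; apply/eqP/eqP => [E|->]; last exact: isoS.
  by apply: (lattice_iso_inj iso) => //; [exact: face_hpoint0|exact: finset.sub0set|rewrite isoS].
apply: (lattice_iso_sum iso) => S fS SF.
  by rewrite sz // !rkE // (lattice_iso_top iso fF fT).
move=> /andP[S0 _]; congr gen_class; case: (iso) => ph _ _.
have [fS' _] := ph S fS SF.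
by apply: (lattice_iso_class fS fS' S0 _ (lattice_iso_restr iso fS SF)); rewrite sz.
Qed.

End Classes.

(** * Relations between the operators d_k *)

Section Operators.
Context (R : realType).

Lemma class_config (c : comb_polytope R) : exists N (n : nat) (v : 'I_n -> 'rV[R]_N),
  [set: 'I_n]%SET != finset.set0 /\ c = set_class (cset v [set: 'I_n]%SET).
Proof.
have [n [v [n0 E]]] := polytope_config (repr c); exists (ambient (repr c)), n, v.
split; first by rewrite -cards_eq0 cardsT card_ord.
rewrite -E set_class_pset (_ : Polytope (repr c) = repr c); last by case: (repr c).
by rewrite /comb_class reprK.
Qed.

Lemma polyZ_ext (V : zmodType) (f g : {additive polyZ R -> V}) :
  (forall c, f (gen_class c) = g (gen_class c)) -> f =1 g.
Proof.
move=> fg x; rewrite -[x]freeg_sumE !raddf_sum; apply: eq_bigr => c _.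
have -> : << coeff c x *g c >> = gen_class c *~ coeff c x.
  by rewrite /gen_class freeg_mulz intz.
by rewrite !raddfMz fg.
Qed.

Lemma endo_sumE (V : zmodType) (J : Type) (r : seq J) (f : J -> endo V) x :
  (\sum_(i <- r) f i : endo V) x = \sum_(i <- r) f i x.
Proof. by elim: r => [|i r IH]; rewrite ?big_nil ?big_cons //= -IH. Qed.

Lemma endo_mulzE (V : zmodType) (f : endo V) z x : (f *~ z : endo V) x = f x *~ z.
Proof.
have nE n : (f *+ n : endo V) x = f x *+ n.
  by elim: n => [|n IH]; rewrite ?mulr0n ?mulrS //= -IH.
by case: z => n; rewrite ?NegzE ?mulrNz -?pmulrn -nE.
Qed.

Lemma dop_euler k : (0 < k)%N ->
  \sum_(i < k.+1) (dop R (k - i) * dop R i) *~ (-1) ^+ i = 0.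
Proof.
move=> k0; apply: val_inj; rewrite raddf_sum; apply: endoP.
pose D : endo (polyZ R) := \sum_(i < k.+1) (dend R (k - i) * dend R i) *~ (-1) ^+ i.
have -> : \sum_(i < k.+1) val ((dop R (k - i) * dop R i) *~ (-1) ^+ i) = D.
  by apply: eq_bigr => i _; rewrite raddfMz.
rewrite [\val 0]raddf0; apply: (@polyZ_ext _ D (0 : endo (polyZ R))) => c; rewrite /D.
rewrite endo_sumE; have [N [n [v [n0 ->]]]] := class_config c.
(* The operators omit the empty face, while Euler's relation includes it; it gets weight 0. *)
pose g (T : {set 'I_n}) := if T == finset.set0 then 0 else gen_class (set_class (cset v T)).
have fT := faceT (hpoint v).
rewrite -[RHS](codim_euler g fT k0); apply: eq_bigr => i _.
rewrite endo_mulzE endo_mulE dend_class // raddf_sum mulrz_suml.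
have g0 S : g S = if S != finset.set0 then gen_class (set_class (cset v S)) else 0.
  by rewrite /g; case: eqP.
rewrite [RHS](bigID (fun S : {set 'I_n} => S != finset.set0)) /=.
rewrite [X in _ = _ + X]big1 => [|S /andP[_ /negPn/eqP->]]; last first.
  apply: big1 => T; rewrite finset.subset0 => /and3P[_ /eqP-> _].
  by rewrite g0 eqxx mul0rz.
rewrite addr0; apply: eq_big => [S|S /and3P[fS _ /andP[S0 _]]].
  by rewrite -!andbA [_ && (S != _)]andbC.
rewrite -[dfun _ _]/(dend R (k - i) _) dend_class // mulrz_suml.
rewrite [RHS](bigID (fun T : {set 'I_n} => T != finset.set0)) /=.
rewrite [X in _ = _ + X]big1 => [|T /andP[_ /negPn/eqP->]]; last by rewrite g0 eqxx mul0rz.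
rewrite addr0; apply: eq_big => [T|T /and3P[_ _ /andP[T0 _]]].
  by rewrite -!andbA [_ && (T != _)]andbC.
by rewrite g0 T0.
Qed.

(** An additive functional counting points, which turns iterated face sums into flag numbers. *)
Definition points : polyZ R -> int :=
  @fglift int int^o (comb_polytope R) (fun c => (adim (repr c) == 0%N)%:R).

Lemma points_is_zmod_morphism : zmod_morphism points.
Proof. exact: (@lift_is_additive int (comb_polytope R) int^o). Qed.
HB.instance Definition _ :=
  GRing.isZmodMorphism.Build (polyZ R) int points points_is_zmod_morphism.

(* Here the first letter acts first, in products of operators the last one does. *)
Definition dact (w : seq nat) (x : polyZ R) : polyZ R :=
  foldl (fun y j => dend R j y) x w.

Lemma dact_sum (J : Type) (r : seq J) (P : pred J) (f : J -> polyZ R) w :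
  dact w (\sum_(i <- r | P i) f i) = \sum_(i <- r | P i) dact w (f i).
Proof.
elim: w f => //= j w IH f; rewrite -IH /=; congr (foldl _ _ _).
exact: (raddf_sum (dend R j)).
Qed.

(** A face is a point exactly when its rank is 1, that is, when a further letter 1 leads to the
    empty face. Chains that reach the empty face earlier cannot use that letter and count zero. *)
Lemma points_dact w N (I : finType) (v : I -> 'rV[R]_N) (F : {set I}) :
    face (hpoint v) F -> F != finset.set0 ->
  points (dact w (gen_class (set_class (cset v F)))) = flags (hpoint v) (rcons w 1) F.
Proof.
elim: w F => [|j w IH] F fF F0 /=.
  rewrite /points liftU scale1r; set c := set_class _.
  have [n [u [n0 QE]]] := polytope_config (repr c).
  have fT : face (hpoint u) [set: 'I_n]%SET by apply: faceT.
  have T0 : [set: 'I_n]%SET != finset.set0 by rewrite -cards_eq0 cardsT card_ord.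
  have [|phi iso] := @class_lattice_iso _ _ _ _ _ v u F [set: 'I_n]%SET fF fT F0 T0.
    rewrite -QE set_class_pset (_ : Polytope (repr c) = repr c); last by case: (repr c).
    by rewrite /comb_class reprK.
  have rE : (adim (repr c)).+1 = rk (hpoint v) F.
    rewrite QE adim_cset // (lattice_iso_rk iso fF fT) //; exact: face_hpoint0.
  rewrite -eqSS rE; case: eqP => r1.
    rewrite (bigD1 finset.set0) /=; last by rewrite face_hpoint0 finset.sub0set rk0 r1.
    by rewrite eqxx big1 ?addr0 // => S /andP[_ /negPf->].
  rewrite big1 // => S /and3P[fS SF /eqP rS]; case: eqP => // S0.
  by move: rS; rewrite S0 rk0 => /esym.
rewrite dend_class // dact_sum raddf_sum.
rewrite [RHS](bigID (fun S : {set I} => S != finset.set0)) /=.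
rewrite [X in _ = _ + X]big1 => [|S /andP[_ /negPn/eqP->]]; last first.
  by rewrite flags_set0 // has_rcons.
rewrite addr0; apply: eq_big => [S|S /and3P[fS SF /andP[S0 _]]]; last exact: IH.
by rewrite -!andbA [_ && (S != _)]andbC.
Qed.

Lemma prod_dopE w x : Dval (\prod_(j <- w) dop R j) x = dact (rev w) x.
Proof.
elim: w x => [|j w IH] x; first by rewrite big_nil.
by rewrite big_cons rev_cons /dact foldl_rcons -/(dact _ _) -IH.
Qed.

(** A configuration at height 1 has the same faces as the polytope of its points: a multiple of [h]
    absorbs the constant of an affine inequality. *)
Lemma flags_rows (I : finType) d (X : I -> 'cV[R]_d) (h : 'rV[R]_d) w :
    (forall i, ev h (X i) = 1) ->
  flags X w [set: I]%SET = flags (hpoint (fun i => (X i)^T)) w [set: I]%SET.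
Proof.
move=> h1; set Y := hpoint _.
have fE S : face X S = face Y S.
  apply/idP/idP => [/asboolP[l hl]|/face_hpointP[c [b hb]]].
    apply/face_hpointP; exists (- l^T), 0 => i; have := hl i.
    by rewrite mulmxN -trmx_mul mxE [_^T _ _]mxE -/(ev l (X i)) oppr_le0 oppr_eq0.
  apply/asboolP.
  exists (b *: h - c^T) => i; have := hb i; rewrite evBl evZl h1 mulr1.
  have -> : ev c^T (X i) = ((X i)^T *m c) 0 0.
    by rewrite /ev -[X in _ *m X]trmxK -trmx_mul mxE.
  by rewrite subr_ge0 subr_eq0 [b == _]eq_sym.
have X0 : face X finset.set0 by rewrite fE face_hpoint0.
apply: (@lattice_iso_flags _ _ _ _ _ X Y _ _ id) => //; last 3 first.
- exact: faceT.
- exact: faceT.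
- exact: face_hpoint0.
split=> [S fS SF|//|S fS SF]; first by rewrite -fE.
by exists S; rewrite fE.
Qed.

(** By [pairing_gens] the claim for every [c] follows from u = 0 in the free algebra. Words are
    reversed because in a product of operators the last factor acts first. *)
Lemma dop_relation (c : seq nat -> rat) (s : seq (int * seq nat)) : eulerian c ->
    \sum_(z <- s) (\prod_(j <- z.2) dop R j) *~ z.1 = 0 ->
  \sum_(z <- s) z.1%:~R * c (rev z.2) = 0.
Proof.
move=> ec s0; have free := oddalg_free.
pose u : oddalg := \sum_(z <- s) (z.1%:~R : rat) *: gens mo (rev z.2).
have pc c' : eulerian c' -> pairing free c' u = \sum_(z <- s) z.1%:~R * c' (rev z.2).
  move=> ec'; rewrite linear_sum; apply: eq_bigr => z _.
  by rewrite linearZ /= pairing_gens.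
suff u0 : u = 0 by rewrite -pc // u0 linear0.
(* [points_dact] appends the letter 1, so the relation controls the flag functionals at u d_1;
   afterwards [rcoef 0] recovers u. *)
have u1 : u * gen mo 0.*2.+1 = 0.
  apply: (@flag_funs_separate R _ _ free) => I d X h h1.
  have -> : u * gen mo 0.*2.+1 = \sum_(z <- s) (z.1%:~R : rat) *: gens mo (rcons (rev z.2) 1).
    rewrite mulr_suml; apply: eq_bigr => z _.
    by rewrite -scalerAl -(gens1 mo) -gens_cat cats1.
  rewrite linear_sum /=; have [I0|I0] := eqVneq [set: I]%SET finset.set0.
    rewrite big1 // => z _; rewrite linearZ /= pairing_gens; last exact: flag_fun_eulerian.
    by rewrite /flag_fun I0 flags_set0 ?has_rcons // rmorph0 scaler0.
  pose v i := (X i)^T; have fT := faceT (hpoint v).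
  set x := gen_class (set_class (cset v [set: I]%SET)).
  have : points (Dval (\sum_(z <- s) (\prod_(j <- z.2) dop R j) *~ z.1) x) = 0.
    by rewrite s0 raddf0.
  have -> : Dval (\sum_(z <- s) (\prod_(j <- z.2) dop R j) *~ z.1) =
      \sum_(z <- s) Dval (\prod_(j <- z.2) dop R j) *~ z.1.
    by rewrite -[LHS]/(\val _) raddf_sum; apply: eq_bigr => z _; rewrite raddfMz.
  rewrite endo_sumE raddf_sum => /(congr1 (fun z : int => z%:~R : rat)).
  rewrite rmorph_sum rmorph0 => E; rewrite -[RHS]E; apply: eq_bigr => z _.
  rewrite linearZ /= pairing_gens; last exact: flag_fun_eulerian.
  have pE : points (dact (rev z.2) x *~ z.1) = points (dact (rev z.2) x) *~ z.1.
    exact: raddfMz.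
  rewrite endo_mulzE prod_dopE pE (points_dact (rev z.2) fT I0) -(flags_rows _ h1).
  by rewrite -[X in _ = X%:~R]mulrzr [X in (_ * X)%:~R]intz rmorphM mulrC.
have := congr1 (rcoef free 0) u1; rewrite linear0 => E; rewrite -[RHS]E.
by rewrite rcoefM eqxx.
Qed.

End Operators.

(** * Quasi-symmetric functions *)

Section QuasiSymmetric.
Context (m : nat).
Implicit Types (a b : 'X_{1..m}) (g : {mpoly int[m]}) (w : seq nat).

Definition nz w : seq nat := [seq j <- w | (0 < j)%N].

Lemma nz_cat v w : nz (v ++ w) = nz v ++ nz w.
Proof. exact: filter_cat. Qed.

Lemma nz_id w : nz (nz w) = nz w.
Proof. by rewrite /nz filter_id. Qed.

Lemma sumn_nz w : sumn (nz w) = sumn w.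
Proof. by elim: w => //= j w <-; case: j. Qed.

Lemma size_nz w : (size (nz w) <= sumn w)%N.
Proof. by elim: w => //= j w IH; case: j => //= j; lia. Qed.

Lemma is_comp_nz w : is_comp (nz w).
Proof. exact: filter_all. Qed.

Lemma mnm_seq a : a = [seq a j | j <- enum 'I_m] :> seq nat.
Proof.
by rewrite -{1}[tval a]map_tnth_enum; apply: eq_map => i; rewrite mnm_tnth.
Qed.

Lemma mdeg_sumn a : mdeg a = sumn a.
Proof. by rewrite mdegE mnm_seq sumnE big_map big_enum. Qed.

Definition msup a : seq 'I_m := [seq j <- enum 'I_m | (0 < a j)%N].

Lemma nz_mnm a : nz a = [seq a j | j <- msup a].
Proof. by rewrite /nz mnm_seq filter_map. Qed.

Lemma msup_sorted a : sorted ltn [seq val i | i <- msup a].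
Proof.
have : subseq [seq val i | i <- msup a] (iota 0 m).
  by rewrite -val_enum_ord; apply/map_subseq/filter_subseq.
move=> /(subseq_sorted ltn_trans); apply; exact: iota_ltn_sorted.
Qed.

Definition spread w (l : (size w).-tuple 'I_m) : 'X_{1..m} :=
  [multinom \sum_(i < size w) (tnth l i == j) * nth 0 w i | j < m].

Lemma qmon_term w (l : (size w).-tuple 'I_m) :
  \prod_(i < size w) ('X_(tnth l i) : {mpoly int[m]}) ^+ nth 0%N w i = 'X_[spread l].
Proof.
under eq_bigr do rewrite mpolyXn.
rewrite mprodXE; congr mpolyX; apply/mnmP => j.
rewrite mnmE mnm_sumE; apply: eq_bigr => i _.
by rewrite mulmnE mnmE.
Qed.

Lemma spread_tnth w (l : (size w).-tuple 'I_m) i : uniq l ->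
  spread l (tnth l i) = nth 0%N w i.
Proof.
move=> ul; rewrite mnmE (bigD1 i) //= eqxx mul1n big1 ?addn0 // => i' ii'.
case: eqP => // e; case/eqP: ii'.
by move/tuple_uniqP: ul; apply.
Qed.

Lemma spread_out w (l : (size w).-tuple 'I_m) j : j \notin l -> spread l j = 0%N.
Proof.
move=> jl; rewrite mnmE big1 // => i _; case: eqP => // e.
by rewrite -e mem_tnth in jl.
Qed.

Lemma ord_sorted_uniq (l : seq 'I_m) : sorted ltn [seq val i | i <- l] -> uniq l.
Proof.
move=> h; rewrite -(map_inj_uniq val_inj); apply: (sorted_uniq ltn_trans) => //.
exact: ltnn.
Qed.

Lemma spread_msup w (l : (size w).-tuple 'I_m) : is_comp w ->
  sorted ltn [seq val i | i <- l] -> msup (spread l) = l.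
Proof.
move=> cw sl; have ul := ord_sorted_uniq sl; apply: (inj_map val_inj).
apply: (irr_sorted_eq ltn_trans ltnn (msup_sorted _) sl) => x.
congr (_ : bool); apply/mapP/mapP => -[j jl ->]; exists j => //.
  by move: jl; rewrite mem_filter; apply: contraLR => /spread_out->.
rewrite mem_filter mem_enum andbT; have /tnthP[i ->] := jl.
by rewrite spread_tnth //; have /allP := cw; apply; apply: mem_nth.
Qed.

Lemma mcoeff_qmon w a : is_comp w -> (qmon m w)@_a = (nz a == w)%:R.
Proof.
move=> cw; rewrite /qmon raddf_sum /=.
under eq_bigr do rewrite qmon_term mcoeffX.
have fwd (l : (size w).-tuple 'I_m) : sorted ltn [seq val i | i <- l] ->
    spread l = a -> nz a = w /\ msup a = l.
  move=> sl <-; rewrite nz_mnm spread_msup //; split=> //.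
  apply: (@eq_from_nth _ 0%N); first by rewrite size_map size_tuple.
  move=> i; rewrite size_map size_tuple => iw.
  have := spread_tnth (Ordinal iw) (ord_sorted_uniq sl) => /= <-.
  have x0 := tnth l (Ordinal iw).
  by rewrite (nth_map x0) ?size_tuple // (tnth_nth x0).
case: eqP => [aw|naw]; last first.
  by rewrite big1 // => l sl; case: eqP => // /(fwd l sl)[].
have sz : size (msup a) == size w by rewrite -aw nz_mnm size_map.
rewrite (bigD1 (Tuple sz)) /= ?msup_sorted // big1 ?addr0 => [|l /andP[sl nl]]; last first.
  by case: eqP => // /(fwd l sl)[_ E]; case/eqP: nl; apply: val_inj.
rewrite (_ : spread _ = a) ?eqxx //; apply/mnmP => j.
have ul := ord_sorted_uniq (msup_sorted a).
case: (boolP (j \in msup a)) => jl; last first.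
  by rewrite spread_out //; move: jl; rewrite mem_filter mem_enum andbT; case: (a j).
have /tnthP[i E] : j \in Tuple sz by [].
have wi : nth 0%N w i = nth 0%N [seq a j | j <- msup a] i by rewrite -nz_mnm aw.
rewrite {1}E spread_tnth // wi (nth_map j) ?(eqP sz) //.
by rewrite [in RHS]E (tnth_nth j).
Qed.

(** By [mcoeff_qmon], M_w is the sum of all monomials whose sequence of nonzero exponents is w. *)
Lemma QsymP g : Qsym g <-> exists c : seq nat -> int, forall a, g@_a = c (nz a).
Proof.
split=> [[s /allP hs ->]|[c hc]].
  exists (fun w => \sum_(z <- s) z.1 * (w == z.2)%:R) => a.
  rewrite raddf_sum big_seq [RHS]big_seq; apply: eq_bigr => z zs.
  by rewrite /= mcoeffZ mcoeff_qmon // hs.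
pose ws := undup [seq nz a | a <- msupp g].
exists [seq (c w, w) | w <- ws].
  by apply/allP => _ /mapP[w + ->]; rewrite mem_undup => /mapP[a _ ->]; apply: is_comp_nz.
rewrite big_map; apply/mpolyP => a; rewrite raddf_sum /= hc.
transitivity (\sum_(w <- ws) if w == nz a then c (nz a) else 0); last first.
  rewrite big_seq [RHS]big_seq; apply: eq_bigr => w.
  rewrite mem_undup => /mapP[b _ ->]; rewrite mcoeffZ mcoeff_qmon ?is_comp_nz //.
  by rewrite eq_sym; case: eqP => [->|]; rewrite ?mulr1 ?mulr0.
rewrite -big_mkcond; case: (boolP (nz a \in ws)) => aw.
  by rewrite -big_filter filter_pred1_uniq ?undup_uniq // big_seq1.
rewrite -hc memN_msupp_eq0; last first.
  by apply: contra aw => ag; rewrite mem_undup; apply/mapP; exists a.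
by rewrite big_seq_cond big1 // => w /andP[ww /eqP E]; rewrite -E ww in aw.
Qed.

Lemma msupp_pick g (f : 'X_{1..m} -> int) a :
  \sum_(b <- msupp g) f b * g@_b * (b == a)%:R = f a * g@_a.
Proof.
transitivity (\sum_(b <- msupp g) if b == a then f a * g@_a else 0).
  by apply: eq_bigr => b _; case: eqP => [->|]; rewrite ?mulr1 ?mulr0.
rewrite -big_mkcond; case: (boolP (a \in msupp g)) => ag.
  by rewrite -big_filter filter_pred1_uniq ?msupp_uniq // big_seq1.
rewrite memN_msupp_eq0 // mulr0 big_seq_cond big1 // => b /andP[bg /eqP E].
Qed.

Section Substitution.
Context (q q' : 'I_m) (qq' : q' = q.+1 :> nat).

Lemma q_neq : (q' == q) = false.
Proof. by apply/eqP => /(congr1 val) /=; rewrite qq'; lia. Qed.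

Definition repl b x y : 'X_{1..m} :=
  [multinom if j == q then x else if j == q' then y else b j | j < m].

Lemma repl_q b x y : repl b x y q = x. Proof. by rewrite mnmE eqxx. Qed.
Lemma repl_q' b x y : repl b x y q' = y. Proof. by rewrite mnmE q_neq eqxx. Qed.

Lemma prod_subst_opp a : \prod_(i < m) tnth (subst_opp q q') i ^+ a i =
  (-1) ^+ a q' *: ('X_[repl a (a q + a q') 0] : {mpoly int[m]}).
Proof.
rewrite (bigD1 q) //= (bigD1 q') /= ?q_neq // [in RHS]mpolyXE_id.
rewrite [in RHS](bigD1 q) //= [in RHS](bigD1 q') /= ?q_neq // repl_q repl_q' expr0 mul1r.
rewrite !tnth_mktuple eqxx [q == q']eq_sym q_neq [(- 'X_q) ^+ _]exprNn.
rewrite (eq_bigr (fun i => 'X_i ^+ repl a (a q + a q') 0 i)) => [|i /andP[iq iq']]; last first.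
  by rewrite tnth_mktuple mnmE (negPf iq) (negPf iq').
rewrite -[in LHS]signr_odd -[in RHS]signr_odd exprD mulr_sign scaler_sign.
by case: (odd _); rewrite ?mulNr ?mulrN !mulrA.
Qed.

Lemma prod_subst_zero a : \prod_(i < m) tnth (subst_zero q q') i ^+ a i =
  if (a q == 0%N) && (a q' == 0%N) then 'X_[a] : {mpoly int[m]} else 0.
Proof.
rewrite (bigD1 q) //= (bigD1 q') /= ?q_neq // !tnth_mktuple !eqxx orbT !expr0n.
case: eqP => [aq|]; last by rewrite mul0r.
case: eqP => [aq'|]; last by rewrite mul0r mulr0.
rewrite !mul1r mpolyXE_id [RHS](bigD1 q) //= [X in _ = _ * X](bigD1 q') /= ?q_neq //.
rewrite aq aq' !expr0 !mul1r; apply: eq_bigr => i /andP[iq iq'].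
by rewrite tnth_mktuple (negPf iq) (negPf iq').
Qed.

(** The monomials that the substitution sends to t^b, up to sign, are those that split the exponent
    [b q] between the two variables. *)
Lemma repl_eqP a b : b q' = 0%N ->
  (repl a (a q + a q') 0 == b)%:R =
  \sum_(i < (b q).+1) (a == repl b (b q - i) i)%:R :> int.
Proof.
move=> b0; case: eqP => [E|nE].
  have bq : b q = (a q + a q')%N by rewrite -E repl_q.
  have lt : (a q' < (b q).+1)%N by rewrite bq ltnS leq_addl.
  rewrite (bigD1 (Ordinal lt)) //= big1 => [|i ine]; last first.
    case: eqP => // Ei; case/eqP: ine; apply: val_inj => /=.
    by rewrite Ei repl_q'.
  rewrite addr0 (_ : a == _) //; apply/eqP/mnmP => j; rewrite mnmE -E mnmE.
  rewrite eqxx addnK mnmE; case: (j =P q) => [->//|_].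
  by case: (j =P q') => [->|].
rewrite big1 // => i _; case: eqP => // Ea; case: nE; apply/mnmP => j.
rewrite mnmE Ea repl_q repl_q' subnK; last by rewrite -ltnS ltn_ord.
case: (j =P q) => [->//|jq]; case: (j =P q') => [->|jq']; first by rewrite b0.
by rewrite mnmE; case: (j =P q) => // _; case: (j =P q').
Qed.

Lemma mcoeff_subst_opp g b : (g \mPo subst_opp q q')@_b =
  if b q' == 0%N then \sum_(i < (b q).+1) (-1) ^+ i * g@_(repl b (b q - i) i) else 0.
Proof.
rewrite comp_mpolyE raddf_sum /=.
under eq_bigr do rewrite prod_subst_opp mcoeffZ mcoeffZ mcoeffX.
case: eqP => [b0|b0]; last first.
  apply: big1 => a _; case: eqP => [E|_]; last by rewrite !mulr0.
  by case: b0; rewrite -E repl_q'.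
under eq_bigr do rewrite repl_eqP // !mulr_sumr.
rewrite exchange_big /=; apply: eq_bigr => i _.
have := msupp_pick g (fun a => (-1) ^+ a q') (repl b (b q - i) i).
rewrite /= repl_q' => <-; apply: eq_bigr => a _.
by rewrite !mulrA [_ * (-1) ^+ _]mulrC.
Qed.

Lemma mcoeff_subst_zero g b : (g \mPo subst_zero q q')@_b =
  if (b q == 0%N) && (b q' == 0%N) then g@_b else 0.
Proof.
rewrite comp_mpolyE raddf_sum /=.
have := msupp_pick g (fun a => ((a q == 0%N) && (a q' == 0%N))%:R) b => /=.
rewrite mulr_natl mulrb => <-; apply: eq_bigr => a _.
rewrite prod_subst_zero mcoeffZ; case: ifP => _; last by rewrite mcoeff0 mulr0 !mul0r.
by rewrite mcoeffX mul1r.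
Qed.

(** A monomial with [b q] and [b q'] both zero has the same coefficient on both sides, and one with
    [b q'] positive does not occur; what remains are the relations between coefficients for two
    adjacent letters. *)
Lemma subst_oppP g : (g \mPo subst_opp q q' = g \mPo subst_zero q q') <->
  forall b, b q' = 0%N -> (0 < b q)%N ->
    \sum_(i < (b q).+1) (-1) ^+ i * g@_(repl b (b q - i) i) = 0.
Proof.
split=> [E b b0 bq|h].
  have := congr1 (fun p => p@_b) E; rewrite /= mcoeff_subst_opp mcoeff_subst_zero.
  by rewrite b0 eqxx andbT; case: (b q) bq.
apply/mpolyP => b; rewrite mcoeff_subst_opp mcoeff_subst_zero andbC.
case: eqP => //= b0; case: eqP => [bq|/eqP]; last by rewrite -lt0n => /h->.
rewrite bq big_ord1 mul1r; congr (_@__); apply/mnmP => j; rewrite mnmE.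
by case: (j =P q) => [->|_]; rewrite ?bq //; case: (j =P q') => [->|].
Qed.

Lemma repl_seq b x y : repl b x y = take q b ++ x :: y :: drop q.+2 b :> seq nat.
Proof.
have sb : size b = m by rewrite size_tuple.
have qm := ltn_ord q; have qm' := ltn_ord q'; rewrite qq' in qm'.
have st : size (take q b) = q by rewrite size_takel // sb ltnW.
apply: (@eq_from_nth _ 0%N).
  rewrite size_tuple size_cat st /= size_drop sb; lia.
move=> i; rewrite size_tuple => im; rewrite -(mnm_nth 0%N _ (Ordinal im)) mnmE.
rewrite -!val_eqE /= qq' nth_cat st.
case: (ltngtP i q) => iq; first by rewrite nth_take // (mnm_nth 0%N); case: eqP => // E; lia.
  case: eqP => [->|iq1]; first by rewrite subSnn.
  have -> : (i - q)%N = (i - q.+2).+2 by lia.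
  by rewrite /= nth_drop (mnm_nth 0%N) /=; congr nth; lia.
by rewrite iq subnn.
Qed.

End Substitution.
End QuasiSymmetric.

Lemma int_mulrz (x y : int) : x *~ y = x * y.
Proof. by rewrite -mulrzr intz. Qed.

(** * The image of R_m^* and the construction of preimages *)

Section Functionals.
Context (R : realType).

Lemma Phi_coefE m (a : 'X_{1..m}) : Phi_coef R a = \prod_(j <- rev a) dop R j.
Proof.
have E : rev (enum 'I_m) = [seq rev_ord i | i <- enum 'I_m].
  apply: (inj_map val_inj); rewrite map_rev val_enum_ord -map_comp.
  rewrite (eq_map (g := (fun i => m - i.+1)%N \o val)) // map_comp val_enum_ord.
  apply: (@eq_from_nth _ 0%N); rewrite ?size_rev ?size_map ?size_iota // => i im.
  by rewrite nth_rev ?size_iota // (nth_map 0%N) ?size_iota // !nth_iota //; lia.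
by rewrite /Phi_coef mnm_seq -map_rev big_map E big_map enumT unlock.
Qed.

Lemma alternating_rev (V : zmodType) (f : nat -> V) k :
  \sum_(i < k.+1) f (k - i)%N *~ (-1) ^+ i =
  (\sum_(i < k.+1) f i *~ (-1) ^+ i) *~ (-1) ^+ k.
Proof.
rewrite mulrz_suml (reindex_inj rev_ord_inj) /=; apply: eq_bigr => i _.
rewrite subSS subKn; last by rewrite -ltnS.
rewrite -mulrzA -exprD; congr (_ *~ _).
rewrite -signr_odd oddB; last by rewrite -ltnS.
by rewrite -[in RHS]signr_odd oddD addbC.
Qed.

Lemma prod_nz w : \prod_(j <- nz w) dop R j = \prod_(j <- w) dop R j.
Proof.
rewrite big_filter big_mkcond; apply: eq_bigr => j _.
by case: j => //; rewrite dop0.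
Qed.

Lemma Rstar_Qsym m (psi : Ddual R) : Qsym (Rstar m psi).
Proof.
apply/QsymP; exists (fun w => psi (\prod_(j <- rev w) dop R j)) => a.
rewrite mcoeff_Rstar Phi_coefE; congr (psi _).
by rewrite -prod_nz /nz filter_rev.
Qed.

Lemma Rstar_homog m n (psi : Ddual R) : Ddual_comp n psi -> Rstar m psi \is n.-homog.
Proof.
move=> hpsi; apply/dhomogP => a; rewrite mcoeff_msupp mcoeff_Rstar.
by apply: contraNeq => an; apply/eqP; apply: hpsi an (Phi_coef_comp R a).
Qed.

(** The factors of consecutive variables are adjacent in Phi(t_m) ... Phi(t_1), so each identity of
    coefficients is the value of [psi] at a two-sided multiple of the relation [dop_euler]. *)
Lemma Rstar_relation m (psi : Ddual R) (q q' : 'I_m) : q' = q.+1 :> nat ->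
  Rstar m psi \mPo subst_opp q q' = Rstar m psi \mPo subst_zero q q'.
Proof.
move=> qq'; apply/(subst_oppP qq') => b b0 bq.
set k := b q in bq *.
pose u := \prod_(j <- rev (drop q.+2 b)) dop R j.
pose v := \prod_(j <- rev (take q b)) dop R j.
transitivity (psi (u * (\sum_(i < k.+1) (dop R i * dop R (k - i)) *~ (-1) ^+ i) * v)).
  rewrite mulr_sumr mulr_suml raddf_sum; apply: eq_bigr => i _.
  rewrite mcoeff_Rstar Phi_coefE (repl_seq qq') rev_cat !rev_cons -!cats1 !big_cat !big_seq1 /=.
  rewrite mulrzAr mulrzAl raddfMz -mulrzr intz mulrC; congr (psi _ * _).
  by rewrite !mulrA.
rewrite (_ : \sum_(i < k.+1) _ = 0) ?mulr0 ?mul0r ?raddf0 //.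
have := alternating_rev (fun i => dop R (k - i) * dop R i) k.
rewrite (dop_euler R bq) mul0rz => E; rewrite -[RHS]E; apply: eq_bigr => i _.
by rewrite subKn // -ltnS.
Qed.

Section Extension.
Context (c : seq nat -> int) (n : nat).
Hypothesis c_eulerian : eulerian (fun w => (c w)%:~R : rat).
Hypothesis c_homog : forall w, sumn w != n -> c w = 0.

Definition combo (s : seq (int * seq nat)) : Dring R :=
  \sum_(z <- s) (\prod_(j <- z.2) dop R j) *~ z.1.

Definition value (s : seq (int * seq nat)) : int := \sum_(z <- s) z.1 * c (rev z.2).

Definition opp_combo (s : seq (int * seq nat)) := [seq (- z.1, z.2) | z <- s].

Lemma combo_opp s : combo (opp_combo s) = - combo s.
Proof. by rewrite /combo big_map -sumrN; apply: eq_bigr => z _; rewrite mulrNz. Qed.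

Lemma value_opp s : value (opp_combo s) = - value s.
Proof. by rewrite /value big_map -sumrN; apply: eq_bigr => z _; rewrite mulNr. Qed.

Lemma combo_cat s t : combo (s ++ t) = combo s + combo t.
Proof. exact: big_cat. Qed.

Lemma value_cat s t : value (s ++ t) = value s + value t.
Proof. exact: big_cat. Qed.

(** This makes [functional] independent of the chosen expression; the integers are embedded in the
    rationals, over which [dop_relation] is stated. *)
Lemma value_eq0 s : combo s = 0 -> value s = 0.
Proof.
move=> /(dop_relation c_eulerian) h; apply/eqP; rewrite -(intr_eq0 rat) rmorph_sum.
by apply/eqP; rewrite -[RHS]h; apply: eq_bigr => z _; rewrite rmorphM.
Qed.

(** The combinations form a subring containing the generators, and membership in [Dpred] means lying
    in every such subring. *)
Lemma combo_surj (x : Dring R) : exists s, combo s = x.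
Proof.
pose S : {pred endo (polyZ R)} := fun y => `[< exists s, Dval (combo s) = y >].
suff : Dval x \in S by move=> /asboolP[s E]; exists s; apply: val_inj.
have /asboolP := DvalP x; apply; first split.
- by apply/asboolP; exists [:: (1, [::])]; rewrite /combo big_seq1 big_nil.
- move=> _ _ /asboolP[s <-] /asboolP[t <-]; apply/asboolP; exists (s ++ opp_combo t).
  by rewrite combo_cat combo_opp.
- move=> _ _ /asboolP[s <-] /asboolP[t <-]; apply/asboolP.
  exists [seq (z.1 * z'.1, z.2 ++ z'.2) | z <- s, z' <- t].
  rewrite -[RHS]/(Dval (combo s * combo t)); congr Dval.
  rewrite /combo big_allpairs_dep mulr_suml; apply: eq_bigr => z _.
  rewrite mulr_sumr; apply: eq_bigr => z' _.
  by rewrite big_cat /= mulrzAl mulrzAr -mulrzA mulrC.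
- by move=> k k0; apply/asboolP; exists [:: (1, [:: k])]; rewrite /combo big_seq1 big_seq1.
Qed.

Definition functional (x : Dring R) : int := value (sval (cid (combo_surj x))).

Lemma functional_combo s : functional (combo s) = value s.
Proof.
rewrite /functional; case: cid => t E /=; apply/eqP; rewrite -subr_eq0 -value_opp -value_cat.
by apply/eqP/value_eq0; rewrite combo_cat combo_opp E subrr.
Qed.

Lemma functional_zmod_morphism : zmod_morphism functional.
Proof.
move=> x y; have [s <-] := combo_surj x; have [t <-] := combo_surj y.
by rewrite -combo_opp -combo_cat !functional_combo value_cat value_opp.
Qed.
HB.instance Definition _ :=
  GRing.isZmodMorphism.Build (Dring R) int functional functional_zmod_morphism.

Lemma functional_comp k x : k != n -> Dcomp k x -> functional x = 0.
Proof.
move=> kn [s /allP hs ->]; rewrite -/(combo s) functional_combo /value big_seq big1 // => z zs.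
have /andP[_ /eqP zk] := hs z zs.
by rewrite c_homog ?mulr0 // sumn_rev zk.
Qed.

Lemma functional_bounded :
  exists N : nat, forall k x, (N <= k)%N -> Dcomp k x -> functional x = 0.
Proof. by exists n.+1 => k x nk; apply: functional_comp; rewrite gtn_eqF. Qed.

Definition Ddual_of : Ddual R :=
  MkDdual (Ddual_fun := functional : {additive Dring R -> int}) functional_bounded.

Lemma Ddual_of_comp : Ddual_comp n Ddual_of.
Proof. by move=> k x; apply: functional_comp. Qed.

Lemma Ddual_of_Phi m (a : 'X_{1..m}) : Ddual_of (Phi_coef R a) = c a.
Proof.
have E : Phi_coef R a = combo [:: (1, rev a)] by rewrite /combo big_seq1 /= Phi_coefE.
by rewrite E [LHS]functional_combo /value big_seq1 /= revK mul1r.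
Qed.
End Extension.
End Functionals.

Section Coefficients.
Context (m n : nat) (hmn : (n <= m)%N) (g : {mpoly int[m]}) (c0 : seq nat -> int).
Hypothesis g_coef : forall a, g@_a = c0 (nz a).
Hypothesis g_rel : forall q q' : 'I_m, q' = q.+1 :> nat ->
  g \mPo subst_opp q q' = g \mPo subst_zero q q'.

(** A word of degree n has at most n nonzero letters, so for n <= m all values in degree n are
    coefficients of [g]. *)
Definition coef_fun (w : seq nat) : int := if sumn w == n then c0 (nz w) else 0.

Lemma coef_fun_nz v w t : coef_fun (v ++ t ++ w) = coef_fun (nz v ++ t ++ nz w).
Proof. by rewrite /coef_fun !sumn_cat !sumn_nz !nz_cat !nz_id. Qed.

Lemma coef_fun_eulerian : eulerian (fun w => (coef_fun w)%:~R : rat).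
Proof.
split=> [v w|v w k k0]; first by rewrite /coef_fun !sumn_cat !nz_cat.
pose f i := coef_fun (v ++ i :: (k - i)%N :: w).
suff f0 : \sum_(i < k.+1) f i *~ (-1) ^+ i = 0.
  transitivity ((\sum_(i < k.+1) f i *~ (-1) ^+ i)%:~R : rat); last by rewrite f0.
  rewrite rmorph_sum; apply: eq_bigr => i _.
  by rewrite int_mulrz rmorphM rmorphXn rmorphN1 mulrC.
have [vn|vn] := eqVneq (sumn v + k + sumn w)%N n; last first.
  rewrite big1 // => i _; rewrite /f /coef_fun sumn_cat /= ifN ?mul0rz //.
  by apply: contra vn => /eqP <-; have := ltn_ord i; lia.
(* For k = 1 the two terms cancel. For k >= 2, the words [nz v] and [nz w] have together at most n -
   2 letters, which leaves two variables for the relation. *)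
have [k1|k1] := eqVneq k 1%N.
  rewrite k1 !big_ord_recr big_ord0 /f k1 /= /coef_fun !sumn_cat /= !nz_cat /=.
  by rewrite add0r mulr1z mulrNz subrr.
have Lm : (size (nz v) + 2 + size (nz w) <= m)%N.
  by have := size_nz v; have := size_nz w; lia.
have qm : (size (nz v) < m)%N by lia.
have qm' : ((size (nz v)).+1 < m)%N by lia.
pose q := Ordinal qm; pose q' := Ordinal qm'.
(* The default 0 of [nth] fills the remaining variables, and these zeros disappear under [nz]. *)
pose b : 'X_{1..m} := [multinom nth 0%N (nz v ++ k :: 0%N :: nz w) j | j < m].
have bE : take q b = nz v :> seq nat /\
    drop q.+2 b = nz w ++ nseq (m - (size (nz v) + 2 + size (nz w))) 0%N :> seq nat.
  have bs : b = nz v ++ k :: 0%N :: nz w ++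
      nseq (m - (size (nz v) + 2 + size (nz w))) 0%N :> seq nat.
    apply: (@eq_from_nth _ 0%N).
      by rewrite size_tuple size_cat /= size_cat size_nseq; lia.
    move=> i; rewrite size_tuple => im.
    rewrite -(mnm_nth 0%N _ (Ordinal im)) mnmE /= -cat_cons -cat_cons catA [RHS]nth_cat.
    case: ltnP => // hi; rewrite nth_default //; rewrite nth_nseq; by case: ifP.
  rewrite bs take_size_cat //; split=> //.
  rewrite -(cat1s k) -(cat1s 0%N) catA catA drop_size_cat //.
  by rewrite !size_cat /= ?addn1.
have bq : b q = k by rewrite mnmE /= nth_cat ltnn subnn.
have bq' : b q' = 0%N by rewrite mnmE /= nth_cat ltnNge leqnSn /= subSnn.
have := (subst_oppP (erefl : q' = q.+1 :> nat) g).1 (g_rel (erefl : q' = q.+1 :> nat)) b bq'.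
rewrite bq => /(_ k0) E.
(* The coefficient identity carries the letters k - i and i in this order, hence the reversed
   sum. *)
have /eqP := alternating_rev f k.
have -> : \sum_(i < k.+1) f (k - i)%N *~ (-1) ^+ i = 0.
  rewrite -[RHS]E; apply: eq_bigr => i _; rewrite int_mulrz mulrC; congr (_ * _).
  have ik : (i <= k)%N by rewrite -ltnS.
  rewrite g_coef (repl_seq (erefl : q' = q.+1 :> nat)) bE.1 bE.2.
  rewrite /f subKn // -[_ :: _ :: w]/([:: _; _] ++ w) coef_fun_nz /coef_fun.
  rewrite !sumn_cat !sumn_nz /= addn0 subnK // addnA vn eqxx.
  congr c0; rewrite !nz_cat !nz_id /= /nz !filter_cat !filter_id.
  by rewrite (_ : [seq j <- nseq _ _ | _] = [::]) ?cats0 //; elim: (m - _)%N.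
by rewrite eq_sym int_mulrz mulf_eq0 signr_eq0 orbF => /eqP.
Qed.
End Coefficients.

Theorem proposition24 (R : realType) (m n : nat) (hmn : (n <= m)%N) :
  [set Rstar m psi | psi in @Ddual_comp R n] =
  [set g : {mpoly int[m]} |
    [/\ Qsym g, g \is n.-homog &
        forall q q' : 'I_m, q' = q.+1 :> nat ->
          g \mPo subst_opp q q' = g \mPo subst_zero q q']].
Proof.
apply/seteqP; split=> [_ [psi hpsi <-]|g [/QsymP[c0 hc] hg hrel]] /=.
  split; [exact: Rstar_Qsym|exact: Rstar_homog|exact: Rstar_relation].
have ec := coef_fun_eulerian hmn hc hrel.
have hz w : sumn w != n -> coef_fun n c0 w = 0 by rewrite /coef_fun => /negPf->.
exists (Ddual_of R ec hz); first exact: Ddual_of_comp.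
apply/mpolyP => a; rewrite mcoeff_Rstar Ddual_of_Phi /coef_fun -mdeg_sumn -hc.
case: eqP => // /eqP an; apply/esym/memN_msupp_eq0.
by apply: contra an => ag; apply/eqP; move/dhomogP: hg; apply.
Qed.
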